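(* Let $\sigma$ be a SODE on $M$. The Chern connection $\nabla^\sigma$ attached to $\sigma$ is the only linear connection on $M^1$ which is reducible to the $G$-structure $\pi\colon P^\sigma\to M^1$ of linear frames adapted to $\sigma$ and whose torsion tensor field is $$T^\sigma=K^\sigma+dt\wedge\bigl(H^\sigma\circ\varepsilon^{-1}\circ(L_{X^\sigma}J)^v\bigr),$$ where $K^\sigma$ is the curvature form of the splitting $H^\sigma$.
   Context: $M$ is a connected smooth manifold of dimension $n$; $M^0=\mathbb{R}\times M$ with projections $p\colon M^0\to\mathbb{R}$, $p'\colon M^0\to M$; $M^r=J^r(\mathbb{R},M)$ is the manifold of $r$-jets of smooth maps $\mathbb{R}\to M$, with projections $p^{rs}\colon M^r\to M^s$. Coordinates $(x^i)$ on $M$ induce coordinates $(t,x^i,\dot x^i)$ on $M^1$ and $(t,x^i,\dot x^i,\ddot x^i)$ on $M^2$. The summation convention is used. A SODE on $M$ is a smooth section $\sigma\colon M^1\to M^2$ of $p^{21}$; in coordinates $F^i=\ddot x^i\circ\sigma$. Put $X^\sigma=\frac{\partial}{\partial t}+\dot x^i\frac{\partial}{\partial x^i}+F^i\frac{\partial}{\partial\dot x^i}$ (globally defined), $X^\sigma_i=\frac{\partial}{\partial x^i}+\frac12\frac{\partial F^j}{\partial\dot x^i}\frac{\partial}{\partial\dot x^j}$, $\omega^i=dx^i-\dot x^idt$. $J=\omega^i\otimes\frac{\partial}{\partial\dot x^i}$ is the fundamental tensor of $M^1$, and $L_{X^\sigma}J$ its Lie derivative along $X^\sigma$. $V(p^{10})$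 is the bundle of $p^{10}$-vertical vectors; $\varepsilon\colon(p'\circ p^{10})^*TM\to V(p^{10})$ is the canonical isomorphism $\varepsilon(\partial/\partial x^i)=\partial/\partial\dot x^i$; $H^\sigma\colon(p^{10})^*TM^0\to TM^1$ is $H^\sigma=dt\otimes X^\sigma+\omega^i\otimes X^\sigma_i$; since $(p'\circ p^{10})^*TM\subset(p^{10})^*TM^0$, $H^\sigma\circ\varepsilon^{-1}$ is defined on $V(p^{10})$ and maps $\partial/\partial\dot x^i$ to $X^\sigma_i$. Every $X\in TM^1$ decomposes as $X=X^h+X^v$ with $X^h=H^\sigma((p^{10})_*X)$, $X^v=X-X^h\in V(p^{10})$. $(L_{X^\sigma}J)^v$ is the endomorphism $X\mapsto((L_{X^\sigma}J)(X))^v$. The curvature form of $H^\sigma$ is $K^\sigma(X,Y)=-[X^h,Y^h]^v$, $X,Y\in\mathfrak{X}(M^1)$. Conventions: torsion is $\nabla_XY-\nabla_YX-[X,Y]$; $(dt\wedge A)(X,Y)=dt(X)A(Y)-dt(Y)A(X)$. A linear frame $(X_0,\dots,X_{2n})$ of $T_\xi M^1$ is adapted to $\sigma$ if $X_0=(X^\sigma)_\xi$, $X_{n+i}$ is $p^{10}$-vertical, and $X_i=(H^\sigma\circ\varepsilon^{-1})(X_{n+i})$ for $1\le i\le n$. The adapted frames form a $G$-structure $P^\sigma\subset F(M^1)$, where $G=\{\mathrm{diag}(1,\Lambda,\Lambda):\Lambda\in Gl(n,\mathbb{R})\}\subset Gl(2n+1,\mathbb{R})$. The Chern connection $\nabla^\sigma$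 is the linear connection on $M^1$ given in every induced coordinate system by $\nabla^\sigma_YX^\sigma=0$ for all $Y$; $\nabla^\sigma_{X^\sigma}X^\sigma_i=-\frac12\frac{\partial F^j}{\partial\dot x^i}X^\sigma_j$, $\nabla^\sigma_{X^\sigma}\frac{\partial}{\partial\dot x^i}=-\frac12\frac{\partial F^j}{\partial\dot x^i}\frac{\partial}{\partial\dot x^j}$; $\nabla^\sigma_{X^\sigma_j}X^\sigma_i=-\frac12\frac{\partial^2F^k}{\partial\dot x^i\partial\dot x^j}X^\sigma_k$, $\nabla^\sigma_{X^\sigma_j}\frac{\partial}{\partial\dot x^i}=-\frac12\frac{\partial^2F^k}{\partial\dot x^i\partial\dot x^j}\frac{\partial}{\partial\dot x^k}$; $\nabla^\sigma_{\partial/\partial\dot x^j}X^\sigma_i=0$, $\nabla^\sigma_{\partial/\partial\dot x^j}\frac{\partial}{\partial\dot x^i}=0$. *)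

(* Defs.v *)
From HB Require Import structures.
From mathcomp Require Import all_boot all_order all_algebra.
From mathcomp Require Import all_classical all_reals topology normedtype derive.

Set Implicit Arguments.
Unset Strict Implicit.
Unset Printing Implicit Defensive.

Import Order.TTheory GRing.Theory Num.Theory.
Import numFieldNormedType.Exports.
Local Open Scope classical_set_scope.
Local Open Scope ring_scope.

(* On finite-dimensional spaces and open U this is the usual C^k: the
   derivatives along all fixed directions are iterated. *)
Fixpoint Ck (R : realType) (V W : normedModType R) (k : nat) (U : set V)
    (f : V -> W) : Prop :=
  if k is k'.+1 then
    (forall x, U x -> differentiable f x) /\
    (forall v, Ck k' U (fun x => 'D_v f x))
  else forall x, U x -> {for x, continuous f}.

Definition smooth_on (R : realType) (V W : normedModType R) (U : set V)
  (f : V -> W) : Prop := forall k, Ck k U f.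

(* [lrep U phi f] is the local representative f \o phi^-1 of f on phi(U),
   extended by 0, for phi injective on U. *)
Definition lrep (R : realType) (T : Type) (E V : normedModType R) (U : set T)
    (phi : T -> E) (f : T -> V) : E -> V :=
  fun y => xget 0 [set f p | p in U `&` phi @^-1` [set y]].

(* A family of charts (only the values of [coord i] on [dom i] matter). *)
Record atlas (R : realType) (T : Type) (d : nat) := Atlas {
  idx : Type ;
  dom : idx -> set T ;
  coord : idx -> T -> 'rV[R]_d }.

Arguments idx {R T d} _.
Arguments dom {R T d} _ _ _.
Arguments coord {R T d} _ _ _.

Definition is_chart (R : realType) (M : topologicalType) (n : nat) (U : set M)
    (phi : M -> 'rV[R]_n) : Prop :=
  [/\ open U, set_inj U phi, forall p, U p -> {for p, continuous phi} &
      forall V : set M, open V -> V `<=` U -> open (phi @` V)].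

Definition transition_smooth (R : realType) (M : topologicalType) (n : nat)
    (U : set M) (phi : M -> 'rV[R]_n) (U' : set M) (phi' : M -> 'rV[R]_n) : Prop :=
  smooth_on (phi @` (U `&` U')) (lrep U phi phi').

Record smooth_manifold (R : realType) (M : topologicalType) (n : nat)
    (A : atlas R M n) : Prop := SmoothManifold {
  sm_hausdorff : hausdorff_space M ;
  sm_countable : @second_countable M ;
  sm_cover : forall p, exists i, dom A i p ;
  sm_chart : forall i, is_chart (dom A i) (coord A i) ;
  sm_compat : forall i j,
    transition_smooth (dom A i) (coord A i) (dom A j) (coord A j) ;
  sm_maximal : forall (U : set M) (phi : M -> 'rV[R]_n), is_chart U phi ->
    (forall i, transition_smooth U phi (dom A i) (coord A i) /\
               transition_smooth (dom A i) (coord A i) U phi) ->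
    exists i, dom A i = U /\ (forall p, U p -> coord A i p = phi p) }.

Section Calculus.
Variables (R : realType) (T : Type) (d : nat) (A : atlas R T d).

Definition rep (V : normedModType R) (i : idx A) (f : T -> V) :=
  lrep (dom A i) (coord A i) f.

(* Open for the topology induced by the charts. *)
Definition mopen (U : set T) : Prop :=
  forall i, open (coord A i @` (dom A i `&` U)).

Definition smooth_fun (U : set T) (f : T -> R) : Prop :=
  forall i, smooth_on (coord A i @` (dom A i `&` U)) (rep i f).

Definition partial (V : normedModType R) (i : idx A) (a : 'I_d) (f : T -> V) :
    T -> V :=
  fun p => 'D_(delta_mx 0 a) (rep i f) (coord A i p).

(* A tangent vector at p is the family of its components in the charts around
   p, subject to the usual transformation rule; the components in charts whose
   domain does not contain p are irrelevant, whence [veq]. *)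
Definition tvec := idx A -> 'rV[R]_d.

Definition veq (p : T) (v w : tvec) : Prop :=
  forall i, dom A i p -> v i = w i.

(* The vector at p with components w in the chart i. *)
Definition tv (i : idx A) (p : T) (w : 'rV[R]_d) : tvec :=
  fun j => 'D_w (rep i (coord A j)) (coord A i p).

Definition is_tvec (p : T) (v : tvec) : Prop :=
  forall i, dom A i p -> veq p v (tv i p (v i)).

(* df_p(v), computed in any chart around p. *)
Definition dfun (f : T -> R) (p : T) (v : tvec) : R :=
  xget 0 [set 'D_(v i) (rep i f) (coord A i p) | i in [set i | dom A i p]].

Definition vfield := T -> tvec.

Definition smooth_vfield (U : set T) (X : vfield) : Prop :=
  (forall p, U p -> is_tvec p (X p)) /\
  (forall i, smooth_on (coord A i @` (dom A i `&` U)) (rep i (fun p => X p i))).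

Definition bracket (X Y : vfield) : vfield := fun p i =>
  'D_(X p i) (rep i (fun q => Y q i)) (coord A i p)
  - 'D_(Y p i) (rep i (fun q => X q i)) (coord A i p).

Definition lie_endo (X : vfield) (S : T -> tvec -> tvec) (Y : vfield) : vfield :=
  fun p => bracket X (fun q => S q (Y q)) p - S p (bracket X Y p).

(* A linear connection, as an operator on local vector fields: [cov Y X] is
   nabla_Y X, its values being meaningful on any open set on which both
   arguments are smooth vector fields. *)
Record linear_connection := LinearConnection {
  cov :> vfield -> vfield -> vfield ;
  cov_smooth : forall U Y X, mopen U -> smooth_vfield U Y ->
    smooth_vfield U X -> smooth_vfield U (cov Y X) ;
  cov_local : forall U Y Y' X X', mopen U ->
    smooth_vfield U Y -> smooth_vfield U Y' ->
    smooth_vfield U X -> smooth_vfield U X' ->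
    (forall p, U p -> veq p (Y p) (Y' p)) ->
    (forall p, U p -> veq p (X p) (X' p)) ->
    forall p, U p -> veq p (cov Y X p) (cov Y' X' p) ;
  cov_addl : forall U Y Y' X, mopen U -> smooth_vfield U Y ->
    smooth_vfield U Y' -> smooth_vfield U X ->
    forall p, U p ->
      veq p (cov (fun q => Y q + Y' q) X p) (cov Y X p + cov Y' X p) ;
  cov_scalel : forall U f Y X, mopen U -> smooth_fun U f ->
    smooth_vfield U Y -> smooth_vfield U X ->
    forall p, U p -> veq p (cov (fun q => f q *: Y q) X p) (f p *: cov Y X p) ;
  cov_addr : forall U Y X X', mopen U -> smooth_vfield U Y ->
    smooth_vfield U X -> smooth_vfield U X' ->
    forall p, U p ->
      veq p (cov Y (fun q => X q + X' q) p) (cov Y X p + cov Y X' p) ;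
  cov_leibniz : forall U f Y X, mopen U -> smooth_fun U f ->
    smooth_vfield U Y -> smooth_vfield U X ->
    forall p, U p -> veq p (cov Y (fun q => f q *: X q) p)
                           (dfun f p (Y p) *: X p + f p *: cov Y X p) }.

Definition conn_eq (D D' : linear_connection) : Prop :=
  forall U Y X, mopen U -> smooth_vfield U Y -> smooth_vfield U X ->
  forall p, U p -> veq p (D Y X p) (D' Y X p).

Definition torsion (D : linear_connection) (X Y : vfield) : vfield :=
  fun p => D X Y p - D Y X p - bracket X Y p.

Definition frame := 'I_d -> tvec.

Definition is_frame (p : T) (u : frame) : Prop :=
  (forall a, is_tvec p (u a)) /\
  (forall i, dom A i p -> (\matrix_(a < d) u a i) \in unitmx).

(* D is reducible to the subbundle P of the bundle of linear frames: the
   horizontal subspace of D at every frame u in P is tangent to P.  The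
   horizontal lift of v to u is S_*(v) for any local section S of the frame
   bundle with S(p) = u and nabla_v S_a = 0 for all a; it is tangent to P iff S
   can be chosen to be a section of P. *)
Definition reducible (D : linear_connection) (P : T -> frame -> Prop) : Prop :=
  forall (p : T) (u : frame) (v : tvec), P p u -> is_tvec p v ->
  exists (U : set T) (S : 'I_d -> vfield) (Y : vfield),
    [/\ mopen U /\ U p,
        (forall a, smooth_vfield U (S a)) /\
          (forall q, U q -> P q (fun a => S a q)),
        forall a, veq p (S a p) (u a),
        smooth_vfield U Y /\ veq p (Y p) v &
        forall a, veq p (D Y (S a) p) 0].

End Calculus.

Arguments mopen {R T d} A U.
Arguments partial {R T d} A {V} i a f.
Arguments tv {R T d} A i p w.
Arguments tvec {R T d} A.
Arguments vfield {R T d} A.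
Arguments frame {R T d} A.
Arguments linear_connection {R T d} A.

Section Maps.
Variables (R : realType) (T T' : Type) (d d' : nat).
Variables (A : atlas R T d) (B : atlas R T' d').

Definition smooth_map (f : T -> T') : Prop :=
  forall i j, open (coord A i @` (dom A i `&` f @^-1` dom B j)) /\
    smooth_on (coord A i @` (dom A i `&` f @^-1` dom B j))
              (rep i (coord B j \o f)).

(* f_* v for v tangent at p, computed in any chart around p. *)
Definition tmap (f : T -> T') (p : T) (v : tvec A) : tvec B := fun j =>
  xget 0 [set 'D_(v i) (rep i (coord B j \o f)) (coord A i p)
         | i in [set i | dom A i p]].

End Maps.

Arguments smooth_map {R T T' d d'} A B f.
Arguments tmap {R T T' d d'} A B f p v.

Section Jets.
Variables (R : realType) (M : topologicalType) (n : nat) (A : atlas R M n).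

Definition smooth_curve (g : R -> M) : Prop :=
  continuous g /\
  forall i, smooth_on [set t | dom A i (g t)] (coord A i \o g).

Definition same_jet (r : nat) (t : R) (g h : R -> M) : Prop :=
  g t = h t /\
  forall i, dom A i (g t) -> forall k, (k <= r)%N ->
    derive1n k (coord A i \o g) t = derive1n k (coord A i \o h) t.

Definition jet_class (r : nat) (t : R) (g : R -> M) : set (R -> M) :=
  [set h | smooth_curve h /\ same_jet r t g h].

Record jet (r : nat) := Jet {
  jtime : R ;
  jcurves : set (R -> M) ;
  jcurvesP : exists2 g, smooth_curve g & jcurves = jet_class r jtime g }.

Definition jrepr (r : nat) (xi : jet r) : R -> M := s2val (cid2 (jcurvesP xi)).

Definition jrepr_smooth (r : nat) (xi : jet r) : smooth_curve (jrepr xi) :=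
  s2valP (cid2 (jcurvesP xi)).

Definition mkjet (r : nat) (t : R) (g : R -> M) (hg : smooth_curve g) : jet r :=
  @Jet r t (jet_class r t g) (ex_intro2 _ _ g hg erefl).

(* p^{rs}, for s <= r *)
Definition jproj (r s : nat) (xi : jet r) : jet s :=
  mkjet s (jtime xi) (jrepr_smooth xi).

Definition jtarget (r : nat) (xi : jet r) : M := jrepr xi (jtime xi).

(* The coordinates x^i, \dot x^i, \ddot x^i for k = 0, 1, 2. *)
Definition jcoord (r : nat) (i : idx A) (k : nat) (xi : jet r) : 'rV[R]_n :=
  derive1n k (coord A i \o jrepr xi) (jtime xi).

(* M^0, M^1 and M^2 with the charts induced by those of M: (t, x),
   (t, x, \dot x) and (t, x, \dot x, \ddot x). *)
Definition M0 : atlas R (R * M) (1 + n) :=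
  @Atlas R (R * M) (1 + n) (idx A)
    (fun i => [set z | dom A i z.2])
    (fun i z => row_mx (z.1)%:M (coord A i z.2)).

Definition M1 : atlas R (jet 1) (1 + (n + n)) :=
  @Atlas R (jet 1) (1 + (n + n)) (idx A)
    (fun i => [set xi | dom A i (jtarget xi)])
    (fun i xi => row_mx (jtime xi)%:M (row_mx (jcoord i 0 xi) (jcoord i 1 xi))).

Definition M2 : atlas R (jet 2) (1 + (n + (n + n))) :=
  @Atlas R (jet 2) (1 + (n + (n + n))) (idx A)
    (fun i => [set xi | dom A i (jtarget xi)])
    (fun i xi => row_mx (jtime xi)%:M
       (row_mx (jcoord i 0 xi) (row_mx (jcoord i 1 xi) (jcoord i 2 xi)))).

Definition p10 (xi : jet 1) : R * M := (jtime xi, jtarget xi).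

Record sode := Sode {
  sigma :> jet 1 -> jet 2 ;
  sigma_section : forall xi, jproj 1 (sigma xi) = xi ;
  sigma_smooth : smooth_map M1 M2 sigma }.

(* Positions of t, x^i and \dot x^i in the coordinates of M^1. *)
Definition it : 'I_(1 + (n + n)) := lshift (n + n) ord0.
Definition ix (i : 'I_n) : 'I_(1 + (n + n)) := rshift 1 (lshift n i).
Definition iv (i : 'I_n) : 'I_(1 + (n + n)) := rshift 1 (rshift n i).

(* The forms dt and omega^i = dx^i - \dot x^i dt (i-th entry of the row), on
   T M^1 and on (p^{10})^* T M^0. *)
Definition dt (xi : jet 1) (v : tvec M1) : R := dfun (@jtime 1) xi v.

Definition dt0 (xi : jet 1) (w : tvec M0) : R := dfun fst (p10 xi) w.

Definition omega (c : idx A) (xi : jet 1) (v : tvec M1) : 'rV[R]_n :=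
  lsubmx (rsubmx (v c)) - dt xi v *: jcoord c 1 xi.

Definition omega0 (c : idx A) (xi : jet 1) (w : tvec M0) : 'rV[R]_n :=
  rsubmx (w c) - dt0 xi w *: jcoord c 1 xi.

Definition vertical (xi : jet 1) (v : tvec M1) : Prop :=
  veq (p10 xi) (tmap M1 M0 p10 xi v) 0.

(* The canonical isomorphism epsilon : (p' \o p^{10})^* TM -> V(p^{10}), its
   inverse on V(p^{10}), and the inclusion of (p' \o p^{10})^* TM in
   (p^{10})^* T M^0. *)
Definition epsilon (w : tvec A) : tvec M1 :=
  fun c => row_mx 0 (row_mx 0 (w c)).

Definition epsilon_inv (v : tvec M1) : tvec A :=
  fun c => rsubmx (rsubmx (v c)).

Definition TM_incl (w : tvec A) : tvec M0 := fun c => row_mx 0 (w c).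

(* The fundamental tensor J = omega^i (x) d/d\dot x^i. *)
Definition Jtensor (xi : jet 1) (v : tvec M1) : tvec M1 :=
  epsilon (fun c => omega c xi v).

Section Sode.
Variable s : sode.

(* F^i = \ddot x^i \o sigma, and its derivatives in the \dot x directions. *)
Definition F (c : idx A) (xi : jet 1) : 'rV[R]_n := jcoord c 2 (s xi).

Definition dF (c : idx A) (j i : 'I_n) (xi : jet 1) : R :=
  partial M1 c (iv i) (F c) xi 0 j.

Definition ddF (c : idx A) (k i j : 'I_n) (xi : jet 1) : R :=
  partial M1 c (iv i) (partial M1 c (iv j) (F c)) xi 0 k.

Definition Xs : vfield M1 :=
  fun xi c => row_mx 1%:M (row_mx (jcoord c 1 xi) (F c xi)).

(* The local fields d/d\dot x^i and X^sigma_i on the domain of the chart c. *)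
Definition Dv (c : idx A) (i : 'I_n) : vfield M1 :=
  fun xi => tv M1 c xi (delta_mx 0 (iv i)).

Definition Xi (c : idx A) (i : 'I_n) : vfield M1 := fun xi =>
  tv M1 c xi (row_mx 0 (row_mx (delta_mx 0 i)
                                      (\row_j (2^-1 * dF c j i xi)))).

(* H^sigma = dt (x) X^sigma + omega^i (x) X^sigma_i *)
Definition Hs (xi : jet 1) (w : tvec M0) : tvec M1 := fun c =>
  dt0 xi w *: Xs xi c + \sum_(i < n) omega0 c xi w 0 i *: Xi c i xi c.

Definition Heps (xi : jet 1) (v : tvec M1) : tvec M1 :=
  Hs xi (TM_incl (epsilon_inv v)).

Definition hpart (xi : jet 1) (v : tvec M1) : tvec M1 :=
  Hs xi (tmap M1 M0 p10 xi v).

Definition vpart (xi : jet 1) (v : tvec M1) : tvec M1 := v - hpart xi v.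

Definition curvature (X Y : vfield M1) : vfield M1 := fun xi =>
  - vpart xi (bracket (fun eta => hpart eta (X eta))
                      (fun eta => hpart eta (Y eta)) xi).

Definition HLJ (X : vfield M1) : vfield M1 := fun xi =>
  Heps xi (vpart xi (lie_endo Xs Jtensor X xi)).

Definition Ts (X Y : vfield M1) : vfield M1 := fun xi =>
  curvature X Y xi + (dt xi (X xi) *: HLJ Y xi - dt xi (Y xi) *: HLJ X xi).

Definition adapted (xi : jet 1) (u : frame M1) : Prop :=
  [/\ is_frame xi u, veq xi (u it) (Xs xi),
      forall i, vertical xi (u (iv i)) &
      forall i, veq xi (u (ix i)) (Heps xi (u (iv i)))].

Definition has_torsion_Ts (D : linear_connection M1) : Prop :=
  forall U X Y, mopen M1 U -> smooth_vfield U X -> smooth_vfield U Y ->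
  forall xi, U xi -> veq xi (torsion D X Y xi) (Ts X Y xi).

Definition is_Chern (D : linear_connection M1) : Prop :=
  (forall U Y, mopen M1 U -> smooth_vfield U Y ->
     forall xi, U xi -> veq xi (D Y Xs xi) 0) /\
  (forall (c : idx A) (xi : jet 1), dom M1 c xi ->
   [/\ forall i, veq xi (D Xs (Xi c i) xi)
                        (- \sum_(j < n) (2^-1 * dF c j i xi) *: Xi c j xi),
       forall i, veq xi (D Xs (Dv c i) xi)
                        (- \sum_(j < n) (2^-1 * dF c j i xi) *: Dv c j xi),
       forall i j, veq xi (D (Xi c j) (Xi c i) xi)
                     (- \sum_(k < n) (2^-1 * ddF c k i j xi) *: Xi c k xi),
       forall i j, veq xi (D (Xi c j) (Dv c i) xi)
                     (- \sum_(k < n) (2^-1 * ddF c k i j xi) *: Dv c k xi) &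
       forall i j, veq xi (D (Dv c j) (Xi c i) xi) 0 /\
                   veq xi (D (Dv c j) (Dv c i) xi) 0]).

End Sode.
End Jets.

(* Main.v *)
From HB Require Import structures.
Require Import Defs.
From mathcomp Require Import all_boot all_order all_algebra fingroup perm.
From mathcomp Require Import all_classical all_reals topology normedtype landau derive.
From mathcomp Require Import ring lra.
Require Import Defs.

Set Implicit Arguments.
Unset Strict Implicit.
Unset Printing Implicit Defensive.

Import Order.TTheory GRing.Theory Num.Theory.
Import numFieldNormedType.Exports.
Local Open Scope classical_set_scope.
Local Open Scope ring_scope.

(** Both conditions on a connection, reducibility and torsion, can be read off
    its values on the frame (X^sigma, X^sigma_i, d/d\dot x^i) induced by a chart
    of M, and together they force these values to be those of the Chern
    connection.

    Reducibility. The frames adapted to sigma are the images of the induced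
    frame under the matrices diag(1, Lambda, Lambda) ([adapted_of_rows],
    [adapted_rows]). A connection is therefore reducible to them when its form
    in the induced frame takes values in the Lie algebra of G: X^sigma is
    parallel and the derivatives of X^sigma_i and of d/d\dot x^i have the same
    coefficients. Conversely, a reducible connection has this property
    ([reducible_frame]). The Chern connection has it by definition, and a
    parallel adapted section through a given frame is obtained by letting
    Lambda depend on the point with the differential that compensates the
    connection form ([table_reducible]).

    Torsion. The torsion of a connection and T^sigma are both tensorial and
    antisymmetric, so for the Chern connection they are compared on the pairs of
    frame fields, whose brackets are explicit ([table_torsion]).

    Uniqueness. Let D be reducible with torsion T^sigma. Since the Chern
    connection has the same torsion, D_X Y - D_Y X is the same for both. For
    X = X^sigma_j and Y = d/d\dot x^i, D_X Y is vertical and D_Y X is in the span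
    of the X^sigma_k, so each of them is determined; for X = X^sigma the term
    D_Y X vanishes. By equality of coefficients all derivatives of frame fields
    are determined ([reducible_torsion_table]), and a connection is determined
    by these ([table_unique]).

    Existence. The equations defining the Chern connection are local, and
    instead of gluing local solutions we give a global formula. Let P and Q be
    the horizontal and vertical projections, J the fundamental tensor and
    K = H^sigma o epsilon^{-1} o Q. Then
      nabla_Y X = Y(dt X) X^sigma + V_Q(Y, X) + K (V_J(Y, X)), where
      V_E(Y, X) = Q [P Y, E X] + J [Q Y, K E X],
    is a linear connection, because of the algebraic relations between P, Q, J
    and K ([twisted_conn]), and satisfies the local equations
    ([chern_is_table]). This requires P, Q, J, K and X^sigma to be independent
    of the charts: X^sigma is the velocity of the lift to M^1 of curves with
    2-jet sigma ([Xs_tvec]), J comes from the identification of vertical vectors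
    with tangent vectors of M ([J_tvec]), and P is
    1/2 (id + dt (x) X^sigma - L_{X^sigma}J) ([hpart_tvec]).

    Tangent vectors are determined by their components in one chart
    ([tvec_eq]), so all computations are made on rows, in a fixed chart. *)

(** * Smooth maps between normed spaces *)

Section SmoothCalculus.
Variable R : realType.
Implicit Types V W Z : normedModType R.

Lemma near_open V (U : set V) (P : V -> Prop) x :
  open U -> U x -> (forall y, U y -> P y) -> \forall y \near x, P y.
Proof.
move=> oU Ux HP; apply: filterS HP _; exact: open_nbhs_nbhs.
Qed.

Lemma derive_eq_on V W (U : set V) (f g : V -> W) v x : open U -> U x ->
  (forall y, U y -> f y = g y) -> 'D_v f x = 'D_v g x.
Proof. by move=> oU Ux fg; apply: near_eq_derive; apply: near_open fg. Qed.

Lemma diff_eq_on V W (U : set V) (f g : V -> W) x : open U -> U x ->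
  (forall y, U y -> f y = g y) -> differentiable f x -> differentiable g x.
Proof.
move=> oU Ux fg df.
have E : g \o shift x = cst (g x) + 'd f x +o_ 0 id.
  apply/eqaddoP => e e0.
  have /eqaddoP/(_ e e0) := diff_locally df.
  have : \forall h \near (0 : V), f (h + x) = g (h + x).
    have : \forall y \near x, f y = g y by apply: near_open fg.
    by rewrite (near_shift 0) subr0.
  by apply: filterS2 => h /= fgh; rewrite !fctE /= fgh fg.
have dfg : 'd g x = 'd f x :> (V -> W).
  by apply: diff_unique E; exact: diff_continuous.
by apply/diff_locallyP; rewrite dfg; split=> //; exact: diff_continuous.
Qed.

Section Scale.
Variables V W : normedModType R.

Lemma scale_is_bilinear :
  bilinear_for
    (GRing.Scale.Law.clone _ _ *:%R _) (GRing.Scale.Law.clone _ _ *:%R _)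
    (@GRing.scale R W : R -> W -> W).
Proof.
split=> [u'|u] a x y /=.
- by rewrite scalerDl scalerA.
- by rewrite scalerDr !scalerA mulrC.
Qed.
Let sM := @bilinear_isBilinear.Build R R W W _ _ _ scale_is_bilinear.
Let sL : {bilinear R -> W -> W} := HB.pack (@GRing.scale R W) sM.

Let sc : continuous (fun p : R * W => sL p.1 p.2).
Proof. exact: scale_continuous. Qed.

(** Scaling is bilinear and continuous, so differentiability and the product
    rule both come from the chain rule through the pair (f, g). *)
Lemma differentiable_scale (f : V -> R) (g : V -> W) x :
  differentiable f x -> differentiable g x ->
  differentiable (fun y => f y *: g y) x.
Proof.
move=> df dg.
exact: (differentiable_comp (differentiable_pair df dg) (differentiable_bilin _ sc)).
Qed.

Lemma derive_scale (f : V -> R) (g : V -> W) v x :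
  differentiable f x -> differentiable g x ->
  'D_v (fun y => f y *: g y) x = f x *: 'D_v g x + 'D_v f x *: g x.
Proof.
move=> df dg; rewrite deriveE; last exact: differentiable_scale.
have dfg := differentiable_pair df dg.
have -> : 'd (fun y => f y *: g y) x =
    'd ((fun p : R * W => sL p.1 p.2) \o (fun y => (f y, g y))) x :> (V -> W).
  by [].
rewrite diff_comp //; last exact: differentiable_bilin.
by rewrite [X in X _]/= (diff_bilin _ sc) diff_pair //= !deriveE.
Qed.

End Scale.

Lemma linear_row_continuous m W (l : {linear 'rV[R]_m -> W}) : continuous l.
Proof.
have lE : (l : _ -> _) = \sum_(a < m) (fun y : 'rV[R]_m => y 0 a *: l (delta_mx 0 a)).
  apply/funext => y; rewrite {1}[y]row_sum_delta linear_sum fct_sumE.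
  by apply: eq_bigr => a _; rewrite linearZ.
move=> y; apply: differentiable_continuous; rewrite lE.
apply: differentiable_sum => a; apply: differentiable_scale => //.
exact: differentiable_coord.
Qed.

Lemma derive_linl V W Z (l : {linear W -> Z}) (f : V -> W) v x :
  continuous l -> differentiable f x ->
  differentiable (l \o f) x /\ 'D_v (l \o f) x = l ('D_v f x).
Proof.
move=> cl df; have dl : differentiable l (f x) by exact: linear_differentiable.
have dc := differentiable_comp df dl; split=> //.
by rewrite deriveE // diff_comp //= diff_lin // deriveE.
Qed.

Lemma derive_rowE m W (g : 'rV[R]_m -> W) w x : differentiable g x ->
  'D_w g x = \sum_(a < m) w 0 a *: 'D_(delta_mx 0 a) g x.
Proof.
move=> dg; rewrite deriveE // {1}[w]row_sum_delta linear_sum.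
by apply: eq_bigr => a _; rewrite linearZ deriveE.
Qed.

Lemma derive_comp V W Z (f : V -> W) (g : W -> Z) v x :
  differentiable f x -> differentiable g (f x) ->
  'D_v (g \o f) x = 'D_('D_v f x) g (f x).
Proof.
move=> df dg; rewrite deriveE; last exact: differentiable_comp.
by rewrite diff_comp //= !deriveE.
Qed.

Section Ck.
Variables V W : normedModType R.
Implicit Types (U : set V) (f g : V -> W).

Lemma Ck_sub k U U' f : U' `<=` U -> Ck k U f -> Ck k U' f.
Proof.
elim: k f => [|k IH] f sU /=; first by move=> h x /sU /h.
by move=> [h1 h2]; split=> [x /sU /h1 //|v]; exact: IH.
Qed.

Lemma Ck_eq k U f g : open U -> (forall x, U x -> f x = g x) ->
  Ck k U f -> Ck k U g.
Proof.
move=> oU; elim: k f g => [|k IH] f g fg /=.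
  move=> h x Ux; rewrite /prop_for /continuous_at -(fg x Ux).
  have /= := h x Ux; rewrite /prop_for /continuous_at.
  apply: cvg_trans; apply: near_eq_cvg.
  exact: near_open fg.
move=> [h1 h2]; split=> [x Ux|v]; first exact: diff_eq_on fg (h1 x Ux).
by apply: IH (h2 v) => x Ux; exact: derive_eq_on fg.
Qed.

Lemma Ck_pred k U f : Ck k.+1 U f -> Ck k U f.
Proof.
elim: k f => [|k IH] f; first by move=> [h _] x Ux; exact/differentiable_continuous/h.
by move=> [h1 h2]; split=> // v; exact: IH.
Qed.

Lemma Ck_cst k U (a : W) : Ck k U (fun=> a).
Proof.
elim: k a => [|k IH] a /=; first by move=> x _; exact: cst_continuous.
split=> [x _|v]; first exact: differentiable_cst.
have -> : (fun x => 'D_v (fun=> a) x) = (fun=> (0 : W)); last exact: IH.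
by apply/funext => x; exact: derive_cst.
Qed.

Lemma CkD k U f g : open U -> Ck k U f -> Ck k U g -> Ck k U (fun x => f x + g x).
Proof.
move=> oU; elim: k f g => [|k IH] f g /=.
  by move=> hf hg x Ux; apply: continuousD; [exact: hf|exact: hg].
move=> [f1 f2] [g1 g2]; split=> [x Ux|v].
  by apply: differentiableD; [exact: f1|exact: g1].
apply: (@Ck_eq _ _ (fun x => 'D_v f x + 'D_v g x)) => // [x Ux|]; last exact: IH.
by rewrite deriveD //; apply: diff_derivable; [exact: f1|exact: g1].
Qed.

End Ck.

Lemma CkZ k V W (U : set V) (f : V -> R) (g : V -> W) : open U ->
  Ck k U f -> Ck k U g -> Ck k U (fun x => f x *: g x).
Proof.
move=> oU; elim: k f g => [|k IH] f g.
  by move=> hf hg x Ux; apply: cvgZ; [exact: hf|exact: hg].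
move=> Cf Cg; have [f1 f2] := Cf; have [g1 g2] := Cg.
split=> [x Ux|v]; first exact: (differentiable_scale (f1 x Ux) (g1 x Ux)).
apply: (@Ck_eq _ _ _ _ (fun x => f x *: 'D_v g x + 'D_v f x *: g x)) => //.
  by move=> x Ux; rewrite (derive_scale v (f1 x Ux) (g1 x Ux)).
by apply: CkD => //; apply: IH; by [exact: Ck_pred|exact: f2|exact: g2].
Qed.

Lemma Ck_linl k V W Z (U : set V) (l : {linear W -> Z}) (f : V -> W) : open U ->
  continuous l -> Ck k U f -> Ck k U (fun x => l (f x)).
Proof.
move=> oU cl; elim: k f => [|k IH] f.
  by move=> hf x Ux; apply: continuous_comp; [exact: hf|exact: cl].
move=> [f1 f2]; split=> [x Ux|v]; first exact: (derive_linl 0 cl (f1 x Ux)).1.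
apply: (@Ck_eq _ _ _ _ (fun x => l ('D_v f x))) => // [x Ux|]; last exact: (IH _ (f2 v)).
by rewrite -(derive_linl v cl (f1 x Ux)).2.
Qed.

Lemma Ck_sum k V W (U : set V) I (r : seq I) (f : I -> V -> W) : open U ->
  (forall i, Ck k U (f i)) -> Ck k U (fun x => \sum_(i <- r) f i x).
Proof.
move=> oU Cf; elim: r => [|i r IH].
  have -> : (fun x => \sum_(i <- [::]) f i x) = (fun=> (0 : W)).
    by apply/funext => x; rewrite big_nil.
  exact: Ck_cst.
have -> : (fun x => \sum_(j <- i :: r) f j x) = (fun x => f i x + \sum_(j <- r) f j x).
  by apply/funext => x; rewrite big_cons.
exact: CkD.
Qed.

Definition entry m (a : 'I_m) (y : 'rV[R]_m) : R := y 0 a.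
Lemma entry_linear m a : linear (@entry m a).
Proof. by move=> k x y; rewrite /entry !mxE. Qed.
HB.instance Definition _ m a := GRing.isLinear.Build _ _ _ _ _ (@entry_linear m a).

(** The intermediate space has finite dimension, so a derivative of g \o f is
    a finite sum of products of a derivative of f with a partial derivative
    of g composed with f, to which the induction hypothesis applies. *)
Lemma Ck_comp k V m W (U : set V) (U' : set 'rV[R]_m) (f : V -> 'rV[R]_m)
  (g : 'rV[R]_m -> W) : open U -> open U' -> (forall x, U x -> U' (f x)) ->
  Ck k U f -> Ck k U' g -> Ck k U (fun x => g (f x)).
Proof.
move=> oU oU' UU'; elim: k f g UU' => [|k IH] f g UU'.
  move=> hf hg x Ux; apply: continuous_comp; first exact: hf.
  by apply: hg; exact: UU'.
move=> Cf [g1 g2]; have [f1 f2] := Cf; split=> [x Ux|v].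
  by apply: differentiable_comp; [exact: f1|apply: g1; exact: UU'].
apply: (@Ck_eq _ _ _ _ (fun x => \sum_(a < m) entry a ('D_v f x) *:
   'D_(delta_mx 0 a) g (f x))) => //.
  move=> x Ux; have dg := g1 _ (UU' x Ux).
  by rewrite (derive_comp v (f1 x Ux) dg) (derive_rowE _ dg).
apply: Ck_sum => // a; apply: CkZ => //.
  by apply: Ck_linl (f2 v) => //; exact: linear_row_continuous.
exact: (IH f _ UU' (Ck_pred Cf) (g2 _)).
Qed.

Section Smooth.
Variables V W : normedModType R.
Implicit Types (U : set V) (f g : V -> W).

Lemma smooth_diff U f x : smooth_on U f -> U x -> differentiable f x.
Proof. by move=> /(_ 1) [+ _]; exact. Qed.

Lemma smooth_derive U f v : smooth_on U f -> smooth_on U ('D_v f).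
Proof. by move=> sf k; have [_] := sf k.+1; exact. Qed.

Lemma smooth_sub U U' f : U' `<=` U -> smooth_on U f -> smooth_on U' f.
Proof. by move=> sU sf k; exact: Ck_sub (sf k). Qed.

Lemma smooth_eq U f g : open U -> (forall x, U x -> f x = g x) ->
  smooth_on U f -> smooth_on U g.
Proof. by move=> oU fg sf k; exact: Ck_eq fg (sf k). Qed.

Lemma smooth_cst U (a : W) : smooth_on U (fun=> a).
Proof. by move=> k; exact: Ck_cst. Qed.

Lemma smoothD U f g : open U -> smooth_on U f -> smooth_on U g ->
  smooth_on U (fun x => f x + g x).
Proof. by move=> oU sf sg k; exact: CkD. Qed.

Lemma smoothZ U (a : V -> R) f : open U -> smooth_on U a -> smooth_on U f ->
  smooth_on U (fun x => a x *: f x).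
Proof. by move=> oU sf sg k; exact: CkZ. Qed.

Lemma smooth_sum U I (r : seq I) (F : I -> V -> W) : open U ->
  (forall i, smooth_on U (F i)) -> smooth_on U (fun x => \sum_(i <- r) F i x).
Proof. by move=> oU sf k; apply: Ck_sum => // i; exact: sf. Qed.

End Smooth.

Lemma smooth_lin V m W (U : set V) (l : {linear 'rV[R]_m -> W})
    (f : V -> 'rV[R]_m) : open U -> smooth_on U f -> smooth_on U (fun x => l (f x)).
Proof.
by move=> oU sf k; apply: Ck_linl => //; exact: linear_row_continuous.
Qed.

Lemma smooth_comp V m W (U : set V) (U' : set 'rV[R]_m) (f : V -> 'rV[R]_m)
  (g : 'rV[R]_m -> W) : open U -> open U' -> (forall x, U x -> U' (f x)) ->
  smooth_on U f -> smooth_on U' g -> smooth_on U (fun x => g (f x)).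
Proof. by move=> oU oU' UU' sf sg k; exact: (Ck_comp oU oU' UU'). Qed.

Lemma smooth_id m (U : set 'rV[R]_m) : open U -> smooth_on U (fun x => x).
Proof.
move=> oU k; elim: k => [|k IH]; first by move=> x _; exact: cvg_id.
split=> [x _|v]; first by [].
apply: (@Ck_eq _ _ _ _ (fun=> v)) => //; last exact: Ck_cst.
by move=> x _; rewrite derive_id.
Qed.

(** Smoothness is defined through constant directions only; a variable
    direction is expanded over the canonical basis. *)
Lemma smooth_derive_along m W (U : set 'rV[R]_m) (w : 'rV[R]_m -> 'rV[R]_m)
    (f : 'rV[R]_m -> W) : open U -> smooth_on U w -> smooth_on U f ->
  smooth_on U (fun x => 'D_(w x) f x).
Proof.
move=> oU sw sf.
apply: (@smooth_eq _ _ _ (fun x => \sum_(a < m) entry a (w x) *: 'D_(delta_mx 0 a) f x)) => //.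
  by move=> x Ux; rewrite [RHS]derive_rowE //; exact: smooth_diff sf Ux.
by apply: smooth_sum => // a; apply: smoothZ => //; [exact: smooth_lin|exact: smooth_derive].
Qed.

Lemma is_derive_line V (f : V -> R) x v (s : R) : differentiable f (x + s *: v) ->
  is_derive s 1 (fun t : R => f (x + t *: v)) ('D_v f (x + s *: v)).
Proof.
move=> df; pose l (t : R) := x + t *: v.
have di : differentiable (id : R -> R) s by [].
have dc := differentiable_cst v s.
have ds := differentiable_scale di dc.
have dl : differentiable l s by exact: (differentiableD (differentiable_cst x s) ds).
have Dl : 'D_1 l s = v.
  rewrite [LHS](deriveD (diff_derivable (differentiable_cst x s)) (diff_derivable ds)).
  by rewrite derive_cst (derive_scale _ di dc) derive_cst derive_id scaler0 !add0r scale1r.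
have -> : 'D_v f (x + s *: v) = 'D_1 (f \o l) s by rewrite (derive_comp _ dl df) Dl.
apply: derivableP; apply: diff_derivable; exact: (differentiable_comp dl).
Qed.

(** The mean value theorem, applied first to s |-> f (x + h w + s v) - f (x +
    s v), then in the direction w to the derivative along v. *)
Lemma second_difference V (U : set V) (f : V -> R) x v w (h : R) : 0 < h ->
  smooth_on U f ->
  (forall s t : R, 0 <= s <= h -> 0 <= t <= h -> U (x + s *: v + t *: w)) ->
  exists s t : R, [/\ 0 <= s <= h, 0 <= t <= h &
  f (x + h *: v + h *: w) - f (x + h *: v) - (f (x + h *: w) - f x) =
   'D_w ('D_v f) (x + s *: v + t *: w) * h * h].
Proof.
move=> h0 sf sU.
have df (s t : R) : 0 <= s <= h -> 0 <= t <= h -> differentiable f (x + s *: v + t *: w).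
  by move=> *; apply: smooth_diff sf _; exact: sU.
have itv_oocc (s : R) : s \in `]0, h[ -> 0 <= s <= h.
  by rewrite in_itv /= => /andP[/ltW -> /ltW ->].
have hh : 0 <= h <= h by rewrite lexx ltW.
have h00 : (0 : R) <= 0 <= h by rewrite lexx ltW.
pose phi s := f (x + h *: w + s *: v) - f (x + s *: v).
have dphi (s : R) : 0 <= s <= h -> is_derive s 1 phi
    ('D_v f (x + h *: w + s *: v) - 'D_v f (x + s *: v)).
  move=> hs; apply: is_deriveB; apply: is_derive_line.
    by rewrite addrAC; exact: df.
  by have := df s 0 hs h00; rewrite scale0r addr0.
have dphi_oo s (hs : s \in `]0, h[) := dphi s (itv_oocc _ hs).
have [|s] := MVT h0 dphi_oo.
  apply: continuous_in_subspaceT => s; rewrite inE /= in_itv /= => hs.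
  by apply: differentiable_continuous; apply/derivable1_diffP; have [] := dphi s hs.
rewrite in_itv /= => /andP[/ltW s0 /ltW sh] E.
have hs : 0 <= s <= h by rewrite s0.
have dpsi (t : R) : 0 <= t <= h -> is_derive t 1 (fun t => 'D_v f (x + s *: v + t *: w))
    ('D_w ('D_v f) (x + s *: v + t *: w)).
  move=> ht; apply: is_derive_line.
  by apply: smooth_diff (smooth_derive v sf) _; exact: sU.
have dpsi_oo t (hs : t \in `]0, h[) := dpsi t (itv_oocc _ hs).
have [|t] := MVT h0 dpsi_oo.
  apply: continuous_in_subspaceT => t; rewrite inE /= in_itv /= => ht.
  by apply: differentiable_continuous; apply/derivable1_diffP; have [] := dpsi t ht.
rewrite in_itv /= => /andP[/ltW t0 /ltW th] E'.
exists s, t; split; rewrite ?t0 ?s0 //.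
move: E E'; rewrite /phi !subr0 !scale0r !addr0 => E E'.
by rewrite [x + s *: v + _]addrAC in E' *; rewrite -E' -E [x + h *: v + _]addrAC; lra.
Qed.

(** Schwarz's theorem: the second difference is symmetric in v and w, and it
    is h^2 times either mixed derivative at some point near x; both mixed
    derivatives are continuous at x. *)
Lemma derive_sym_real V (U : set V) (f : V -> R) x v w : open U -> U x ->
  smooth_on U f -> 'D_v ('D_w f) x = 'D_w ('D_v f) x.
Proof.
move=> oU Ux sf; apply/eqP; rewrite -subr_eq0 -normr_le0; apply/ler_addgt0Pr => e e0.
have nb (v' w' : V) : \forall y \near x, `|'D_v' ('D_w' f) x - 'D_v' ('D_w' f) y| < e / 2.
  have : {for x, continuous ('D_v' ('D_w' f))}.
    apply: differentiable_continuous.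
    exact: (smooth_diff (smooth_derive v' (smooth_derive w' sf)) Ux).
  by move=> /cvgrPdist_lt; apply; rewrite divr_gt0.
have : \forall y \near x, [/\ U y, `|'D_v ('D_w f) x - 'D_v ('D_w f) y| < e / 2 &
     `|'D_w ('D_v f) x - 'D_w ('D_v f) y| < e / 2].
  have nU : \forall y \near x, U y := near_open oU Ux (fun y Uy => Uy).
  by apply: filterS (filterI nU (filterI (nb v w) (nb w v))) => y [? [? ?]].
move=> /nbhs_ballP[r /= r0 Br].
(* With this h the parallelogram x + s v + t w, 0 <= s, t <= h, lies in the
   ball of radius r around x. *)
pose h := r / (`|v| + `|w| + 1).
have N0 : 0 < `|v| + `|w| + 1 by rewrite ltr_wpDl ?addr_ge0.
have h0 : 0 < h by rewrite divr_gt0.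
have Bh s t : 0 <= s <= h -> 0 <= t <= h -> ball x r (x + s *: v + t *: w).
  move=> /andP[s0 sh] /andP[t0 th]; rewrite -ball_normE /ball_ /=.
  rewrite -addrA opprD addNKr normrN.
  have hr : h * (`|v| + `|w| + 1) = r by rewrite /h divfK // gt_eqF.
  rewrite -hr (le_lt_trans (ler_normD _ _)) // !normrZ !ger0_norm //.
  by rewrite mulrDr mulr1 mulrDr ltr_pwDr // lerD // ler_wpM2r.
have [s1 [t1 [hs1 ht1 E1]]] : exists s t : R, [/\ 0 <= s <= h, 0 <= t <= h &
  f (x + h *: v + h *: w) - f (x + h *: v) - (f (x + h *: w) - f x) =
   'D_w ('D_v f) (x + s *: v + t *: w) * h * h].
  by apply: second_difference sf _ => // s t hs ht; have [] := Br _ (Bh s t hs ht).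
have Bh' s t : 0 <= s <= h -> 0 <= t <= h -> ball x r (x + s *: w + t *: v).
  by move=> hs ht; rewrite addrAC; exact: Bh.
have [s2 [t2 [hs2 ht2 E2]]] : exists s t : R, [/\ 0 <= s <= h, 0 <= t <= h &
  f (x + h *: w + h *: v) - f (x + h *: w) - (f (x + h *: v) - f x) =
   'D_v ('D_w f) (x + s *: w + t *: v) * h * h].
  by apply: second_difference sf _ => // s t hs ht; have [] := Br _ (Bh' s t hs ht).
have [_ _ n1] := Br _ (Bh s1 t1 hs1 ht1).
have [_ n2 _] := Br _ (Bh' s2 t2 hs2 ht2).
have E : 'D_w ('D_v f) (x + s1 *: v + t1 *: w) = 'D_v ('D_w f) (x + s2 *: w + t2 *: v).
  apply: (mulIf (lt0r_neq0 h0)); apply: (mulIf (lt0r_neq0 h0)).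
  apply: etrans (esym E1) (etrans _ E2); rewrite [x + h *: w + _]addrAC.
  move: (f _) (f (x + h *: v)) (f _) (f x) => a1 a2 a3 a4.
  by ring.
rewrite add0r; move: n1 n2; rewrite E => n1 n2.
rewrite -[X in `|X|](subrKA ('D_v ('D_w f) (x + s2 *: w + t2 *: v))).
apply: (le_trans (ler_normD _ _)); rewrite [e]splitr.
by apply: lerD; [exact: ltW n2|rewrite distrC; exact: ltW n1].
Qed.

Lemma derive_sym V m (U : set V) (f : V -> 'rV[R]_m) x v w : open U -> U x ->
  smooth_on U f -> 'D_v ('D_w f) x = 'D_w ('D_v f) x.
Proof.
move=> oU Ux sf; apply/rowP => a.
have H (v' w' : V) : ('D_v' ('D_w' f) x) 0 a = 'D_v' ('D_w' (entry a \o f)) x.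
  have ca := @linear_row_continuous _ _ (@entry m a).
  rewrite -[LHS]/(entry a _) -(derive_linl v' ca _).2; last first.
    exact: (smooth_diff (smooth_derive w' sf)).
  apply: (derive_eq_on v' oU Ux) => y Uy; rewrite /= -(derive_linl w' ca _).2 //.
  exact: (smooth_diff sf).
have se : smooth_on U (entry a \o f) := smooth_lin (@entry m a) oU sf.
have E := derive_sym_real v w oU Ux se.
have Hvw := H v w; have Hwv := H w v.
exact: (etrans Hvw (etrans E (esym Hwv))).
Qed.

End SmoothCalculus.

(** * Functions and tangent vectors in charts *)

(** What the calculus in charts uses of a manifold, common to M and to its
    space of 1-jets. *)
Record regular_atlas (R : realType) (T : Type) (d : nat) (A : atlas R T d) : Prop := RegularAtlas {
  ra_inj : forall c, set_inj (dom A c) (coord A c) ;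
  ra_open : forall c e, open (coord A c @` (dom A c `&` dom A e)) ;
  ra_smooth : forall c e,
    smooth_on (coord A c @` (dom A c `&` dom A e)) (rep c (coord A e)) }.

(** The derivative of f along the coordinate vector w, read in the chart c.
    It is opaque, to be handled by its rules alone. *)
HB.lock Definition cderive (R : realType) (T : Type) (d : nat) (A : atlas R T d)
    (V : normedModType R) (c : idx A) (w : 'rV[R]_d) (f : T -> V) (p : T) : V :=
  'D_w (rep c f) (coord A c p).
Arguments cderive {R T d A V} c w f p.

(** The Lie bracket, made opaque for the same purpose. *)
HB.lock Definition lbracket (R : realType) (T : Type) (d : nat) (A : atlas R T d)
    (X Y : vfield A) : vfield A := bracket X Y.
Arguments lbracket {R T d A} X Y _ _.

Section Charts.
Variables (R : realType) (T : Type) (d : nat) (A : atlas R T d).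
Hypothesis hA : regular_atlas A.
Implicit Types (V W : normedModType R) (c e : idx A) (p q : T) (U : set T).

Definition chart_image c U := coord A c @` (dom A c `&` U).

(** Smoothness and differentiability read in one chart; [csmooth_change]
    carries the former to the others. *)
Definition csmooth V c U (f : T -> V) := smooth_on (chart_image c U) (rep c f).

Definition cdiff V c (f : T -> V) p := differentiable (rep c f) (coord A c p).

Lemma repE V c (f : T -> V) p : dom A c p -> rep c f (coord A c p) = f p.
Proof.
move=> cp; apply: xget_unique; first by exists p.
move=> _ [q [cq /= E] <-]; congr f; apply: (ra_inj hA _ _ E); exact/mem_set.
Qed.

Lemma chart_imageP c U p : dom A c p -> U p -> chart_image c U (coord A c p).
Proof. by move=> cp Up; exists p. Qed.

Lemma mopenT : mopen A setT.
Proof.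
by move=> c; have := ra_open hA (c := c) (e := c); rewrite setIid setIT.
Qed.

Lemma mopen_dom c : mopen A (dom A c).
Proof. by move=> e; exact: (ra_open hA). Qed.

Lemma mopenI U U' : mopen A U -> mopen A U' -> mopen A (U `&` U').
Proof.
move=> oU oU' c; have := openI (oU c) (oU' c); congr open.
apply/seteqP; split=> [y [[p [cp Up] <-] [q [cq Uq] E]]|y [p [cp [Up U'p]] <-]].
  have pq : q = p by apply: (ra_inj hA _ _ E); exact/mem_set.
  by exists p => //; rewrite pq in Uq; split.
by split; exists p.
Qed.

Lemma rep_on V c U (f g : T -> V) : (forall q, dom A c q -> U q -> f q = g q) ->
  forall y, chart_image c U y -> rep c f y = rep c g y.
Proof. by move=> fg _ [q [cq Uq] <-]; rewrite !repE //; exact: fg. Qed.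

Lemma cderive_eq V c U w (f g : T -> V) p : mopen A U -> U p -> dom A c p ->
  (forall q, dom A c q -> U q -> f q = g q) -> cderive c w f p = cderive c w g p.
Proof.
move=> oU Up cp fg; rewrite cderive.unlock; apply: (derive_eq_on _ (oU c));
  first exact: chart_imageP.
exact: rep_on.
Qed.

Section Local.
Variables (c : idx A) (p : T).
Hypothesis cp : dom A c p.

Lemma cderive_rep V (f : T -> V) (F : 'rV[R]_d -> V) w : (forall q, dom A c q ->
  F (coord A c q) = f q) ->
  cderive c w f p = 'D_w F (coord A c p).
Proof.
move=> Ff; rewrite cderive.unlock; apply: (derive_eq_on _ (@mopenT c)); first exact: chart_imageP.
by move=> _ [q [cq _] <-]; rewrite repE // Ff.
Qed.

Lemma cdiff_rep V (f : T -> V) (F : 'rV[R]_d -> V) :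
  (forall q, dom A c q -> F (coord A c q) = f q) ->
  differentiable F (coord A c p) -> cdiff c f p.
Proof.
move=> Ff; rewrite /cdiff; apply: (diff_eq_on (@mopenT c)); first exact: chart_imageP.
by move=> _ [q [cq _] <-]; rewrite repE // Ff.
Qed.

Lemma cderive_cst V (a : V) w : cderive c w (fun=> a) p = 0.
Proof. by rewrite (@cderive_rep _ _ (fun=> a)) // derive_cst. Qed.

Lemma cderiveD V (f g : T -> V) w : cdiff c f p -> cdiff c g p ->
  cderive c w (fun q => f q + g q) p = cderive c w f p + cderive c w g p.
Proof.
move=> df dg; rewrite (@cderive_rep _ _ (rep c f + rep c g)); last first.
  by move=> q cq; rewrite fctE !repE.
by rewrite cderive.unlock (deriveD (diff_derivable df) (diff_derivable dg)).
Qed.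

Lemma cderiveZ V (a : T -> R) (f : T -> V) w : cdiff c a p -> cdiff c f p ->
  cderive c w (fun q => a q *: f q) p = a p *: cderive c w f p + cderive c w a p *: f p.
Proof.
move=> da df; rewrite (@cderive_rep _ _ (fun y => rep c a y *: rep c f y)); last first.
  by move=> q cq; rewrite !repE.
by rewrite (derive_scale _ da df) !repE // cderive.unlock.
Qed.

Lemma cderive_lin m W (l : {linear 'rV[R]_m -> W}) (f : T -> 'rV[R]_m) w : cdiff c f p ->
  cderive c w (fun q => l (f q)) p = l (cderive c w f p).
Proof.
move=> df; rewrite (@cderive_rep _ _ (l \o rep c f)); last first.
  by move=> q cq; rewrite /= !repE.
by rewrite cderive.unlock; have [] := derive_linl w (@linear_row_continuous _ _ _ l) df.
Qed.

Lemma cderive_coord w : cderive c w (coord A c) p = w.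
Proof. by rewrite (@cderive_rep _ _ (fun y => y)) // derive_id. Qed.

Lemma cderive_dirE V (f : T -> V) w : cdiff c f p ->
  cderive c w f p = \sum_(a < d) w 0 a *: cderive c (delta_mx 0 a) f p.
Proof. by move=> df; rewrite cderive.unlock derive_rowE. Qed.

Lemma cderive_dirD V (f : T -> V) w w' : cdiff c f p ->
  cderive c (w + w') f p = cderive c w f p + cderive c w' f p.
Proof. by move=> df; rewrite cderive.unlock !deriveE // linearD. Qed.

Lemma cderive_dirZ V (f : T -> V) k w : cdiff c f p -> cderive c (k *: w)
  f p = k *: cderive c w f p.
Proof. by move=> df; rewrite cderive.unlock !deriveE // linearZ. Qed.

Lemma cderive_dirB V (f : T -> V) w w' : cdiff c f p ->
  cderive c (w - w') f p = cderive c w f p - cderive c w' f p.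
Proof. by move=> df; rewrite cderive.unlock !deriveE // linearB. Qed.

Lemma cderive_dir0 V (f : T -> V) : cderive c 0 f p = 0.
Proof. by rewrite cderive.unlock derive0. Qed.

End Local.

Lemma csmooth_cdiff V c U (f : T -> V) p : csmooth c U f -> dom A c p -> U p -> cdiff c f p.
Proof. by move=> sf cp Up; apply: smooth_diff sf _; exact: chart_imageP. Qed.

Lemma csmooth_sub V c U U' (f : T -> V) : U' `<=` U -> csmooth c U f -> csmooth c U' f.
Proof. by move=> sU; apply: smooth_sub => _ [q [cq /sU Uq] <-]; exact: chart_imageP. Qed.

Section Smf.
Variables (c : idx A) (U : set T).
Hypothesis oU : mopen A U.

Lemma csmooth_rep V (f : T -> V) (F : 'rV[R]_d -> V) :
  (forall q, dom A c q -> U q -> F (coord A c q) = f q) ->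
  smooth_on (chart_image c U) F -> csmooth c U f.
Proof.
move=> Ff sF; rewrite /csmooth.
have E : forall y, chart_image c U y -> F y = rep c f y.
  by move=> _ [q [cq Uq] <-]; rewrite repE // Ff.
exact: (smooth_eq (@oU c) E sF).
Qed.

Lemma csmooth_eq V (f g : T -> V) : (forall q, dom A c q -> U q -> f q = g q) ->
  csmooth c U f -> csmooth c U g.
Proof. by move=> fg; apply: csmooth_rep => q cq Uq; rewrite repE // fg. Qed.

Lemma csmooth_cst V (a : V) : csmooth c U (fun=> a).
Proof. by apply: (@csmooth_rep _ _ (fun=> a)) => //; exact: smooth_cst. Qed.

Lemma csmoothD V (f g : T -> V) : csmooth c U f -> csmooth c U g ->
  csmooth c U (fun q => f q + g q).
Proof.
move=> sf sg; apply: csmooth_rep; last exact: (smoothD (@oU c) sf sg).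
by move=> q cq Uq; rewrite /= !repE.
Qed.

Lemma csmoothZ V (a : T -> R) (f : T -> V) :
  csmooth c U a -> csmooth c U f -> csmooth c U (fun q => a q *: f q).
Proof.
move=> sf sg; apply: csmooth_rep; last exact: (smoothZ (@oU c) sf sg).
by move=> q cq Uq; rewrite /= !repE.
Qed.

Lemma csmooth_sum V I (r : seq I) (F : I -> T -> V) :
  (forall i, csmooth c U (F i)) -> csmooth c U (fun q => \sum_(i <- r) F i q).
Proof.
move=> sf; apply: csmooth_rep; last exact: (smooth_sum r (@oU c) sf).
by move=> q cq Uq /=; apply: eq_bigr => i _; rewrite repE.
Qed.

Lemma csmooth_lin m W (l : {linear 'rV[R]_m -> W}) (f : T -> 'rV[R]_m) :
  csmooth c U f -> csmooth c U (fun q => l (f q)).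
Proof.
move=> sf; apply: csmooth_rep; last exact: (smooth_lin l (@oU c) sf).
by move=> q cq Uq; rewrite /= !repE.
Qed.

Lemma csmooth_coord : csmooth c U (coord A c).
Proof. by apply: (@csmooth_rep _ _ (fun y => y)) => //; exact: (smooth_id (@oU c)). Qed.

Lemma csmooth_cderive V (w : T -> 'rV[R]_d) (f : T -> V) : csmooth c U w -> csmooth c U f ->
  csmooth c U (fun q => cderive c (w q) f q).
Proof.
move=> sw sf; rewrite cderive.unlock; apply: csmooth_rep; last exact: (smooth_derive_along (@oU
  c) sw sf).
by move=> q cq Uq; rewrite /= !repE.
Qed.

End Smf.

Lemma csmooth_coord2 c e : csmooth c (dom A e) (coord A e).
Proof. exact: (ra_smooth hA). Qed.

Lemma cdiff_coord2 c e p : dom A c p -> dom A e p -> cdiff c (coord A e) p.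
Proof. by move=> cp ep; apply: csmooth_cdiff cp ep; exact: csmooth_coord2. Qed.

(** The chain rule: [tv] is the change of components of tangent vectors. *)
Lemma cderive_change V c e (f : T -> V) w p : dom A c p -> dom A e p -> cdiff e f p ->
  cderive c w f p = cderive e (tv A c p w e) f p.
Proof.
move=> cp ep df; rewrite /tv cderive.unlock.
have df' : differentiable (rep e f) (rep c (coord A e) (coord A c p)) by rewrite repE.
have := derive_comp w (cdiff_coord2 cp ep) df'; rewrite repE // => <-.
apply: (derive_eq_on _ (@mopen_dom e c)); first exact: chart_imageP.
by move=> _ [q [cq eq] <-]; rewrite /= !repE.
Qed.

Lemma csmooth_change V c e U (f : T -> V) : mopen A U -> U `<=` dom A c ->
  csmooth c U f -> csmooth e U f.
Proof.
move=> oU Uc sf.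
apply: (@csmooth_rep _ _ _ _ _ (fun y => rep c f (rep e (coord A c) y))) => //.
  by move=> q eq Uq; have cq := Uc q Uq; rewrite !repE.
apply: (smooth_comp (oU e) (oU c) _ _ sf).
  by move=> _ [q [eq Uq] <-]; rewrite repE //; apply: chart_imageP => //; exact: Uc.
exact: (csmooth_sub Uc (@csmooth_coord2 e c)).
Qed.

Lemma tv_cderiveE c p w e : tv A c p w e = cderive c w (coord A e) p.
Proof. by rewrite cderive.unlock. Qed.

Lemma tv_self c p w : dom A c p -> tv A c p w c = w.
Proof. by move=> cp; rewrite tv_cderiveE cderive_coord. Qed.

Lemma tv_is_tvec c p w : dom A c p -> is_tvec p (tv A c p w).
Proof.
move=> cp i ip j jp; rewrite [RHS]tv_cderiveE tv_cderiveE.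
exact: (cderive_change w cp ip (cdiff_coord2 ip jp)).
Qed.

Lemma tvec_cderive V c e p (v : tvec A) (f : T -> V) : is_tvec p v -> dom A c p -> dom A e p ->
  cdiff e f p -> cderive c (v c) f p = cderive e (v e) f p.
Proof.
move=> tp cp ep df; rewrite (cderive_change _ cp ep df).
by rewrite [in RHS](tp c cp e ep) tv_cderiveE.
Qed.

(** A tangent vector is determined by its components in a single chart.
    Identities between vectors are therefore proved in one chart, on rows. *)
Lemma tvec_eq c p (v w : tvec A) : is_tvec p v -> is_tvec p w -> dom A c p ->
  v c = w c -> veq p v w.
Proof. by move=> tp tw cp E e ep; rewrite (tp c cp e ep) (tw c cp e ep) E. Qed.

Lemma is_tvec_eq p (v w : tvec A) : veq p v w -> is_tvec p v -> is_tvec p w.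
Proof. by move=> E tp c cp e ep; rewrite -(E e ep) -(E c cp); exact: tp. Qed.

Lemma is_tvecD p (v w : tvec A) : is_tvec p v -> is_tvec p w -> is_tvec p (v + w).
Proof.
move=> tp tw c cp e ep; rewrite tv_cderiveE [(v + w) c]/(v c + w c).
rewrite cderive_dirD //; last exact: cdiff_coord2.
by rewrite [LHS]/(v e + w e) (tp c cp e ep) (tw c cp e ep) !tv_cderiveE.
Qed.

Lemma is_tvecZ p k (v : tvec A) : is_tvec p v -> is_tvec p (k *: v).
Proof.
move=> tp c cp e ep; rewrite tv_cderiveE [(k *: v) c]/(k *: v c).
by rewrite cderive_dirZ //; [rewrite [LHS]/(k *: v e) (tp c cp e ep) tv_cderiveE|exact: cdiff_coord2].
Qed.

Lemma is_tvec0 p : is_tvec p (0 : tvec A).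
Proof. by move=> c cp e ep; rewrite tv_cderiveE cderive_dir0. Qed.

Lemma is_tvecN p (v : tvec A) : is_tvec p v -> is_tvec p (- v).
Proof. by move=> tp; rewrite -scaleN1r; exact: is_tvecZ. Qed.

Lemma is_tvecB p (v w : tvec A) : is_tvec p v -> is_tvec p w -> is_tvec p (v - w).
Proof. by move=> tp tw; apply: is_tvecD => //; exact: is_tvecN. Qed.

(** All charts around p give the same value, so that the choice made by
    [dfun] is immaterial. *)
Lemma dfunE c p (v : tvec A) (f : T -> R) : is_tvec p v -> dom A c p ->
  (forall e, dom A e p -> cdiff e f p) -> dfun f p v = cderive c (v c) f p.
Proof.
move=> tp cp df; have E e : dom A e p -> 'D_(v e) (rep e f) (coord A e p) = cderive c (v c) f p.
  by move=> ep; rewrite (tvec_cderive tp cp ep (df e ep)) cderive.unlock.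
by apply: xget_unique => [|_ [e /= ep <-]]; [exists c => //; exact: E|exact: E].
Qed.

End Charts.

(** * Vector fields and their brackets *)

Section VectorFields.
Variables (R : realType) (T : Type) (d : nat) (A : atlas R T d).
Hypothesis hA : regular_atlas A.
Implicit Types (V W : normedModType R) (c e : idx A) (p q : T) (U : set T).
Implicit Types (X Y Z : vfield A) (v w : tvec A).

Lemma tvaddE v w c : (v + w) c = v c + w c. Proof. by []. Qed.
Lemma tvoppE v c : (- v) c = - v c. Proof. by []. Qed.
Lemma tvscaleE k v c : (k *: v) c = k *: v c. Proof. by []. Qed.
Lemma tvzeroE c : (0 : tvec A) c = 0. Proof. by []. Qed.
Lemma tvsumE I (r : seq I) (F : I -> tvec A) c :
  (\sum_(i <- r) F i) c = \sum_(i <- r) F i c.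
Proof. by elim/big_rec2: _ => [//|i y1 y2 _ <-]. Qed.

Lemma csmooth_domI V c U (f : T -> V) : csmooth c (U `&` dom A c) f -> csmooth c U f.
Proof.
by rewrite /csmooth /chart_image => h; apply: smooth_sub h => _ [q [cq Uq] <-]; exists q => //;
  split.
Qed.

Lemma vf_csmooth c U X : smooth_vfield U X -> csmooth c U (fun q => X q c).
Proof. by case=> _; apply. Qed.

Lemma vf_tvec U X p : smooth_vfield U X -> U p -> is_tvec p (X p).
Proof. by case=> h _ /h. Qed.

Lemma vf_sub U U' X : U' `<=` U -> smooth_vfield U X -> smooth_vfield U' X.
Proof.
move=> sU [h1 h2]; split=> [p /sU /h1 //|c].
exact: (csmooth_sub sU (h2 c)).
Qed.

Lemma vf_eq U X Y : mopen A U -> (forall q, U q -> veq q (X q) (Y q)) ->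
  smooth_vfield U X -> smooth_vfield U Y.
Proof.
move=> oU XY [h1 h2]; split=> [p Up|c].
  exact: (is_tvec_eq (XY p Up) (h1 p Up)).
apply: (@csmooth_eq _ _ _ _ hA _ _ oU _ _ _ _ (h2 c)) => q cq Uq; exact: XY.
Qed.

Lemma vfD U X Y : mopen A U -> smooth_vfield U X -> smooth_vfield U Y ->
  smooth_vfield U (fun q => X q + Y q).
Proof.
move=> oU sX sY; split=> [p Up|c].
  by apply: (is_tvecD hA); exact: vf_tvec Up.
exact: (csmoothD hA oU (vf_csmooth c sX) (vf_csmooth c sY)).
Qed.

Lemma vfZ U f X : mopen A U -> smooth_fun A U f -> smooth_vfield U X ->
  smooth_vfield U (fun q => f q *: X q).
Proof.
move=> oU sf sX; split=> [p Up|c].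
  by apply: (is_tvecZ hA); exact: vf_tvec Up.
exact: (csmoothZ hA oU (sf c) (vf_csmooth c sX)).
Qed.

Lemma sfun_cst U k : mopen A U -> smooth_fun A U (fun=> k).
Proof. by move=> oU c; exact: (csmooth_cst hA c oU). Qed.

Lemma vfN U X : mopen A U -> smooth_vfield U X -> smooth_vfield U (fun q => - X q).
Proof.
move=> oU sX; apply: (vf_eq oU _ (vfZ oU (sfun_cst (- 1) oU) sX)) => q Uq c cq.
by rewrite scaleN1r.
Qed.

Lemma vfB U X Y : mopen A U -> smooth_vfield U X -> smooth_vfield U Y ->
  smooth_vfield U (fun q => X q - Y q).
Proof. by move=> oU sX sY; exact: (vfD oU sX (vfN oU sY)). Qed.

Lemma vf0 U : mopen A U -> smooth_vfield U (fun=> 0 : tvec A).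
Proof.
move=> oU; split=> [p Up|c]; first exact: is_tvec0.
exact: (csmooth_cst hA c oU).
Qed.

Lemma vf_sum U I (r : seq I) (F : I -> vfield A) : mopen A U ->
  (forall i, smooth_vfield U (F i)) -> smooth_vfield U (fun q => \sum_(i <- r) F i q).
Proof.
move=> oU sF; elim: r => [|i r IH].
  by apply: vf_eq (vf0 oU) => // q Uq c cq; rewrite big_nil.
by apply: vf_eq (vfD oU (sF i) IH) => // q Uq c cq; rewrite big_cons.
Qed.

(** In any other chart e, the components of X are the derivatives of the
    coordinates of e along X. *)
Lemma vf_chart c U X : mopen A U -> U `<=` dom A c ->
  (forall q, U q -> is_tvec q (X q)) -> csmooth c U (fun q => X q c) ->
  smooth_vfield U X.
Proof.
move=> oU Uc tX sX; split=> // e; apply: (@csmooth_domI _ e U (fun q => X q e)).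
have oUe := mopenI hA oU (mopen_dom hA (c := e)).
have Uec : U `&` dom A e `<=` dom A c by move=> q [/Uc].
apply: (csmooth_change hA e oUe Uec).
apply: (@csmooth_eq _ _ _ _ hA _ _ oUe _ (fun q => cderive c (X q c) (coord A e) q)).
  by move=> q cq [Uq eq]; rewrite (tX q Uq c cq e eq) tv_cderiveE.
apply: (csmooth_cderive hA oUe); first by apply: csmooth_sub sX => q [].
by apply: csmooth_sub (csmooth_coord2 hA c e) => q [].
Qed.

Lemma vf_tv c U (w : T -> 'rV[R]_d) : mopen A U -> U `<=` dom A c -> csmooth c U w ->
  smooth_vfield U (fun q => tv A c q (w q)).
Proof.
move=> oU Uc sw; apply: (vf_chart (c := c)) => // [q Uq|].
  by apply: (tv_is_tvec hA); exact: Uc.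
apply: (csmooth_eq hA oU _ sw) => q cq _; by rewrite (tv_self hA).
Qed.

Lemma bracketE X Y : bracket X Y = lbracket X Y. Proof. by rewrite lbracket.unlock. Qed.

Lemma lbracketE X Y p c : lbracket X Y p c =
  cderive c (X p c) (fun q => Y q c) p - cderive c (Y p c) (fun q => X q c) p.
Proof. by rewrite lbracket.unlock cderive.unlock. Qed.

Lemma cderiveE V c (w : 'rV[R]_d) (f : T -> V) p : cderive c w f p = 'D_w (rep c f) (coord A c p).
Proof. by rewrite cderive.unlock. Qed.

Section Second.
Variables (c : idx A) (U : set T) (p : T).
Hypotheses (oU : mopen A U) (cp : dom A c p) (Up : U p).

Lemma cderive_sym m (f : T -> 'rV[R]_m) (w w' : 'rV[R]_d) : csmooth c U f ->
  cderive c w (fun q => cderive c w' f q) p = cderive c w' (fun q => cderive c w f q) p.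
Proof.
move=> sf.
have E u u' : cderive c u (fun q => cderive c u' f q) p = 'D_u ('D_u' (rep c f)) (coord A c p).
  by apply: (cderive_rep hA) => // q _; rewrite cderiveE.
rewrite !E; exact: (derive_sym _ _ (@oU c) (chart_imageP cp Up) sf).
Qed.

(** The second derivative of f along constant directions; expanding u over
    the basis keeps both directions constant when u later varies with the
    point. *)
Definition hess m (f : T -> 'rV[R]_m) (w u : 'rV[R]_d) :=
  \sum_(a < d) u 0 a *: cderive c w (fun q => cderive c (delta_mx 0 a) f q) p.

Lemma csmooth_cderive_cst V (f : T -> V) (w : 'rV[R]_d) : csmooth c U f ->
  csmooth c U (fun q => cderive c w f q).
Proof. by move=> sf; apply: (csmooth_cderive hA oU) => //; exact: (csmooth_cst hA). Qed.

Lemma hess_sym m (f : T -> 'rV[R]_m) (w u : 'rV[R]_d) : csmooth c U f -> hess f w u = hess f u w.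
Proof.
move=> sf; have dd a : cdiff c (fun q => cderive c (delta_mx 0 a) f q) p.
  by apply: csmooth_cdiff cp Up; exact: csmooth_cderive_cst.
have E (w' u' : 'rV[R]_d) : hess f w' u' = \sum_(a < d) \sum_(b < d) (u' 0 a * w' 0 b) *:
   cderive c (delta_mx 0 b) (fun q => cderive c (delta_mx 0 a) f q) p.
  apply: eq_bigr => a _; rewrite (cderive_dirE _ (dd a)) scaler_sumr.
  by apply: eq_bigr => b _; rewrite scalerA.
rewrite !E exchange_big; apply: eq_bigr => a _; apply: eq_bigr => b _.
by rewrite cderive_sym // mulrC.
Qed.

Lemma cderive_sum V I (r : seq I) (F : I -> T -> V) (w : 'rV[R]_d) : (forall i, cdiff c (F i) p) ->
  cderive c w (fun q => \sum_(i <- r) F i q) p = \sum_(i <- r) cderive c w (F i) p /\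
  cdiff c (fun q => \sum_(i <- r) F i q) p.
Proof.
move=> dF; elim: r => [|i r [IH1 IH2]].
  have E : (fun q => \sum_(i <- [::]) F i q) = (fun=> 0).
    by apply/funext => q; rewrite big_nil.
  rewrite E (cderive_cst hA cp) big_nil; split=> //.
  by apply: (cdiff_rep hA cp (F := fun=> 0)) => //; exact: differentiable_cst.
have E : (fun q => \sum_(j <- i :: r) F j q) = (fun q => F i q + \sum_(j <- r) F j q).
  by apply/funext => q; rewrite big_cons.
rewrite E (cderiveD hA cp _ (dF i) IH2) IH1 big_cons; split=> //.
apply: (cdiff_rep hA cp (F := rep c (F i) + rep c (fun q => \sum_(j <- r) F j q))).
  by move=> q cq; rewrite fctE !(repE hA).
exact: differentiableD (dF i) IH2.
Qed.

(** The product rule for the derivative of f along a variable direction u. *)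
Lemma cderive_cderive m (u : T -> 'rV[R]_d) (f : T -> 'rV[R]_m) (w : 'rV[R]_d) : csmooth c U u ->
  csmooth c U f ->
  cderive c w (fun q => cderive c (u q) f q) p = cderive c (cderive c w u p) f p + hess f w (u p).
Proof.
move=> su sf.
have df q : dom A c q -> U q -> cdiff c f q by move=> cq Uq; exact: csmooth_cdiff Uq.
have sa a : csmooth c U (fun q => entry a (u q)) by exact: (csmooth_lin hA oU).
have da a := csmooth_cdiff (sa a) cp Up.
have dd a : cdiff c (fun q => cderive c (delta_mx 0 a) f q) p.
  by apply: csmooth_cdiff cp Up; exact: csmooth_cderive_cst.
have ds a : cdiff c (fun q => entry a (u q) *: cderive c (delta_mx 0 a) f q) p.
  by apply: csmooth_cdiff cp Up; apply: (csmoothZ hA oU) => //; exact: csmooth_cderive_cst.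
rewrite (@cderive_eq _ _ _ _ hA _ _ _ _ _
  (fun q => \sum_(a < d) entry a (u q) *: cderive c (delta_mx 0 a) f q) p oU Up cp); last first.
  by move=> q cq Uq; rewrite (cderive_dirE _ (df q cq Uq)).
rewrite (cderive_sum _ _ ds).1 (cderive_dirE _ (df p cp Up)) /hess -big_split.
apply: eq_bigr => a _; rewrite (cderiveZ hA cp _ (da a) (dd a)) addrC.
congr (_ *: _ + _ *: _).
exact: (cderive_lin hA cp (@entry R d a) w (csmooth_cdiff su cp Up)).
Qed.

End Second.

Opaque hess.

Section Bracket.
Variables (U : set T).
Hypotheses (oU : mopen A U).

Lemma lbracket_anti X Y p c : lbracket X Y p c = - lbracket Y X p c.
Proof. by rewrite !lbracketE opprB. Qed.

(** In another chart both terms of the bracket acquire the second derivative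
    of the transition map along X and Y; by Schwarz's theorem these cancel. *)
Lemma lbracket_tvec X Y p : U p -> smooth_vfield U X -> smooth_vfield U Y ->
  is_tvec p (lbracket X Y p).
Proof.
move=> Up sX sY c cp e ep.
have oUe := mopenI hA oU (mopen_dom hA (c := e)).
have Uep : (U `&` dom A e) p by [].
have H X' Y' : smooth_vfield U X' -> smooth_vfield U Y' ->
   cderive e (X' p e) (fun q => Y' q e) p =
   cderive c (cderive c (X' p c) (fun q => Y' q c) p) (coord A e) p +
   hess c p (coord A e) (X' p c) (Y' p c).
  move=> sX' sY'.
  rewrite -(tvec_cderive hA (vf_tvec sX' Up) cp ep); last first.
    exact: csmooth_cdiff (vf_csmooth e sY') ep Up.
  rewrite -(cderive_cderive oUe cp Uep (u := fun q => Y' q c)); last first.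
  - by apply: csmooth_sub (csmooth_coord2 hA c e) => q [].
  - by apply: csmooth_sub (vf_csmooth c sY') => q [].
  apply: (cderive_eq hA _ oUe Uep cp) => q cq [Uq eq].
  by rewrite (vf_tvec sY' Uq cq eq) tv_cderiveE.
rewrite tv_cderiveE !lbracketE (H _ _ sX sY) (H _ _ sY sX).
rewrite (hess_sym oUe cp Uep (Y p c) (X p c)); last first.
  by apply: csmooth_sub (csmooth_coord2 hA c e) => q [].
have cancel (a b h : 'rV[R]_d) : (a + h) - (b + h) = a - b.
  by rewrite opprD addrACA subrr addr0.
rewrite cancel.
have de := cdiff_coord2 hA cp ep.
by rewrite (cderive_dirB _ _ de).
Qed.

Lemma lbracket_vf X Y : smooth_vfield U X -> smooth_vfield U Y ->
  smooth_vfield U (lbracket X Y).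
Proof.
move=> sX sY; split=> [p Up|c]; first exact: lbracket_tvec.
have H X' Y' : smooth_vfield U X' -> smooth_vfield U Y' ->
   csmooth c U (fun p => cderive c (X' p c) (fun q => Y' q c) p).
  by move=> sX' sY'; apply: (csmooth_cderive hA oU); exact: vf_csmooth.
apply: (@csmooth_eq _ _ _ _ hA _ _ oU _
  (fun p => cderive c (X p c) (fun q => Y q c) p + (-1) *: cderive c (Y p c) (fun q => X q c) p)).
  by move=> q cq Uq; rewrite lbracketE scaleN1r.
apply: (csmoothD hA oU); first exact: H.
apply: (csmoothZ hA oU); first exact: (csmooth_cst hA).
exact: H.
Qed.

Lemma lbracket_local X X' Y Y' :
  (forall p, U p -> veq p (X p) (X' p)) -> (forall p, U p -> veq p (Y p) (Y' p)) ->
  forall p, U p -> veq p (lbracket X Y p) (lbracket X' Y' p).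
Proof.
move=> XX YY p Up c cp; rewrite !lbracketE (XX p Up c cp) (YY p Up c cp).
have E X1 Y1 Y2 : (forall p, U p -> veq p (Y1 p) (Y2 p)) ->
    cderive c (X1 p c) (fun q => Y1 q c) p = cderive c (X1 p c) (fun q => Y2 q c) p.
  by move=> YY12; apply: (cderive_eq hA _ oU Up cp) => q cq Uq; exact: YY12.
by rewrite (E X' Y Y' YY) (E Y' X X' XX).
Qed.

Lemma lbracketDr X Y Y' p c : U p -> dom A c p -> smooth_vfield U X ->
  smooth_vfield U Y -> smooth_vfield U Y' ->
  lbracket X (fun q => Y q + Y' q) p c = lbracket X Y p c + lbracket X Y' p c.
Proof.
move=> Up cp sX sY sY'; rewrite !lbracketE.
have dY := csmooth_cdiff (vf_csmooth c sY) cp Up; have dY' := csmooth_cdiff (vf_csmooth c sY')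
  cp Up.
have dX := csmooth_cdiff (vf_csmooth c sX) cp Up.
by rewrite tvaddE (cderive_dirD _ _ dX) (cderiveD hA cp _ dY dY') opprD addrACA.
Qed.

Lemma lbracketZr X Y f p c : U p -> dom A c p -> smooth_vfield U X ->
  smooth_vfield U Y -> smooth_fun A U f ->
  lbracket X (fun q => f q *: Y q) p c =
  f p *: lbracket X Y p c + dfun f p (X p) *: Y p c.
Proof.
move=> Up cp sX sY sf; rewrite !lbracketE.
have dY := csmooth_cdiff (vf_csmooth c sY) cp Up.
have dX := csmooth_cdiff (vf_csmooth c sX) cp Up.
have df e (ep : dom A e p) := csmooth_cdiff (sf e) ep Up.
rewrite tvscaleE (cderive_dirZ _ _ dX) (cderiveZ hA cp _ (df c cp) dY).
rewrite (dfunE hA (vf_tvec sX Up) cp df) scalerBr.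
by rewrite addrAC.
Qed.

Lemma lbracketDl X X' Y p c : U p -> dom A c p -> smooth_vfield U X ->
  smooth_vfield U X' -> smooth_vfield U Y ->
  lbracket (fun q => X q + X' q) Y p c = lbracket X Y p c + lbracket X' Y p c.
Proof.
move=> Up cp sX sX' sY; rewrite lbracket_anti (lbracketDr Up cp sY sX sX').
rewrite (lbracket_anti Y X) (lbracket_anti Y X').
move: (lbracket _ _ _ _) (lbracket _ _ _ _) => a b.
by rewrite opprD !opprK.
Qed.

Lemma lbracketZl X Y f p c : U p -> dom A c p -> smooth_vfield U X ->
  smooth_vfield U Y -> smooth_fun A U f ->
  lbracket (fun q => f q *: X q) Y p c =
  f p *: lbracket X Y p c - dfun f p (Y p) *: X p c.
Proof.
move=> Up cp sX sY sf; rewrite lbracket_anti (lbracketZr Up cp sY sX sf).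
rewrite (lbracket_anti Y X).
move: (lbracket _ _ _ _) (X p c) => a b.
by rewrite opprD scalerN opprK.
Qed.

End Bracket.

End VectorFields.

(** * Tensorial operators *)

Section Tensors.
Variables (R : realType) (T : Type) (d : nat) (A : atlas R T d).
Hypothesis hA : regular_atlas A.
Implicit Types (V : normedModType R) (c e : idx A) (p q : T) (U W : set T).
Implicit Types (X Y Z : vfield A) (v w : tvec A).

Lemma csmooth_dom V c U (f : T -> V) : csmooth c (dom A c) f -> csmooth c U f.
Proof.
by rewrite /csmooth /chart_image => h; apply: smooth_sub h => _ [q [cq Uq] <-]; exists q.
Qed.

Lemma sfun_chart c U (f : T -> R) : mopen A U -> U `<=` dom A c -> csmooth c U f ->
  smooth_fun A U f.
Proof. by move=> oU Uc sf e; exact: (csmooth_change hA e oU Uc sf). Qed.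

(** A smooth field of endomorphisms of the tangent bundle, given in each
    chart by linear maps on rows that preserve smoothness. *)
Record endo (L : T -> tvec A -> tvec A) : Prop := Endo {
  endo_tvec : forall p v, is_tvec p v -> is_tvec p (L p v) ;
  endo_row : forall c, exists l : T -> 'rV[R]_d -> 'rV[R]_d,
    [/\ forall q v, dom A c q -> is_tvec q v -> L q v c = l q (v c),
        forall q a (u w : 'rV[R]_d), dom A c q ->
          l q (a *: u + w) = a *: l q u + l q w &
        forall U (w : T -> 'rV[R]_d), mopen A U -> csmooth c U w ->
          csmooth c U (fun q => l q (w q))] }.

Section Endo.
Variable L : T -> tvec A -> tvec A.
Hypothesis eL : endo L.

Lemma endo_comb c q a u v w : dom A c q -> is_tvec q u -> is_tvec q v -> is_tvec q w ->
  v c = a *: u c + w c -> L q v c = a *: L q u c + L q w c.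
Proof.
move=> cq tu tv tw E; have [l [lE llin _]] := endo_row eL c.
by rewrite !lE // E llin.
Qed.

Lemma endo_eq c q v w : dom A c q -> is_tvec q v -> is_tvec q w ->
  v c = w c -> L q v c = L q w c.
Proof.
by move=> cq tv tw E; have [l [lE _ _]] := endo_row eL c; rewrite !lE // E.
Qed.

Lemma endo_zero c q v : dom A c q -> is_tvec q v -> v c = 0 -> L q v c = 0.
Proof.
move=> cq tv E; have := endo_comb (a := -1) cq tv tv tv.
by rewrite E scaler0 addr0 => /(_ erefl) ->; rewrite scaleN1r addNr.
Qed.

Lemma endoD c q v w : dom A c q -> is_tvec q v -> is_tvec q w ->
  L q (v + w) c = L q v c + L q w c.
Proof.
move=> cq tv tw; have := endo_comb (a := 1) cq tv (is_tvecD hA tv tw) tw.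
by rewrite !scale1r; apply.
Qed.

Lemma endoZ c q a v : dom A c q -> is_tvec q v -> L q (a *: v) c = a *: L q v c.
Proof.
move=> cq tv; have t0 := @is_tvec0 _ _ _ A q.
have := endo_comb (a := a) cq tv (is_tvecZ hA a tv) t0.
by rewrite (endo_zero cq t0) // !addr0; apply.
Qed.

Lemma endo_vf U X : mopen A U -> smooth_vfield U X -> smooth_vfield U (fun q => L q (X q)).
Proof.
move=> oU sX; split=> [p Up|c].
  exact: (endo_tvec eL (vf_tvec sX Up)).
have [l [lE _ ls]] := endo_row eL c.
apply: (@csmooth_eq _ _ _ _ hA _ _ oU _ _ _ _ (ls U _ oU (vf_csmooth c sX))) => q cq Uq.
by rewrite lE //; exact: vf_tvec Uq.
Qed.

End Endo.

Lemma endo_comp L L' : endo L -> endo L' -> endo (fun q v => L q (L' q v)).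
Proof.
move=> eL eL'; split=> [p v tv|c]; first by apply: (endo_tvec eL); exact: endo_tvec tv.
have [l [lE ll ls]] := endo_row eL c; have [l' [lE' ll' ls']] := endo_row eL' c.
exists (fun q u => l q (l' q u)); split=> [q v cq tv|q a u1 u2 cq|U w1 oU sw].
- by rewrite (lE q (L' q v) cq (endo_tvec eL' tv)) (lE' q v cq tv).
- by rewrite ll' // ll.
- by apply: ls => //; exact: ls'.
Qed.

(** Local and linear over the smooth functions, on every open subset of W.
    Such an operator depends on the value of X at the point only
    ([tensorial_pt]), and is determined by its values on a local frame
    ([tensorial_expand]). *)
Definition tensorial W (Phi : vfield A -> vfield A) := forall U, mopen A U -> U `<=` W ->
  [/\ forall X X', smooth_vfield U X -> smooth_vfield U X' ->
        (forall q, U q -> veq q (X q) (X' q)) ->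
        forall p c, U p -> dom A c p -> Phi X p c = Phi X' p c,
      forall X X', smooth_vfield U X -> smooth_vfield U X' ->
        forall p c, U p -> dom A c p ->
        Phi (fun q => X q + X' q) p c = Phi X p c + Phi X' p c &
      forall f X, smooth_fun A U f -> smooth_vfield U X ->
        forall p c, U p -> dom A c p ->
        Phi (fun q => f q *: X q) p c = f p *: Phi X p c].

Lemma tensorial_expand W Phi c m (E : 'I_m -> vfield A) (x : 'I_m -> T -> R) X p :
  tensorial W Phi -> mopen A W -> W p -> dom A c p ->
  (forall a, csmooth c (W `&` dom A c) (x a)) ->
  (forall a, smooth_vfield (W `&` dom A c) (E a)) -> smooth_vfield W X ->
  (forall q, W q -> dom A c q -> X q c = \sum_(a < m) x a q *: E a q c) ->
  Phi X p c = \sum_(a < m) x a p *: Phi (E a) p c.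
Proof.
move=> tP oW Wp cp sx sE sX XE.
have oW' := mopenI hA oW (mopen_dom hA (c := c)).
have W'W : W `&` dom A c `<=` W by move=> q [].
have W'c : W `&` dom A c `<=` dom A c by move=> q [].
have W'p : (W `&` dom A c) p by [].
have sfx a : smooth_fun A (W `&` dom A c) (x a) by exact: sfun_chart W'c (sx a).
have [loc add sca] := tP _ oW' W'W.
have sxE a : smooth_vfield (W `&` dom A c) (fun q => x a q *: E a q).
  exact: (vfZ hA oW' (sfx a) (sE a)).
have sS r : smooth_vfield (W `&` dom A c) (fun q => \sum_(a <- r) x a q *: E a q).
  exact: (vf_sum hA r oW' sxE).
have PE r : Phi (fun q => \sum_(a <- r) x a q *: E a q) p c =
    \sum_(a <- r) x a p *: Phi (E a) p c.
  elim: r => [|a r IH].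
    rewrite big_nil (loc _ (fun q => (fun=> 0 : R) q *: (fun=> 0 : tvec A) q)) //.
    - by rewrite sca ?scale0r //; [exact: (sfun_cst hA)|exact: (vf0 hA)].
    - by apply: (vfZ hA) => //; [exact: (sfun_cst hA)|exact: (vf0 hA)].
    - by move=> q W'q e eq; rewrite big_nil scale0r.
  rewrite big_cons -IH -sca // -add //; apply: loc => //.
    exact: (vfD hA oW' (sxE a) (sS r)).
  by move=> q W'q e eq; rewrite big_cons.
rewrite -PE; apply: loc => //; first exact: (vf_sub W'W).
move=> q [Wq cq]; apply: (tvec_eq (c := c)) => //; first exact: vf_tvec Wq.
  exact: vf_tvec (sS _) _.
by rewrite XE // tvsumE.
Qed.

Lemma tensorial_pt W Phi c X X' p :
  tensorial W Phi -> mopen A W -> W p -> dom A c p ->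
  smooth_vfield W X -> smooth_vfield W X' -> X p c = X' p c ->
  Phi X p c = Phi X' p c.
Proof.
move=> tP oW Wp cp sX sX' E.
have oW' := mopenI hA oW (mopen_dom hA (c := c)).
have W'c : W `&` dom A c `<=` dom A c by move=> q [].
pose E0 (a : 'I_d) : vfield A := fun q => tv A c q (delta_mx 0 a).
have sE0 a : smooth_vfield (W `&` dom A c) (E0 a).
  by apply: (vf_tv hA oW' W'c); exact: (csmooth_cst hA).
have H Z : smooth_vfield W Z ->
    Phi Z p c = \sum_(a < d) entry a (Z p c) *: Phi (E0 a) p c.
  move=> sZ; apply: (tensorial_expand (x := fun a q => entry a (Z q c)) tP) => //.
    move=> a; apply: (csmooth_lin hA oW'); apply: csmooth_sub (vf_csmooth c sZ).
    by move=> q [].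
  move=> q Wq cq; rewrite {1}[Z q c]row_sum_delta; apply: eq_bigr => a _.
  by rewrite /E0 (tv_self hA).
by rewrite (H X) // (H X') // E.
Qed.

Lemma lie_endoE X S Y p c : lie_endo X S Y p c =
  lbracket X (fun q => S q (Y q)) p c - S p (lbracket X Y p) c.
Proof. by rewrite lbracket.unlock. Qed.

Lemma lbracket_localr U X Y Y' p c : mopen A U -> U p -> dom A c p ->
  (forall q, U q -> veq q (Y q) (Y' q)) -> lbracket X Y p c = lbracket X Y' p c.
Proof.
by move=> oU Up cp YY; apply: (lbracket_local hA oU (X := X) (Y := Y)).
Qed.

Lemma lbracket_locall U X X' Y p c : mopen A U -> U p -> dom A c p ->
  (forall q, U q -> veq q (X q) (X' q)) -> lbracket X Y p c = lbracket X' Y p c.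
Proof.
by move=> oU Up cp XX; apply: (lbracket_local hA oU (X := X) (Y := Y)).
Qed.

Lemma lie_vf U X S Y : mopen A U -> endo S -> smooth_vfield U X -> smooth_vfield U Y ->
  smooth_vfield U (lie_endo X S Y).
Proof.
move=> oU eS sX sY; rewrite /lie_endo bracketE; apply: (vfB hA oU); rewrite ?bracketE.
  exact: (lbracket_vf hA oU sX (endo_vf eS oU sY)).
exact: (endo_vf eS oU (lbracket_vf hA oU sX sY)).
Qed.

(** In [X, S (f Y)] and in S [X, f Y] the derivative of f along X multiplies
    the same vector S Y. *)
Lemma lie_tensorial W X S : endo S -> smooth_vfield W X -> tensorial W (lie_endo X S).
Proof.
move=> eS sXW U oU UW; have sX := vf_sub UW sXW.
split=> [Y Y' sY sY' YY p c Up cp|Y Y' sY sY' p c Up cp|f Y sf sY p c Up cp];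
    rewrite !lie_endoE.
- have tb := lbracket_tvec hA oU Up sX sY; have tb' := lbracket_tvec hA oU Up sX sY'.
  have SS q : U q -> veq q (S q (Y q)) (S q (Y' q)).
    move=> Uq e eq.
    exact: (endo_eq eS eq (vf_tvec sY Uq) (vf_tvec sY' Uq) (YY q Uq e eq)).
  have E1 := lbracket_localr X oU Up cp SS; have E2 := lbracket_localr X oU Up cp YY.
  by rewrite E1 (endo_eq eS cp tb tb' E2).
- have tY := lbracket_tvec hA oU Up sX sY; have tY' := lbracket_tvec hA oU Up sX sY'.
  have tYY := lbracket_tvec hA oU Up sX (vfD hA oU sY sY').
  have SS q : U q -> veq q (S q (Y q + Y' q)) (S q (Y q) + S q (Y' q)).
    by move=> Uq e eq; rewrite (endoD eS eq (vf_tvec sY Uq) (vf_tvec sY' Uq)).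
  rewrite (lbracket_localr X oU Up cp SS).
  rewrite (lbracketDr hA Up cp sX (endo_vf eS oU sY) (endo_vf eS oU sY')).
  have E : S p (lbracket X (fun q => Y q + Y' q) p) c =
      1 *: S p (lbracket X Y p) c + S p (lbracket X Y' p) c.
    apply: (endo_comb eS cp tY tYY tY').
    by rewrite scale1r (lbracketDr hA Up cp sX sY sY').
  by rewrite E scale1r opprD addrACA.
- have tY := lbracket_tvec hA oU Up sX sY; have ty := vf_tvec sY Up.
  have tYY := lbracket_tvec hA oU Up sX (vfZ hA oU sf sY).
  have SS q : U q -> veq q (S q (f q *: Y q)) (f q *: S q (Y q)).
    by move=> Uq e eq; rewrite (endoZ eS (f q) eq (vf_tvec sY Uq)).
  rewrite (lbracket_localr X oU Up cp SS).
  rewrite (lbracketZr hA Up cp sX (endo_vf eS oU sY) sf).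
  have E : S p (lbracket X (fun q => f q *: Y q) p) c =
      f p *: S p (lbracket X Y p) c + S p (dfun f p (X p) *: Y p) c.
    apply: (endo_comb eS cp tY tYY (is_tvecZ hA _ ty)).
    by rewrite (lbracketZr hA Up cp sX sY sf).
  rewrite E (endoZ eS _ cp ty).
  move: (lbracket _ _ _ _) (S _ _ _) (S _ _ _) (dfun _ _ _) (f p) => a1 a2 a3 a4 a5.
  by rewrite scalerBr opprD addrACA subrr addr0.
Qed.

Lemma tensorialB W Phi Psi : tensorial W Phi -> tensorial W Psi ->
  tensorial W (fun X p c => Phi X p c - Psi X p c).
Proof.
move=> tP tQ U oU UW; have [l1 a1 s1] := tP U oU UW; have [l2 a2 s2] := tQ U oU UW.
split=> [X X' sX sX' XX p c Up cp|X X' sX sX' p c Up cp|f X sf sX p c Up cp].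
- by rewrite (l1 X X') // (l2 X X').
- by rewrite a1 // a2 // opprD addrACA.
- by rewrite s1 // s2 // scalerBr.
Qed.

Section Connection.
Variable D : linear_connection A.

Lemma cov_leib U f Y X p c : mopen A U -> smooth_fun A U f -> smooth_vfield U Y ->
  smooth_vfield U X -> U p -> dom A c p ->
  D Y (fun q => f q *: X q) p c = dfun f p (Y p) *: X p c + f p *: D Y X p c.
Proof. by move=> oU sf sY sX Up cp; rewrite (cov_leibniz D oU sf sY sX Up cp). Qed.

Lemma cov_Dr U Y X X' p c : mopen A U -> smooth_vfield U Y ->
  smooth_vfield U X -> smooth_vfield U X' -> U p -> dom A c p ->
  D Y (fun q => X q + X' q) p c = D Y X p c + D Y X' p c.
Proof. by move=> oU sY sX sX' Up cp; rewrite (cov_addr D oU sY sX sX' Up cp). Qed.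

Lemma cov_tensorial W X : smooth_vfield W X -> tensorial W (fun Y => D Y X).
Proof.
move=> sXW U oU UW; have sX := vf_sub UW sXW.
split=> [Y Y' sY sY' YY p c Up cp|Y Y' sY sY' p c Up cp|f Y sf sY p c Up cp].
- exact: (cov_local D oU sY sY' sX sX YY).
- by rewrite (cov_addl D oU sY sY' sX Up cp).
- by rewrite (cov_scalel D oU sf sY sX Up cp).
Qed.

Lemma cov_localr U Y X X' p c : mopen A U -> smooth_vfield U Y ->
  smooth_vfield U X -> smooth_vfield U X' ->
  (forall q, U q -> veq q (X q) (X' q)) -> U p -> dom A c p -> D Y X p c = D Y X' p c.
Proof. by move=> oU sY sX sX' XX Up cp; exact: (cov_local D oU sY sY sX sX'). Qed.

Lemma torsionE X Y p c : torsion D X Y p c = D X Y p c - D Y X p c - lbracket X Y p c.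
Proof. by rewrite lbracket.unlock. Qed.

Lemma torsion_anti X Y p c : torsion D X Y p c = - torsion D Y X p c.
Proof.
rewrite !torsionE (lbracket_anti X Y).
by move: (D _ _ _ _) (D _ _ _ _) (lbracket _ _ _ _) => a b e; rewrite !opprB opprK addrC addrA.
Qed.

(** The derivative of f along X appears with the factor Y both in the
    derivative of f Y along X and in the bracket of X and f Y. *)
Lemma torsion_tensorial W X : smooth_vfield W X -> tensorial W (torsion D X).
Proof.
move=> sXW U oU UW; have sX := vf_sub UW sXW.
have [l a s] := cov_tensorial sXW oU UW.
split=> [Y Y' sY sY' YY p c Up cp|Y Y' sY sY' p c Up cp|f Y sf sY p c Up cp];
    rewrite !torsionE.
- by rewrite (cov_localr oU sX sY sY' YY Up cp) (l _ _ sY sY' YY) //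
    (lbracket_localr _ oU Up cp YY).
- rewrite (cov_Dr oU sX sY sY' Up cp) (a _ _ sY sY') // (lbracketDr hA Up cp sX sY sY').
  move: (D _ _ _ _) (D _ _ _ _) (D _ _ _ _) (D _ _ _ _) (lbracket _ _ _ _) (lbracket _ _ _ _).
  by move=> a1 a2 a3 a4 a5 a6; apply/rowP => j; rewrite !mxE; ring.
- rewrite (cov_leib oU sf sX sY Up cp) (s f) // (lbracketZr hA Up cp sX sY sf).
  move: (D _ _ _ _) (D _ _ _ _) (lbracket _ _ _ _) (dfun _ _ _) (Y p c) (f p).
  by move=> a1 a2 a3 a4 a5 a6; apply/rowP => j; rewrite !mxE; ring.
Qed.

Lemma cov_sum U Y m (E : 'I_m -> vfield A) (x : 'I_m -> T -> R) p c : mopen A U ->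
  smooth_vfield U Y -> (forall a, smooth_fun A U (x a)) ->
  (forall a, smooth_vfield U (E a)) -> U p -> dom A c p ->
  D Y (fun q => \sum_(a < m) x a q *: E a q) p c =
  \sum_(a < m) (dfun (x a) p (Y p) *: E a p c + x a p *: D Y (E a) p c).
Proof.
move=> oU sY sx sE Up cp.
have sxE a : smooth_vfield U (fun q => x a q *: E a q) by exact: (vfZ hA oU).
have sS r : smooth_vfield U (fun q => \sum_(a <- r) x a q *: E a q).
  exact: (vf_sum hA r oU sxE).
elim: (index_enum _) => [|a r IH].
  rewrite big_nil.
  rewrite (cov_localr (X' := fun q => (fun=> 0 : R) q *: (fun=> 0 : tvec A) q) oU sY) //.
  - rewrite (cov_leib oU (sfun_cst hA 0 oU) sY (vf0 hA oU) Up cp).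
    by rewrite scale0r addr0 tvzeroE scaler0.
  - by apply: (vfZ hA) => //; [exact: (sfun_cst hA)|exact: (vf0 hA)].
  - by move=> q W'q e eq; rewrite big_nil scale0r.
rewrite big_cons -IH -(cov_leib oU (sx a) sY (sE a) Up cp).
rewrite -(cov_Dr oU sY (sxE a) (sS r) Up cp).
apply: (cov_localr oU) => //; first exact: (vfD hA oU (sxE a) (sS r)).
by move=> q Uq e eq; rewrite big_cons.
Qed.

End Connection.

(** The Leibniz terms of two connections are the same. *)
Lemma cov_diff_tensorial (D D' : linear_connection A) W Y : smooth_vfield W Y ->
  tensorial W (fun X p c => D Y X p c - D' Y X p c).
Proof.
move=> sYW U oU UW; have sY := vf_sub UW sYW.
split=> [X X' sX sX' XX p c Up cp|X X' sX sX' p c Up cp|f X sf sX p c Up cp].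
- by rewrite (cov_localr D oU sY sX sX' XX Up cp) (cov_localr D' oU sY sX sX' XX Up cp).
- by rewrite (cov_Dr D oU sY sX sX' Up cp) (cov_Dr D' oU sY sX sX' Up cp) opprD addrACA.
- rewrite (cov_leib D oU sf sY sX Up cp) (cov_leib D' oU sf sY sX Up cp).
  by rewrite opprD addrACA subrr add0r scalerBr.
Qed.

End Tensors.

(** * Coordinates on the space of 1-jets *)

(** The row with t-part a, x-part b and \dot x-part e. Rows on the space of
    1-jets are compared part by part through [row_ext]. *)
HB.lock Definition txv (R : realType) (n : nat) (a : R) (b e : 'rV[R]_n) :
  'rV[R]_(1 + (n + n)) := row_mx a%:M (row_mx b e).
HB.lock Definition tcoord (R : realType) (n : nat) (w : 'rV[R]_(1 + (n + n))) : R :=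
  lsubmx w 0 0.
HB.lock Definition xcoord (R : realType) (n : nat) (w : 'rV[R]_(1 + (n + n))) : 'rV[R]_n :=
  lsubmx (rsubmx w).
HB.lock Definition vcoord (R : realType) (n : nat) (w : 'rV[R]_(1 + (n + n))) : 'rV[R]_n :=
  rsubmx (rsubmx w).
Arguments txv {R n} a b e.
Arguments tcoord {R n} w.
Arguments xcoord {R n} w.
Arguments vcoord {R n} w.

Section Rows.
Variables (R : realType) (n : nat).
Implicit Types w : 'rV[R]_(1 + (n + n)).

Lemma tcoord_linear : linear (@tcoord R n).
Proof. by move=> k u v; rewrite tcoord.unlock !mxE. Qed.
Lemma xcoord_linear : linear (@xcoord R n).
Proof. by move=> k u v; rewrite xcoord.unlock !linearP. Qed.
Lemma vcoord_linear : linear (@vcoord R n).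
Proof. by move=> k u v; rewrite vcoord.unlock !linearP. Qed.
HB.instance Definition _ := GRing.isLinear.Build _ _ _ _ (@tcoord R n) tcoord_linear.
HB.instance Definition _ := GRing.isLinear.Build _ _ _ _ (@xcoord R n) xcoord_linear.
HB.instance Definition _ := GRing.isLinear.Build _ _ _ _ (@vcoord R n) vcoord_linear.

Lemma tcoord_row (b e : 'rV[R]_n) (a : 'rV[R]_1) : tcoord (row_mx a (row_mx b e)) = a 0 0.
Proof. by rewrite tcoord.unlock row_mxKl. Qed.
Lemma xcoord_row b e (a : 'rV[R]_1) : xcoord (row_mx a (row_mx b e)) = b :> 'rV[R]_n.
Proof. by rewrite xcoord.unlock row_mxKr row_mxKl. Qed.
Lemma vcoord_row b e (a : 'rV[R]_1) : vcoord (row_mx a (row_mx b e)) = e :> 'rV[R]_n.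
Proof. by rewrite vcoord.unlock !row_mxKr. Qed.

Lemma tcoord_txv a (b e : 'rV[R]_n) : tcoord (txv a b e) = a.
Proof. by rewrite txv.unlock tcoord_row mxE eqxx. Qed.
Lemma xcoord_txv a (b e : 'rV[R]_n) : xcoord (txv a b e) = b.
Proof. by rewrite txv.unlock xcoord_row. Qed.
Lemma vcoord_txv a (b e : 'rV[R]_n) : vcoord (txv a b e) = e.
Proof. by rewrite txv.unlock vcoord_row. Qed.

Lemma txv_eta w : w = txv (tcoord w) (xcoord w) (vcoord w).
Proof. by rewrite txv.unlock tcoord.unlock xcoord.unlock vcoord.unlock -mx11_scalar !hsubmxK. Qed.

Lemma row_ext w w' : tcoord w = tcoord w' -> xcoord w = xcoord w' -> vcoord w = vcoord w' -> w = w'.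
Proof. by move=> ht hx hv; rewrite [w]txv_eta [w']txv_eta ht hx hv. Qed.

Lemma tcoordD w w' : tcoord (w + w') = tcoord w + tcoord w'. Proof. exact: linearD. Qed.
Lemma tcoordN w : tcoord (- w) = - tcoord w. Proof. exact: linearN. Qed.
Lemma tcoordZ k w : tcoord (k *: w) = k * tcoord w. Proof. exact: linearZ. Qed.
Lemma tcoord0 : tcoord (0 : 'rV[R]_(1 + (n + n))) = 0. Proof. exact: linear0. Qed.
Lemma xcoordD w w' : xcoord (w + w') = xcoord w + xcoord w'. Proof. exact: linearD. Qed.
Lemma xcoordN w : xcoord (- w) = - xcoord w. Proof. exact: linearN. Qed.
Lemma xcoordZ k w : xcoord (k *: w) = k *: xcoord w. Proof. exact: linearZ. Qed.
Lemma xcoord0 : xcoord (0 : 'rV[R]_(1 + (n + n))) = 0. Proof. exact: linear0. Qed.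
Lemma vcoordD w w' : vcoord (w + w') = vcoord w + vcoord w'. Proof. exact: linearD. Qed.
Lemma vcoordN w : vcoord (- w) = - vcoord w. Proof. exact: linearN. Qed.
Lemma vcoordZ k w : vcoord (k *: w) = k *: vcoord w. Proof. exact: linearZ. Qed.
Lemma vcoord0 : vcoord (0 : 'rV[R]_(1 + (n + n))) = 0. Proof. exact: linear0. Qed.

End Rows.

#[global] Hint Rewrite tcoord_txv xcoord_txv vcoord_txv tcoordD tcoordN tcoordZ tcoord0 xcoordD
  xcoordN xcoordZ xcoord0 vcoordD vcoordN vcoordZ vcoord0
  : row_db.
Ltac rowE := autorewrite with row_db.

Section Jets.
Variables (R : realType) (M : topologicalType) (n : nat) (A : atlas R M n).
Hypothesis hM : smooth_manifold A.

Lemma manifold_regular : regular_atlas A.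
Proof.
split=> [c|c e|c e].
- by have [] := sm_chart hM c.
- have [oc _ _ im] := sm_chart hM c; have [oe _ _ _] := sm_chart hM e.
  by apply: im; [exact: openI|exact: subIsetl].
- exact: (sm_compat hM c e).
Qed.
Let hA := manifold_regular.

Lemma jreprP r (xi : jet A r) : jcurves xi = jet_class A r (jtime xi) (jrepr xi).
Proof. exact: (s2valP' (cid2 (jcurvesP xi))). Qed.

Lemma mkjet_same r t g (hg : smooth_curve A g) : same_jet A r t (jrepr (mkjet r t hg)) g.
Proof.
have : jcurves (mkjet r t hg) g by split.
by rewrite jreprP => -[].
Qed.

Lemma jtarget_mkjet r t g (hg : smooth_curve A g) : jtarget (mkjet r t hg) = g t.
Proof. by have [] := mkjet_same r t hg. Qed.

Lemma jcoord_mkjet r t g (hg : smooth_curve A g) c k : (k <= r)%N -> dom A c (g t) ->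
  jcoord c k (mkjet r t hg) = derive1n k (coord A c \o g) t.
Proof. by move=> kr cg; have [E] := mkjet_same r t hg; rewrite E; apply. Qed.

Lemma curve_open g c : smooth_curve A g -> open [set t | dom A c (g t)].
Proof.
move=> [/continuousP cg _]; have [oc _ _ _] := sm_chart hM c; exact: (cg _ oc).
Qed.

Lemma curve_change g t c e : smooth_curve A g -> dom A c (g t) -> dom A e (g t) ->
  derive1n 1 (coord A e \o g) t = tv A c (g t) (derive1n 1 (coord A c \o g) t) e.
Proof.
move=> hg ct et; rewrite !derive1n1 !derive1E tv_cderiveE cderive.unlock.
have df : differentiable (coord A c \o g) t by apply: smooth_diff (hg.2 c) _.
have dg : differentiable (rep c (coord A e)) ((coord A c \o g) t).
  exact: (cdiff_coord2 hA ct et).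
rewrite -[RHS](derive_comp (1 : R) df dg).
apply: (derive_eq_on _ (@curve_open g c hg)) => // u cu /=.
by rewrite (repE hA).
Qed.

Lemma jcoord1_change r (xi : jet A r) c e : dom A c (jtarget xi) -> dom A e (jtarget xi) ->
  jcoord e 1 xi = tv A c (jtarget xi) (jcoord c 1 xi) e.
Proof. exact: (curve_change (jrepr_smooth xi)). Qed.

Lemma same_jet_sym r t g h : same_jet A r t g h -> same_jet A r t h g.
Proof.
move=> [E H]; split=> // i ih k kr; rewrite H //; by rewrite E.
Qed.

Lemma same_jet_trans r t g h k : same_jet A r t g h -> same_jet A r t h k ->
  same_jet A r t g k.
Proof.
move=> [E H] [E' H']; split=> [|i ig j jr]; first by rewrite E.
by rewrite H // H' // -E.
Qed.

(** Both classes consist of the smooth curves that have the same jet as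
    either representative. *)
Lemma jet_eq r (xi eta : jet A r) : jtime xi = jtime eta ->
  same_jet A r (jtime xi) (jrepr xi) (jrepr eta) -> xi = eta.
Proof.
move=> Et S.
have : jcurves xi = jcurves eta.
  rewrite !jreprP -Et; apply/seteqP; split=> h [hh Sh]; split=> //.
    exact: same_jet_trans (same_jet_sym S) Sh.
  exact: same_jet_trans S Sh.
case: xi eta Et {S} => [t C hC] [t' C' hC'] /= Et EC.
by case: _ / Et hC'; case: _ / EC => hC'; rewrite (Prop_irrelevance hC hC').
Qed.

Lemma coordE c (xi : jet A 1) :
  coord (M1 A) c xi = txv (jtime xi) (jcoord c 0 xi) (jcoord c 1 xi).
Proof. by rewrite txv.unlock. Qed.

(** A 1-jet is determined by its coordinates in one chart, since velocities
    in the other charts are the images of that velocity by the differentials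
    of the transition maps. *)
Lemma M1_inj c : set_inj (dom (M1 A) c) (coord (M1 A) c).
Proof.
move=> xi eta /set_mem cxi /set_mem ceta; rewrite !coordE => E.
have Et : jtime xi = jtime eta.
  have := congr1 (@tcoord R n) E.
  rewrite tcoord_txv.
  rewrite tcoord_txv.
  exact.
have Ex : jcoord c 0 xi = jcoord c 0 eta.
  have := congr1 (@xcoord R n) E.
  rewrite xcoord_txv.
  rewrite xcoord_txv.
  exact.
have Ev : jcoord c 1 xi = jcoord c 1 eta.
  have := congr1 (@vcoord R n) E.
  rewrite vcoord_txv.
  rewrite vcoord_txv.
  exact.
have Eg : jtarget xi = jtarget eta.
  by apply: (ra_inj hA (c := c)); [exact/mem_set|exact/mem_set|exact: Ex].
have Eg' : jrepr xi (jtime xi) = jrepr eta (jtime xi) by rewrite [in RHS]Et; exact: Eg.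
apply: (jet_eq Et); split; first exact: Eg'.
move=> i ixi; have ieta : dom A i (jtarget eta) by rewrite -Eg.
have E1 : jcoord i 1 xi = jcoord i 1 eta.
  by rewrite (jcoord1_change cxi ixi) (jcoord1_change ceta ieta) Eg Ev.
move=> [|[|k]] k1; [exact: (congr1 (coord A i) Eg')| |discriminate k1].
by apply: etrans E1 _; rewrite /jcoord Et.
Qed.

Variable s : sode A.

Lemma sode_time xi : jtime (s xi) = jtime xi.
Proof. by rewrite -[in RHS](sigma_section s xi). Qed.

Lemma sode_target xi : jtarget (s xi) = jtarget xi.
Proof. by rewrite -[in RHS](sigma_section s xi) jtarget_mkjet. Qed.

Lemma sode_coord xi c k : (k <= 1)%N -> dom A c (jtarget xi) ->
  jcoord c k (s xi) = jcoord c k xi.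
Proof.
move=> k1 cx; rewrite -[in RHS](sigma_section s xi) jcoord_mkjet //.
by rewrite -[jrepr _ _]/(jtarget (s xi)) sode_target.
Qed.

Lemma sode_dom e : s @^-1` dom (M2 A) e = dom (M1 A) e.
Proof. by apply/seteqP; split=> xi /=; rewrite sode_target. Qed.

Lemma M1_open c e : open (coord (M1 A) c @` (dom (M1 A) c `&` dom (M1 A) e)).
Proof. by have [] := sigma_smooth s c e; rewrite sode_dom. Qed.

(** The coordinates of M^2 extend those of M^1, and sigma is smooth and
    covers the identity of M^1. A function that is linear in the coordinates
    of sigma, such as a coordinate of M^1 or F^i, is therefore smooth in
    every chart of M^1; this gives in particular the smoothness of the
    transition maps of M^1. *)
Lemma M1_rep_smooth (V : normedModType R) c e (f : jet A 1 -> V)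
   (l : {linear 'rV[R]_(1 + (n + (n + n))) -> V}) :
  (forall xi, dom (M1 A) c xi -> dom (M1 A) e xi -> f xi = l (coord (M2 A) e (s xi))) ->
  smooth_on (coord (M1 A) c @` (dom (M1 A) c `&` dom (M1 A) e)) (rep c f).
Proof.
move=> fl; have [] := sigma_smooth s c e; rewrite sode_dom => oU sU.
apply: (smooth_eq oU _ (smooth_lin l oU sU)) => _ [xi [cxi exi] <-].
have rE (W : normedModType R) (h : jet A 1 -> W) :
    rep c h (coord (M1 A) c xi) = h xi.
  apply: xget_unique; first by exists xi.
  move=> _ [q [cq /= E] <-]; congr h; apply: (M1_inj _ _ E); exact/mem_set.
by rewrite !rE fl.
Qed.

Lemma drop2_linear : linear (fun w : 'rV[R]_(1 + (n + (n + n))) =>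
  row_mx (lsubmx w) (row_mx (lsubmx (rsubmx w)) (lsubmx (rsubmx (rsubmx w))))).
Proof.
by move=> k u v; rewrite !linearP /= !scale_row_mx !add_row_mx.
Qed.
Let drop2 : {linear 'rV[R]_(1 + (n + (n + n))) -> 'rV[R]_(1 + (n + n))} :=
  HB.pack (fun w : 'rV[R]_(1 + (n + (n + n))) =>
  row_mx (lsubmx w) (row_mx (lsubmx (rsubmx w)) (lsubmx (rsubmx (rsubmx w)))))
  (GRing.isLinear.Build _ _ _ _ _ drop2_linear).

Lemma last2_linear : linear (fun w : 'rV[R]_(1 + (n + (n + n))) =>
  rsubmx (rsubmx (rsubmx w))).
Proof. by move=> k u v; rewrite !linearP. Qed.
Let last2 : {linear 'rV[R]_(1 + (n + (n + n))) -> 'rV[R]_n} :=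
  HB.pack (fun w : 'rV[R]_(1 + (n + (n + n))) => rsubmx (rsubmx (rsubmx w)))
  (GRing.isLinear.Build _ _ _ _ _ last2_linear).

Lemma M1_regular : regular_atlas (M1 A).
Proof.
split; [exact: M1_inj|exact: M1_open|move=> c e].
apply: (M1_rep_smooth (l := drop2)) => xi cxi exi /=.
by rewrite !(row_mxKl, row_mxKr) sode_time !sode_coord.
Qed.

Lemma F_smooth c : csmooth c (dom (M1 A) c) (F s c).
Proof.
apply: (M1_rep_smooth (l := last2)) => xi cxi exi /=.
by rewrite !(row_mxKl, row_mxKr).
Qed.

End Jets.

Section Insert.
Variables (R : realType) (n : nat).

Lemma insx_linear : linear (fun b : 'rV[R]_n => txv 0 b 0).
Proof.
move=> k u v; apply: row_ext; rewrite linearP /= ?(tcoord_txv, xcoord_txv, vcoord_txv) //;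
  rewrite ?scaler0 ?addr0; done.
Qed.
Lemma insv_linear : linear (fun e : 'rV[R]_n => txv 0 0 e).
Proof.
move=> k u v; apply: row_ext; rewrite linearP /= ?(tcoord_txv, xcoord_txv, vcoord_txv) //;
  rewrite ?scaler0 ?addr0; done.
Qed.
Definition insx : {linear 'rV[R]_n -> 'rV[R]_(1 + (n + n))} :=
  HB.pack (fun b : 'rV[R]_n => txv 0 b 0) (GRing.isLinear.Build _ _ _ _ _ insx_linear).
Definition insv : {linear 'rV[R]_n -> 'rV[R]_(1 + (n + n))} :=
  HB.pack (fun b : 'rV[R]_n => txv 0 0 b) (GRing.isLinear.Build _ _ _ _ _ insv_linear).

Lemma txv_split a (b e : 'rV[R]_n) : txv a b e = a *: txv 1 0 0 + insx b + insv e.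
Proof.
apply: row_ext; rewrite !linearD linearZ /= ?(tcoord_txv, xcoord_txv, vcoord_txv).
- by rewrite [_ *: _]mulr1 !addr0.
- by rewrite scaler0 add0r addr0.
- by rewrite scaler0 !add0r.
Qed.

Lemma p10_coord_linear : linear (fun w : 'rV[R]_(1 + (n + n)) => row_mx (tcoord w)%:M (xcoord w)).
Proof.
move=> k u v; rewrite scale_row_mx add_row_mx linearP /= linearP /=; congr row_mx.
by apply/rowP => j; rewrite !ord1 !mxE eqxx.
Qed.
(** The projection p^{10} in coordinates, which is linear. *)
Definition p10_coord : {linear 'rV[R]_(1 + (n + n)) -> 'rV[R]_(1 + n)} :=
  HB.pack (fun w : 'rV[R]_(1 + (n + n)) => row_mx (tcoord w)%:M (xcoord w))
    (GRing.isLinear.Build _ _ _ _ _ p10_coord_linear).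

Lemma delta_iv i : delta_mx 0 (iv i) = txv 0 0 (delta_mx 0 i) :> 'rV[R]_(1 + (n + n)).
Proof. by rewrite txv.unlock /iv !delta_mx_rshift raddf0. Qed.

End Insert.
Arguments insx {R n}.
Arguments insv {R n}.
Arguments p10_coord {R n}.

Section Geometry.
Variables (R : realType) (M : topologicalType) (n : nat) (A : atlas R M n).
Hypothesis hM : smooth_manifold A.
Variable s : sode A.
Let B := M1 A.
Let hB : regular_atlas B := M1_regular hM s.
Implicit Types (c e : idx A) (p q : jet A 1).

Lemma csmooth_txv c U (a : jet A 1 -> R) (b e : jet A 1 -> 'rV[R]_n) : mopen B U ->
  csmooth (A := B) c U a -> csmooth (A := B) c U b -> csmooth (A := B) c U e ->
  csmooth (A := B) c U (fun q => txv (a q) (b q) (e q)).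
Proof.
move=> oU sa sb se.
apply: (@csmooth_eq _ _ _ _ hB _ _ oU _ (fun q => a q *: txv 1 0 0 + insx (b q) + insv (e q)
  : 'rV[R]_(1 + (n + n)))).
  by move=> q _ _; rewrite [RHS]txv_split.
apply: (csmoothD hB oU); last exact: (csmooth_lin hB oU).
apply: (csmoothD hB oU); last exact: (csmooth_lin hB oU).
by apply: (csmoothZ hB oU) => //; exact: (csmooth_cst hB).
Qed.

Section Point.
Variables (c : idx A) (p : jet A 1).
Hypothesis cp : dom B c p.

Lemma cdiff_coordB : cdiff (A := B) c (coord B c) p.
Proof. exact: (cdiff_coord2 hB). Qed.

Lemma cderive_coord_lin (V : normedModType R) (l : {linear 'rV[R]_(1 + (n + n)) -> V})
    (f : jet A 1 -> V) w : (forall q, dom B c q -> f q = l (coord B c q)) ->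
  cderive (A := B) c w f p = l w.
Proof.
move=> fl; rewrite (@cderive_eq _ _ _ _ hB _ _ _ _ _ (fun q => l (coord B c q)) p (mopenT hB) I cp).
  by rewrite (cderive_lin hB cp l w cdiff_coordB) (cderive_coord hB cp).
by move=> q cq _; exact: fl.
Qed.

Lemma cderive_t w : cderive (A := B) c w (@jtime _ _ _ _ 1) p = tcoord w.
Proof. by apply: (cderive_coord_lin (l := @tcoord R n)) => q _; rewrite coordE /= tcoord_txv. Qed.
Lemma cderive_v w : cderive (A := B) c w (jcoord c 1) p = vcoord w.
Proof. by apply: (cderive_coord_lin (l := @vcoord R n)) => q _; rewrite coordE /= vcoord_txv. Qed.

End Point.

Lemma csmooth_t c U : mopen B U -> csmooth (A := B) c U (@jtime _ _ _ _ 1).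
Proof.
move=> oU; apply: (@csmooth_eq _ _ _ _ hB _ _ oU _ (fun q => tcoord (coord B c q))).
  by move=> q _ _; rewrite coordE tcoord_txv.
by apply: (csmooth_lin hB oU); exact: (csmooth_coord hB).
Qed.
Lemma csmooth_v c U : mopen B U -> csmooth (A := B) c U (jcoord c 1).
Proof.
move=> oU; apply: (@csmooth_eq _ _ _ _ hB _ _ oU _ (fun q => vcoord (coord B c q))).
  by move=> q _ _; rewrite coordE vcoord_txv.
by apply: (csmooth_lin hB oU); exact: (csmooth_coord hB).
Qed.

Lemma smooth_time U : mopen B U -> smooth_fun B U (@jtime _ _ _ _ 1).
Proof. by move=> oU c; exact: csmooth_t. Qed.

Lemma csmooth_F c U : mopen B U -> csmooth (A := B) c U (F s c).
Proof. by move=> _; apply: csmooth_dom; exact: (F_smooth hM). Qed.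

Lemma dtE c p (v : tvec B) : is_tvec p v -> dom B c p -> dt p v = tcoord (v c).
Proof.
move=> tv cp; rewrite /dt (dfunE hB tv cp) ?cderive_t // => e ep.
exact: (csmooth_cdiff (csmooth_t e (mopenT hB)) ep I).
Qed.

Lemma tmap_p10 c p (v : tvec B) : is_tvec p v -> dom B c p ->
  tmap B (M0 A) (@p10 _ _ _ _) p v c = row_mx (tcoord (v c))%:M (xcoord (v c)).
Proof.
move=> tv cp.
have fl q : dom B c q -> (coord (M0 A) c \o @p10 _ _ _ _) q = p10_coord (coord B c q).
  by move=> _; rewrite coordE /= tcoord_txv xcoord_txv.
have df : cdiff (A := B) c (coord (M0 A) c \o @p10 _ _ _ _) p.
  apply: (csmooth_cdiff _ cp I); apply: (csmooth_eq hB (mopenT hB) (f :=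
    fun q => p10_coord (coord B c q))).
    by move=> q cq _; rewrite fl.
  by apply: (csmooth_lin hB (mopenT hB)); exact: (csmooth_coord hB c (mopenT hB)).
have E e : dom B e p -> 'D_(v e) (rep (A := B) e (coord (M0 A) c \o @p10 _ _ _ _)) (coord B e p)
    = row_mx (tcoord (v c))%:M (xcoord (v c)).
  move=> ep; have := tvec_cderive hB tv ep cp df; rewrite {1}cderive.unlock => ->.
  by rewrite (cderive_coord_lin cp (v c) fl).
by apply: xget_unique => [|_ [e /= ep <-]]; [exists c => //; exact: E|exact: E].
Qed.

(** The charts of R x M cover sets of the form R x U, on which the time is a
    linear function of the coordinates. *)
Lemma dt0_const p (w : tvec (M0 A)) (a : R) : (exists c, dom B c p) ->
  (forall c, dom B c p -> exists b, w c = row_mx a%:M b) -> dt0 p w = a.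
Proof.
move=> [c0 c0p] wE.
have E c : dom B c p -> 'D_(w c) (rep (A := M0 A) c (@fst R M)) (coord (M0 A) c (p10 p)) = a.
  move=> cp; have [b wc] := wE c cp.
  have tl : linear (fun y : 'rV[R]_(1 + n) => lsubmx y 0 0).
    by move=> k u v; rewrite !mxE.
  pose l : {linear 'rV[R]_(1 + n) -> R} := HB.pack (fun y : 'rV[R]_(1 + n) => lsubmx y 0 0)
    (GRing.isLinear.Build _ _ _ _ _ tl).
  have [oc cont inj im] := sm_chart hM c.
  pose O := [set y : 'rV[R]_(1 + n) | (coord A c @` dom A c) (rsubmx y)].
  have oO : open O.
    have : open (coord A c @` dom A c) by apply: im.
    by move: (@continuous_rsubmx R 1 1 n) => /continuousP; apply.
  have Op : O (coord (M0 A) c (p10 p)).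
    by rewrite /O /= row_mxKr; exists (jtarget p).
  have lE y : O y -> rep (A := M0 A) c (@fst R M) y = l y.
    move=> [m cm Em]; apply: xget_unique.
      exists (lsubmx y 0 0, m) => //; split => //=.
      by rewrite -mx11_scalar Em hsubmxK.
    move=> _ [[t m'] [_ /= <-] <-] /=.
    by rewrite row_mxKl mxE eqxx.
  rewrite (derive_eq_on (w c) oO Op lE).
  have cl : continuous l by exact: linear_row_continuous.
  rewrite deriveE; last exact: linear_differentiable.
  by rewrite (diff_lin _ cl) /= wc row_mxKl mxE eqxx.
by apply: xget_unique => [|_ [c /= cp <-]]; [exists c0 => //; exact: E|exact: E].
Qed.

End Geometry.

(** * The splitting of the tangent bundle given by a SODE *)

Section Splitting.
Variables (R : realType) (M : topologicalType) (n : nat) (A : atlas R M n).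
Hypothesis hM : smooth_manifold A.
Variable s : sode A.
Let B := M1 A.
Let hB : regular_atlas B := M1_regular hM s.
Implicit Types (c e : idx A) (p q : jet A 1) (v w : tvec B).

(** Half of the derivative of F along b in the \dot x-directions. It is the
    \dot x-part of the combination of the X^sigma_i with coefficients b
    ([XiSum]). *)
Definition hlift c p (b : 'rV[R]_n) : 'rV[R]_n := 2^-1 *: cderive (A := B) c (txv 0 0 b) (F s c) p.

Lemma cdiff_F c p : dom B c p -> cdiff (A := B) c (F s c) p.
Proof. by move=> cp; apply: (csmooth_cdiff (csmooth_F hM s c (mopenT hB)) cp I). Qed.

Lemma hlift_linear c p k (b b' : 'rV[R]_n) : dom B c p ->
  hlift c p (k *: b + b') = k *: hlift c p b + hlift c p b'.
Proof.
move=> cp; rewrite /hlift -[txv 0 0 _]/(insv _) linearP (cderive_dirD _ _ (cdiff_F cp)).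
by rewrite (cderive_dirZ _ _ (cdiff_F cp)) scalerDr !scalerA [2^-1 * _]mulrC.
Qed.

Lemma hlift0 c p : hlift c p 0 = 0.
Proof.
rewrite /hlift -[txv 0 0 _]/(insv _) linear0.
by rewrite cderive_dir0 scaler0.
Qed.

Lemma hlift_sum c p (b : 'rV[R]_n) : dom B c p ->
  hlift c p b = \sum_(i < n) b 0 i *: hlift c p (delta_mx 0 i).
Proof.
move=> cp; rewrite {1}[b]row_sum_delta.
elim: (index_enum _) => [|i r IH]; first by rewrite !big_nil hlift0.
by rewrite !big_cons hlift_linear // IH.
Qed.

Lemma hlift_smooth c U (b : jet A 1 -> 'rV[R]_n) : mopen B U -> csmooth (A := B) c U b ->
  csmooth (A := B) c U (fun q => hlift c q (b q)).
Proof.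
move=> oU sb; apply: (csmoothZ hB oU); first exact: (csmooth_cst hB).
apply: (csmooth_cderive hB oU); last exact: (csmooth_F hM).
by apply: (csmooth_txv hM s oU) => //; exact: (csmooth_cst hB).
Qed.

Lemma XsE c p : Xs s p c = txv 1 (jcoord c 1 p) (F s c p).
Proof. by rewrite txv.unlock. Qed.

Lemma XiE c p i : dom B c p -> Xi s c i p c = txv 0 (delta_mx 0 i) (hlift c p (delta_mx 0 i)).
Proof.
move=> cp; rewrite /Xi (tv_self hB _ cp) txv.unlock raddf0; congr (row_mx _ (row_mx _ _)).
by apply/rowP => j; rewrite !mxE /dF /hlift /partial -delta_iv cderive.unlock.
Qed.

Lemma DvE c p i : dom B c p -> Dv c i p c = txv 0 0 (delta_mx 0 i).
Proof. by move=> cp; rewrite /Dv (tv_self hB _ cp) delta_iv. Qed.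

Lemma JE c p v : is_tvec p v -> dom B c p ->
  Jtensor p v c = txv 0 0 (xcoord (v c) - tcoord (v c) *: jcoord c 1 p).
Proof.
move=> tv cp; rewrite /Jtensor /epsilon /omega (dtE hM s tv cp) txv.unlock raddf0.
by rewrite xcoord.unlock.
Qed.

Lemma XiSum c p (b : 'rV[R]_n) : dom B c p ->
  \sum_(i < n) b 0 i *: Xi s c i p c = txv 0 b (hlift c p b).
Proof.
move=> cp; rewrite (eq_bigr (fun i => b 0 i *:
   txv 0 (delta_mx 0 i) (hlift c p (delta_mx 0 i)))); last by move=> i _; rewrite XiE.
apply: row_ext; rewrite linear_sum /= ?(tcoord_txv, xcoord_txv, vcoord_txv).
- by rewrite big1 // => i _; rewrite linearZ /= tcoord_txv; apply: mulr0.
- by rewrite [RHS]row_sum_delta; apply: eq_bigr => i _; rewrite linearZ /= xcoord_txv.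
- by rewrite hlift_sum //; apply: eq_bigr => i _; rewrite linearZ /= vcoord_txv.
Qed.

Lemma HsE c p (w : tvec (M0 A)) a b : dom B c p -> dt0 p w = a -> w c = row_mx a%:M b ->
  Hs s p w c = txv a b (a *: F s c p + hlift c p (b - a *: jcoord c 1 p)).
Proof.
move=> cp wa wc; rewrite /Hs /omega0 wa wc row_mxKr XiSum // XsE.
apply: row_ext; rewrite linearP /= ?(tcoord_txv, xcoord_txv, vcoord_txv) //.
- by rewrite [_ *: _]mulr1 addr0.
- by rewrite addrC subrK.
Qed.

Lemma hpartE c p v : is_tvec p v -> dom B c p ->
  hpart s p v c = txv (tcoord (v c)) (xcoord (v c)) (tcoord (v c) *: F s c p +
    hlift c p (xcoord (v c) - tcoord (v c) *: jcoord c 1 p)).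
Proof.
move=> tv cp; rewrite /hpart; apply: HsE => //; last exact: (tmap_p10 hM s tv cp).
apply: (dt0_const hM); first by exists c.
move=> e ep; exists (xcoord (v e)); rewrite (tmap_p10 hM s tv ep).
by rewrite -(dtE hM s tv ep) -(dtE hM s tv cp).
Qed.

Lemma vpartE c p v : is_tvec p v -> dom B c p ->
  vpart s p v c = txv 0 0 (vcoord (v c) - (tcoord (v c) *: F s c p +
    hlift c p (xcoord (v c) - tcoord (v c) *: jcoord c 1 p))).
Proof.
move=> tv cp; rewrite /vpart [LHS]/(v c - hpart s p v c) hpartE //.
by apply: row_ext; rewrite linearB /= ?(tcoord_txv, xcoord_txv, vcoord_txv) ?subrr.
Qed.

Lemma HepsE c p v : dom B c p -> Heps s p v c = txv 0 (vcoord (v c)) (hlift c p (vcoord (v c))).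
Proof.
move=> cp; rewrite /Heps (@HsE c p _ 0 (vcoord (v c)) cp).
- by rewrite scale0r add0r scale0r subr0.
- apply: (dt0_const hM); first by exists c.
  by move=> e ep; exists (epsilon_inv v e); rewrite /TM_incl raddf0.
- by rewrite /TM_incl /epsilon_inv raddf0 vcoord.unlock.
Qed.

Lemma verticalE c p v : is_tvec p v -> vertical p v -> dom B c p ->
  tcoord (v c) = 0 /\ xcoord (v c) = 0.
Proof.
move=> tv vp cp; have := vp c cp; rewrite (tmap_p10 hM s tv cp) -[RHS]/(0 : 'rV[R]_(1+n)).
rewrite -row_mx0 => /eq_row_mx [/matrixP/(_ 0 0) + ->]; by rewrite !mxE eqxx.
Qed.

Lemma verticalI p v : is_tvec p v -> (forall c, dom B c p -> tcoord (v c) = 0 /\ xcoord (v c)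
  = 0) ->
  vertical p v.
Proof.
move=> tv H c cp; have [t0 x0] := H c cp; rewrite (tmap_p10 hM s tv cp) t0 x0.
by rewrite raddf0 row_mx0.
Qed.

(** Let g be a curve in M with 2-jet sigma(p). In every chart, the curve u
    |-> (1-jet of g at u) in M^1 has velocity X^sigma at p, so that the
    transformation rule of X^sigma is the chain rule along that curve. *)
Lemma Xs_tvec p : is_tvec p (Xs s p).
Proof.
move=> c cp e ep; rewrite tv_cderiveE cderive.unlock.
set g := jrepr (s p); have hg : smooth_curve A g := jrepr_smooth (s p).
set t := jtime (s p).
have gt : g t = jtarget p by rewrite -(sode_target s p).
(* The lift of g to M^1, in the chart i. *)
pose curve i (u : R) := txv u (coord A i (g u)) (derive1n 1 (coord A i \o g) u).
have curveE i u (iu : dom A i (g u)) : curve i u = coord B i (mkjet 1 u hg).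
  by rewrite coordE /curve !jcoord_mkjet.
have curvet i : dom B i p -> curve i t = coord B i p.
  move=> ip; rewrite coordE /curve /t.
  have E1 := sode_coord s (k := 1) isT ip; have E0 := sode_coord s (k := 0) isT ip.
  by rewrite -E1 -E0 -(sode_time s p).
have dcurve i : dom B i p -> differentiable (curve i) t /\ 'D_1 (curve i) t = Xs s p i.
  move=> ip; have it' : dom A i (g t) by rewrite gt.
  have d0 : differentiable (coord A i \o g) t by apply: smooth_diff (hg.2 i) _.
  have d1 : differentiable (derive1n 1 (coord A i \o g)) t.
    have -> : derive1n 1 (coord A i \o g) = 'D_1 (coord A i \o g).
      by apply/funext => u; rewrite derive1n1 derive1E.
    exact: (smooth_diff (smooth_derive (1 : R) (hg.2 i)) it').
  have did : differentiable (id : R -> R) t by [].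
  have dc := differentiable_cst (txv 1 0 0 : 'rV[R]_(1 + (n + n))) t.
  have dt1 := differentiable_scale did dc.
  have H1 : 'D_1 (coord A i \o g) t = jcoord i 1 p.
    by rewrite -(sode_coord s (k := 1) isT ip) /jcoord derive1n1 derive1E.
  have H2 : 'D_1 (derive1n 1 (coord A i \o g)) t = F s i p.
    by rewrite -[RHS]/(derive1 (derive1n 1 (coord A i \o g)) t) derive1E.
  have [dx] := derive_linl (1 : R) (@linear_row_continuous _ _ _ (@insx R n)) d0.
  rewrite H1 => Dx.
  have [dv] := derive_linl (1 : R) (@linear_row_continuous _ _ _ (@insv R n)) d1.
  rewrite H2 => Dv.
  have gE : curve i = ((fun u => id u *: cst (txv 1 0 0) u) + (insx \o (coord A i \o g)) +
     (insv \o derive1n 1 (coord A i \o g)) : R -> 'rV[R]_(1 + (n + n))).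
    by apply/funext => u; rewrite /curve txv_split.
  have dd := differentiableD dt1 dx.
  split; first by rewrite gE; exact: (differentiableD dd dv).
  rewrite gE (deriveD (diff_derivable dd) (diff_derivable dv)).
  rewrite (deriveD (diff_derivable dt1) (diff_derivable dx)) Dx Dv.
  rewrite (derive_scale _ did dc) derive_cst scaler0 add0r derive_id XsE.
  by rewrite [RHS]txv_split.
have [dc Dc] := dcurve c cp; have [de De] := dcurve e ep.
have dT : differentiable (rep (A := B) c (coord B e)) (curve c t).
  by rewrite curvet //; exact: (cdiff_coord2 hB cp ep).
have E := derive_comp (1 : R) dc dT.
rewrite Dc (curvet c cp) in E.
apply: etrans (esym De) (etrans _ E).
have ct : dom A c (g t) by rewrite gt.
have et : dom A e (g t) by rewrite gt.
have oU := openI (@curve_open _ _ _ _ hM g c hg) (@curve_open _ _ _ _ hM g e hg).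
have EE u : ([set u | dom A c (g u)] `&` [set u | dom A e (g u)]) u ->
    curve e u = (rep (A := B) c (coord B e) \o curve c) u.
  move=> [/= cu eu]; rewrite (curveE e u eu) (curveE c u cu) (repE hB) //=.
  by rewrite jtarget_mkjet.
exact: (derive_eq_on (1 : R) oU (conj ct et) EE).
Qed.

End Splitting.

Section Endomorphisms.
Variables (R : realType) (M : topologicalType) (n : nat) (A : atlas R M n).
Hypothesis hM : smooth_manifold A.
Variable s : sode A.
Let B := M1 A.
Let hB : regular_atlas B := M1_regular hM s.
Let hA : regular_atlas A := manifold_regular hM.
Implicit Types (c e : idx A) (p q : jet A 1) (v : tvec B).

(** The x-part of the coordinates of a jet is the coordinate of its target. *)
Lemma cderive_pull (V : normedModType R) c p (h : M -> V) w : dom B c p ->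
  cdiff (A := A) c h (jtarget p) ->
  cderive (A := B) c w (h \o @jtarget _ _ _ _ 1) p = cderive (A := A) c (xcoord w) h (jtarget p) /\
  cdiff (A := B) c (h \o @jtarget _ _ _ _ 1) p.
Proof.
move=> cp dh.
have xc q : xcoord (coord B c q) = coord A c (jtarget q) by rewrite coordE xcoord_txv.
have cl : continuous (@xcoord R n) by exact: linear_row_continuous.
have dx : differentiable (@xcoord R n) (coord B c p) by exact: linear_differentiable.
have E q : dom B c q -> (rep (A := A) c h \o @xcoord R n) (coord B c q)
  = (h \o @jtarget _ _ _ _ 1) q.
  by move=> cq; rewrite /= xc (repE hA).
have dh' : differentiable (rep (A := A) c h) (xcoord (coord B c p)) by rewrite xc.
split; last exact: (cdiff_rep hB cp E (differentiable_comp dx dh')).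
have Dx : 'D_w (@xcoord R n) (coord B c p) = xcoord w by rewrite deriveE // (diff_lin _ cl).
rewrite (cderive_rep hB cp _ E) (derive_comp _ dx dh') Dx xc.
by rewrite cderive.unlock.
Qed.

(** The x-part of a tangent vector of M^1 is transformed by the differential
    of a transition map of M, and so is the \dot x-part of a vertical vector.
    Hence J, which moves the one to the place of the other, is the same in
    all charts. *)
Lemma J_tvec p v : is_tvec p v -> is_tvec p (Jtensor p v).
Proof.
move=> tv c cp e ep; rewrite tv_cderiveE (JE hM s tv ep) (JE hM s tv cp).
set m := jtarget p.
have dphi : cdiff (A := A) c (coord A e) m by exact: (cdiff_coord2 hA).
have dB := cdiff_coord2 hB cp ep.
have Ex w : xcoord (cderive (A := B) c w (coord B e) p) = cderive (A :=
  A) c (xcoord w) (coord A e) m.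
  rewrite -(cderive_pull w cp dphi).1 -(cderive_lin hB cp (@xcoord R n) w dB).
  apply: (cderive_eq hB _ (mopenT hB) I cp) => q _ _; by rewrite coordE /= xcoord_txv.
have Et w : tcoord (cderive (A := B) c w (coord B e) p) = tcoord w.
  rewrite -(cderive_lin hB cp (@tcoord R n) w dB) -(cderive_t hM s cp).
  apply: (cderive_eq hB _ (mopenT hB) I cp) => q _ _; by rewrite coordE /= tcoord_txv.
have Ev b : vcoord (cderive (A := B) c (txv 0 0 b) (coord B e) p) = cderive (A :=
  A) c b (coord A e) m.
  rewrite -(cderive_lin hB cp (@vcoord R n) _ dB).
  (* The velocity in the chart e is the derivative of the coordinates of e
     along the velocity in c: a linear combination of the functions h a on M,
     with the velocities in c as coefficients. *)
  pose h a : M -> 'rV[R]_n := cderive (A := A) c (delta_mx 0 a) (coord A e).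
  have sh a : csmooth (A := A) c (dom A e) (h a).
    exact: (csmooth_cderive hA (mopen_dom hA (c := e)) (csmooth_cst hA c (mopen_dom hA (c := e)) _)
      (csmooth_coord2 hA c e)).
  have dh a : cdiff (A := A) c (h a) m by exact: (csmooth_cdiff (sh a) cp ep).
  have sv a : csmooth (A := B) c setT (fun q => entry a (jcoord c 1 q)).
    exact: (csmooth_lin hB (mopenT hB) (entry a) (csmooth_v hM s c (mopenT hB))).
  have dv a : cdiff (A := B) c (fun q => entry a (jcoord c 1 q)) p by exact: csmooth_cdiff (sv a)
    cp I.
  have dhB a := (cderive_pull 0 cp (dh a)).2.
  have dva a : cdiff (A := B) c (fun q => entry a (jcoord c 1 q) *: (h a \o @jtarget _ _ _ _ 1)
    q) p.
    apply: (cdiff_rep hB cp (F := fun y => rep (A := B) c (fun q => entry a (jcoord c 1 q)) y *: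
       rep (A := B) c (h a \o @jtarget _ _ _ _ 1) y)).
      by move=> q cq; rewrite !(repE hB).
    exact: (differentiable_scale (dv a) (dhB a)).
  rewrite (@cderive_eq _ _ _ _ hB _ _ _ _ _
    (fun q => \sum_(a < n) entry a (jcoord c 1 q) *: (h a \o @jtarget _ _ _ _ 1) q) p
    (mopen_dom hB (c := e)) ep cp); last first.
    move=> q cq eq; rewrite coordE /= vcoord_txv (jcoord1_change hM cq eq) tv_cderiveE.
    exact: (cderive_dirE _ (cdiff_coord2 hA cq eq)).
  rewrite (cderive_sum hB cp _ _ dva).1 (cderive_dirE _ dphi); apply: eq_bigr => a _.
  rewrite (cderiveZ hB cp _ (dv a) (dhB a)) (cderive_pull _ cp (dh a)).1 xcoord_txv cderive_dir0
    scaler0 add0r.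
  congr (_ *: _).
  have dj : cdiff (A := B) c (jcoord c 1) p by exact: csmooth_cdiff (csmooth_v hM s c (mopenT
    hB)) cp I.
  by rewrite (cderive_lin hB cp (entry a) _ dj) (cderive_v hM s cp) vcoord_txv.
have E1 := tv c cp e ep; rewrite tv_cderiveE in E1.
apply: row_ext; [by rewrite Et; rowE|by rewrite Ex; rowE; rewrite cderive_dir0|].
rewrite Ev vcoord_txv E1 Ex Et (cderive_dirB _ _ dphi) (cderive_dirZ _ _ dphi).
by rewrite (jcoord1_change hM cp ep) tv_cderiveE.
Qed.

(** The row of the omega^i. *)
Definition contact c q (w : 'rV[R]_(1 + (n + n))) := xcoord w - tcoord w *: jcoord c 1 q.
(** The \dot x-part of the vertical component. *)
Definition vcoef c q (w : 'rV[R]_(1 + (n + n))) :=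
  vcoord w - (tcoord w *: F s c q + hlift s c q (contact c q w)).

Lemma contact_linear c q k (u w : 'rV[R]_(1 + (n + n))) :
  contact c q (k *: u + w) = k *: contact c q u + contact c q w.
Proof.
rewrite /contact; rowE; move: (xcoord u) (xcoord w) (tcoord u) (tcoord w) => a1 a2 a3 a4.
by apply/rowP => j; rewrite !mxE; ring.
Qed.

Lemma vcoef_linear c q k (u w : 'rV[R]_(1 + (n + n))) : dom B c q ->
  vcoef c q (k *: u + w) = k *: vcoef c q u + vcoef c q w.
Proof.
move=> cq; rewrite /vcoef contact_linear (hlift_linear hM s _ _ _ cq); rowE.
move: (vcoord u) (vcoord w) (tcoord u) (tcoord w) (hlift _ _ _ _) (hlift _ _ _ _)
  => a1 a2 a3 a4 a5 a6.
by apply/rowP => j; rewrite !mxE; ring.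
Qed.

Lemma contact_smooth c U (w : jet A 1 -> 'rV[R]_(1 + (n + n))) : mopen B U ->
  csmooth (A := B) c U w -> csmooth (A := B) c U (fun q => contact c q (w q)).
Proof.
move=> oU sw.
apply: (@csmooth_eq _ _ _ _ hB c _ oU _
   (fun q => xcoord (w q) + (- 1) *: (tcoord (w q) *: jcoord c 1 q)) _ _).
  by move=> q _ _; rewrite scaleN1r.
apply: (csmoothD hB oU); first exact: (csmooth_lin hB oU (@xcoord R n) sw).
apply: (csmoothZ hB oU (csmooth_cst hB _ oU _)).
exact: (csmoothZ hB oU (csmooth_lin hB oU (@tcoord R n) sw) (csmooth_v hM s c oU)).
Qed.

Lemma hpart_vcoord_smooth c U (w : jet A 1 -> 'rV[R]_(1 + (n + n))) : mopen B U ->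
  csmooth (A := B) c U w ->
  csmooth (A := B) c U (fun q => tcoord (w q) *: F s c q + hlift s c q (contact c q (w q))).
Proof.
move=> oU sw; apply: (csmoothD hB oU); last exact: (hlift_smooth hM s oU (contact_smooth oU sw)).
exact: (csmoothZ hB oU (csmooth_lin hB oU (@tcoord R n) sw) (csmooth_F hM s c oU)).
Qed.

Lemma vcoef_smooth c U (w : jet A 1 -> 'rV[R]_(1 + (n + n))) : mopen B U ->
  csmooth (A := B) c U w -> csmooth (A := B) c U (fun q => vcoef c q (w q)).
Proof.
move=> oU sw.
apply: (@csmooth_eq _ _ _ _ hB c _ oU _ (fun q => vcoord (w q) + (- 1) *:
   (tcoord (w q) *: F s c q + hlift s c q (contact c q (w q)))) _ _).
  by move=> q _ _; rewrite scaleN1r.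
apply: (csmoothD hB oU); first exact: (csmooth_lin hB oU (@vcoord R n) sw).
exact: (csmoothZ hB oU (csmooth_cst hB _ oU _) (hpart_vcoord_smooth oU sw)).
Qed.

Lemma J_endo : endo (A := B) (@Jtensor _ _ _ A).
Proof.
split=> [p v|c]; first exact: J_tvec.
exists (fun q w => txv 0 0 (contact c q w)); split=> [q v cq tv|q k u w _|U w oU sw].
- exact: (JE hM s tv cq).
- by rewrite contact_linear -[txv 0 0 _]/(insv _) linearP.
- by apply: (csmooth_txv hM s oU); [exact: (csmooth_cst hB)|exact: (csmooth_cst hB)|exact:
  contact_smooth].
Qed.

Lemma Xs_vf U : mopen B U -> smooth_vfield U (Xs s).
Proof.
move=> oU; split=> [p _|c]; first exact: Xs_tvec.
apply: (@csmooth_eq _ _ _ _ hB c _ oU _ (fun q => txv 1 (jcoord c 1 q) (F s c q))).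
  by move=> q _ _; rewrite XsE.
by apply: (csmooth_txv hM s oU); [exact: (csmooth_cst hB)|exact: (csmooth_v hM)|exact: (csmooth_F
  hM)].
Qed.

Lemma cderive_txv c U p (f : jet A 1 -> 'rV[R]_(1 + (n + n))) (a : jet A 1 -> R)
    (b e : jet A 1 -> 'rV[R]_n) w : mopen B U -> U p -> dom B c p ->
  (forall q, dom B c q -> U q -> f q = txv (a q) (b q) (e q)) ->
  cdiff (A := B) c f p ->
  cderive (A := B) c w f p = txv (cderive (A := B) c w a p) (cderive (A :=
    B) c w b p) (cderive (A := B) c w e p).
Proof.
move=> oU Up cp fE df; apply: row_ext; rowE.
- rewrite -(cderive_lin hB cp (@tcoord R n) w df); apply: (cderive_eq hB _ oU Up cp) => q cq Uq /=.
  by rewrite fE // tcoord_txv.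
- rewrite -(cderive_lin hB cp (@xcoord R n) w df); apply: (cderive_eq hB _ oU Up cp) => q cq Uq /=.
  by rewrite fE // xcoord_txv.
- rewrite -(cderive_lin hB cp (@vcoord R n) w df); apply: (cderive_eq hB _ oU Up cp) => q cq Uq /=.
  by rewrite fE // vcoord_txv.
Qed.

Lemma cderive_Xs c p w : dom B c p ->
  cderive (A := B) c w (fun q => Xs s q c) p = txv 0 (vcoord w) (cderive (A := B) c w (F s c) p).
Proof.
move=> cp; rewrite (cderive_txv (U := setT) (a := fun=> 1) (b := jcoord c 1) (e := F s c)) //.
- by rewrite (cderive_cst hB cp) (cderive_v hM s cp).
- exact: mopenT.
- by move=> q _ _; rewrite XsE.
- exact: (csmooth_cdiff (vf_csmooth (A := B) c (Xs_vf (mopenT hB))) cp I).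
Qed.

(** Among the vectors with dt = 0, L_{X^sigma}J is -1 on the horizontal ones
    and 1 on the vertical ones. *)
Lemma lieJ U p c (V : vfield B) : mopen B U -> U p -> dom B c p -> smooth_vfield U V ->
  lie_endo (Xs s) (@Jtensor _ _ _ A) V p c =
  txv 0 (- contact c p (V p c)) (vcoord (V p c) - tcoord (V p c)
    *: F s c p - 2 *: hlift s c p (contact c p (V p c))).
Proof.
move=> oU Up cp sV; rewrite lie_endoE.
have tV := vf_tvec sV Up.
have sX := Xs_vf oU.
have tb := lbracket_tvec hB oU Up sX sV.
rewrite (JE hM s tb cp) !lbracketE (JE hM s tV cp) -/(contact c p (V p c)).
have sJ := endo_vf hB J_endo oU sV.
have dJ := csmooth_cdiff (vf_csmooth (A := B) c sJ) cp Up.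
have dV := csmooth_cdiff (vf_csmooth (A := B) c sV) cp Up.
have JVE q : dom B c q -> U q -> Jtensor q (V q) c =
    txv 0 0 (xcoord (V q c) + (- 1) *: (tcoord (V q c) *: jcoord c 1 q)).
  by move=> cq Uq; rewrite (JE hM s (vf_tvec sV Uq) cq) scaleN1r.
have EJ := cderive_txv (f := fun q => Jtensor q (V q) c) (a := fun=> 0) (b := fun=> 0)
  (e := fun q => xcoord (V q c) + (- 1) *: (tcoord (V q c) *: jcoord c 1 q)) _ oU Up cp JVE dJ.
rewrite !(cderive_Xs _ cp) EJ {EJ}.
have sx := csmooth_lin hB oU (@xcoord R n) (vf_csmooth (A := B) c sV).
have st := csmooth_lin hB oU (@tcoord R n) (vf_csmooth (A := B) c sV).
have sv := csmooth_v hM s c oU.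
have sm1 := csmooth_cst hB c oU (-1 : R).
have stv := csmoothZ hB oU st sv.
have dx := csmooth_cdiff sx cp Up; have dt := csmooth_cdiff st cp Up;
  have dv := csmooth_cdiff sv cp Up.
have dtv := csmooth_cdiff stv cp Up; have dm1 := csmooth_cdiff sm1 cp Up.
have dmtv := csmooth_cdiff (csmoothZ hB oU sm1 stv) cp Up.
rewrite !(cderive_cst hB cp) (cderiveD hB cp _ dx dmtv) (cderiveZ hB cp _ dm1 dtv)
  (cderive_cst hB cp) scale0r.
rewrite (cderiveZ hB cp _ dt dv) (cderive_v hM s cp) (cderive_lin hB cp (@xcoord R n) _ dV).
rewrite (cderive_lin hB cp (@tcoord R n) _ dV) /=.
rewrite XsE; rowE.
have -> : 2 *: hlift s c p (contact c p (V p c)) = cderive (A :=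
  B) c (txv 0 0 (contact c p (V p c))) (F s c) p.
  by rewrite /hlift scalerA divff ?scale1r // pnatr_eq0.
move: (cderive _ _ (F s c) _) (cderive _ _ _ _) => a1 a2.
apply: row_ext; rowE.
- by rewrite !subr0.
- by rewrite sub0r subr0.
- by apply/rowP => j; rewrite !mxE; ring.
Qed.

(** The horizontal projection is 1/2 (id + dt (x) X^sigma - L_{X^sigma}J), in
    which every term is already known to be a tensor. This is how the
    horizontal distribution, defined by the local fields X^sigma_i, is seen
    to be independent of the chart. *)
Lemma hpart_tvec p v : is_tvec p v -> is_tvec p (hpart s p v).
Proof.
move=> tv.
have [[c cp]|no] := pselect (exists c, dom B c p); last by move=> c cp; case: no; exists c.
pose V : vfield B := fun q => Defs.tv B c q (v c).
have oc : mopen B (dom B c) := mopen_dom hB (c := c).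
have sV : smooth_vfield (dom B c) V by apply: (vf_tv hB oc) => //; exact: (csmooth_cst hB).
have VE e : dom B e p -> V p e = v e by move=> ep; rewrite [RHS](tv c cp e ep).
pose L := lie_endo (Xs s) (@Jtensor _ _ _ A) V p.
have tL : is_tvec p L.
  exact: (vf_tvec (lie_vf hB oc J_endo (Xs_vf oc) sV) cp).
have t1 := is_tvecZ hB (dt p v) (@Xs_tvec _ _ _ _ hM s p).
have t2 := is_tvecB hB (is_tvecD hB tv t1) tL.
apply: is_tvec_eq (is_tvecZ hB 2^-1 t2).
move=> e ep; rewrite (hpartE hM s tv ep) -/(contact e p (v e)).
rewrite -[LHS]/(2^-1 *: ((v e + dt p v *: Xs s p e) - L e)).
rewrite (dtE hM s tv ep) XsE /L (lieJ oc cp ep sV) (VE e ep).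
apply: row_ext; rowE.
- by lra.
- rewrite /contact; move: (xcoord (v e)) (tcoord (v e)) => a1 a2.
  by apply/rowP => j; rewrite !mxE; lra.
- move: (hlift _ _ _ _) (vcoord (v e)) (tcoord (v e)) => a1 a2 a3.
  by apply/rowP => j; rewrite !mxE; lra.
Qed.

Lemma vpart_tvec p v : is_tvec p v -> is_tvec p (vpart s p v).
Proof. by move=> tv; apply: (is_tvecB hB) => //; exact: hpart_tvec. Qed.

(** The endomorphism H^sigma o epsilon^{-1} o v of the whole tangent bundle,
    where v is the vertical projection. *)
Definition vert_to_hor p v := Heps s p (vpart s p v).

Lemma vpart_coef c p v : is_tvec p v -> dom B c p -> vpart s p v c = txv 0 0 (vcoef c p (v c)).
Proof. exact: vpartE. Qed.

Lemma vert_to_horE c p v : is_tvec p v -> dom B c p ->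
  vert_to_hor p v c = txv 0 (vcoef c p (v c)) (hlift s c p (vcoef c p (v c))).
Proof. by move=> tv cp; rewrite /vert_to_hor (HepsE hM) // (vpart_coef tv cp) vcoord_txv. Qed.

(** If J w is the vertical part of v, then the image of v is the horizontal
    part of w minus dt(w) X^sigma; and such a w exists. *)
Lemma vert_to_hor_tvec p v : is_tvec p v -> is_tvec p (vert_to_hor p v).
Proof.
move=> tv.
have [[c cp]|no] := pselect (exists c, dom B c p); last by move=> c cp; case: no; exists c.
pose w := Defs.tv B c p (txv 0 (vcoef c p (v c)) 0).
have tw : is_tvec p w by exact: (tv_is_tvec hB).
have wc : w c = txv 0 (vcoef c p (v c)) 0 by exact: (tv_self hB).
have JW : veq p (Jtensor p w) (vpart s p v).
  apply: (tvec_eq (J_tvec tw) (vpart_tvec tv) cp).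
  by rewrite (JE hM s tw cp) (vpart_coef tv cp) wc tcoord_txv xcoord_txv scale0r subr0.
have t1 := is_tvecZ hB (dt p w) (@Xs_tvec _ _ _ _ hM s p).
apply: is_tvec_eq (is_tvecB hB (hpart_tvec tw) t1).
move=> e ep; have := JW e ep; rewrite (JE hM s tw ep) (vpart_coef tv ep).
move=> /(congr1 (@vcoord R n)); rewrite !vcoord_txv -/(contact e p (w e)) => bE.
rewrite -[LHS]/(hpart s p w e - dt p w *: Xs s p e) (hpartE hM s tw ep) (vert_to_horE tv ep).
rewrite (dtE hM s tw ep) XsE -/(contact e p (w e)) bE -bE.
apply: row_ext; rowE.
- by rewrite mulr1 subrr.
- by [].
- by rewrite addrC addKr.
Qed.

Lemma hpart_endo : endo (A := B) (hpart s).
Proof.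
split=> [p v|c]; first exact: hpart_tvec.
exists (fun q w => txv (tcoord w) (xcoord w) (tcoord w *: F s c q + hlift s c q (contact c q w))).
split=> [q v cq tv|q k u w cq|U w oU sw].
- exact: (hpartE hM s tv cq).
- rewrite contact_linear (hlift_linear hM s _ _ _ cq).
  apply: row_ext; rowE => //.
  move: (hlift _ _ _ _) (hlift _ _ _ _) (tcoord u) (tcoord w) => a1 a2 a3 a4.
  by apply/rowP => j; rewrite !mxE; ring.
- apply: (csmooth_txv hM s oU); last exact: hpart_vcoord_smooth.
    exact: (csmooth_lin hB oU (@tcoord R n) sw).
  exact: (csmooth_lin hB oU (@xcoord R n) sw).
Qed.

Lemma vpart_endo : endo (A := B) (vpart s).
Proof.
split=> [p v|c]; first exact: vpart_tvec.
exists (fun q w => txv 0 0 (vcoef c q w)).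
split=> [q v cq tv|q k u w cq|U w oU sw].
- exact: vpart_coef.
- by rewrite vcoef_linear // -[txv 0 0 _]/(insv _) linearP.
- by apply: (csmooth_txv hM s oU); [exact: (csmooth_cst hB)|exact: (csmooth_cst hB)|exact:
  vcoef_smooth].
Qed.

Lemma vert_to_hor_endo : endo (A := B) vert_to_hor.
Proof.
split=> [p v|c]; first exact: vert_to_hor_tvec.
exists (fun q w => txv 0 (vcoef c q w) (hlift s c q (vcoef c q w))).
split=> [q v cq tv|q k u w cq|U w oU sw].
- exact: vert_to_horE.
- rewrite vcoef_linear // (hlift_linear hM s _ _ _ cq).
  apply: row_ext; rowE => //.
  by rewrite mulr0 addr0.
- apply: (csmooth_txv hM s oU); first exact: (csmooth_cst hB).
    exact: vcoef_smooth.
  exact: (hlift_smooth hM s oU (vcoef_smooth oU sw)).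
Qed.

End Endomorphisms.

(** * A connection built from brackets and projectors *)

(** Brackets of two images under endomorphisms. Multiplying X or Y by a
    function f creates only one differential term, a multiple of L (b X) or
    of L (a Y). *)
HB.lock Definition twisted (R : realType) (T : Type) (d : nat) (A : atlas R T d)
    (L a b : T -> tvec A -> tvec A) (Y X : vfield A) : vfield A := fun q =>
  L q (lbracket (fun q' => a q' (Y q')) (fun q' => b q' (X q')) q).
Arguments twisted {R T d A} L a b Y X _ _.

(** For P, Q, J the horizontal projection, the vertical projection and the
    fundamental tensor, and for K = H^sigma o epsilon^{-1} o Q, this is the
    covariant derivative along Y of the vertical field E X: the component Q Y
    of Y acts through brackets with the horizontal copy K E X of E X, which J
    brings back to the vertical bundle. *)
HB.lock Definition vconn (R : realType) (T : Type) (d : nat) (A : atlas R T d)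
    (P Q J K E : T -> tvec A -> tvec A) (Y X : vfield A) : vfield A := fun q =>
  twisted Q P E Y X q + twisted J Q (fun q v => K q (E q v)) Y X q.
Arguments vconn {R T d A} P Q J K E Y X _ _.

Ltac gen_atoms := repeat match goal with
  | |- context [@dfun ?R ?T ?d ?A ?f ?p ?v] => generalize (@dfun R T d A f p v); intro
  | |- context [@vconn ?R ?T ?d ?A ?P ?Q ?J ?K ?E ?Y ?X ?p] =>
      generalize (@vconn R T d A P Q J K E Y X p); intro
  end.

Section Twisted.
Variables (R : realType) (T : Type) (d : nat) (A : atlas R T d).
Hypothesis hA : regular_atlas A.
Implicit Types (c e : idx A) (p q : T) (U : set T) (X Y Z : vfield A).

Section Dfun.
Variables (U : set T) (p : T) (c : idx A).
Hypotheses (oU : mopen A U) (Up : U p) (cp : dom A c p).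

Lemma dfun_cderive f (v : tvec A) : smooth_fun A U f -> is_tvec p v ->
  dfun f p v = cderive c (v c) f p.
Proof.
move=> sf tv; apply: (dfunE hA tv cp) => e ep; exact: (csmooth_cdiff (sf e) ep Up).
Qed.

Lemma dfunDv f (v w : tvec A) : smooth_fun A U f -> is_tvec p v -> is_tvec p w ->
  dfun f p (v + w) = dfun f p v + dfun f p w.
Proof.
move=> sf tv tw; have df := csmooth_cdiff (sf c) cp Up.
rewrite (dfun_cderive sf tv) (dfun_cderive sf tw) (dfun_cderive sf (is_tvecD hA tv tw)).
exact: (cderive_dirD _ _ df).
Qed.

Lemma dfunZv f k (v : tvec A) : smooth_fun A U f -> is_tvec p v ->
  dfun f p (k *: v) = k * dfun f p v.
Proof.
move=> sf tv; have df := csmooth_cdiff (sf c) cp Up.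
rewrite (dfun_cderive sf tv) (dfun_cderive sf (is_tvecZ hA k tv)); exact: (cderive_dirZ _ _ df).
Qed.

Lemma dfun_veq f (v w : tvec A) : smooth_fun A U f -> is_tvec p v -> is_tvec p w ->
  v c = w c -> dfun f p v = dfun f p w.
Proof. by move=> sf tv tw E; rewrite (dfun_cderive sf tv) (dfun_cderive sf tw) E. Qed.

Lemma dfun_local f g (v : tvec A) : smooth_fun A U f -> smooth_fun A U g ->
  is_tvec p v -> (forall q, U q -> f q = g q) -> dfun f p v = dfun g p v.
Proof.
move=> sf sg tv fg; rewrite (dfun_cderive sf tv) (dfun_cderive sg tv).
by apply: (cderive_eq hA _ oU Up cp) => q _; exact: fg.
Qed.

Lemma dfunD f g (v : tvec A) : smooth_fun A U f -> smooth_fun A U g -> is_tvec p v ->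
  dfun (fun q => f q + g q) p v = dfun f p v + dfun g p v.
Proof.
move=> sf sg tv; have df := csmooth_cdiff (sf c) cp Up; have dg := csmooth_cdiff (sg c) cp Up.
have sfg : smooth_fun A U (fun q => f q + g q).
  by move=> e; exact: (csmoothD hA oU (sf e) (sg e)).
by rewrite (dfun_cderive sf tv) (dfun_cderive sg tv) (dfun_cderive sfg tv) (cderiveD hA cp _ df dg).
Qed.

Lemma dfunM f g (v : tvec A) : smooth_fun A U f -> smooth_fun A U g -> is_tvec p v ->
  dfun (fun q => f q * g q) p v = f p * dfun g p v + dfun f p v * g p.
Proof.
move=> sf sg tv; have df := csmooth_cdiff (sf c) cp Up; have dg := csmooth_cdiff (sg c) cp Up.
have sfg : smooth_fun A U (fun q => f q * g q).
  by move=> e; exact: (csmoothZ hA oU (sf e) (sg e)).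
rewrite (dfun_cderive sf tv) (dfun_cderive sg tv) (dfun_cderive sfg tv);
  exact: (cderiveZ hA cp _ df dg).
Qed.

End Dfun.

Lemma dfun_smooth U f Y : mopen A U -> smooth_fun A U f -> smooth_vfield U Y ->
  smooth_fun A U (fun q => dfun f q (Y q)).
Proof.
move=> oU sf sY c.
apply: (@csmooth_eq _ _ _ _ hA c _ oU _ (fun q => cderive c (Y q c) f q)).
  by move=> q cq Uq; rewrite (dfun_cderive Uq cq sf (vf_tvec sY Uq)).
exact: (csmooth_cderive hA oU (vf_csmooth c sY) (sf c)).
Qed.

Section twisted.
Variables L a b : T -> tvec A -> tvec A.
Hypotheses (eL : endo L) (ea : endo a) (eb : endo b).

Local Notation twisted := (twisted L a b).

Variable U : set T.
Hypothesis oU : mopen A U.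

Lemma twisted_vf Y X : smooth_vfield U Y -> smooth_vfield U X -> smooth_vfield U (twisted Y X).
Proof.
move=> sY sX; rewrite twisted.unlock; apply: (endo_vf hA eL oU).
exact: (lbracket_vf hA oU (endo_vf hA ea oU sY) (endo_vf hA eb oU sX)).
Qed.

Lemma lbracket_endo_tvec Y X p : U p -> smooth_vfield U Y -> smooth_vfield U X ->
  is_tvec p (lbracket (fun q => a q (Y q)) (fun q => b q (X q)) p).
Proof.
move=> Up sY sX.
exact: (lbracket_tvec hA oU Up (endo_vf hA ea oU sY) (endo_vf hA eb oU sX)).
Qed.

Lemma twisted_local Y Y' X X' p c : smooth_vfield U Y -> smooth_vfield U Y' ->
  smooth_vfield U X -> smooth_vfield U X' ->
  (forall q, U q -> veq q (Y q) (Y' q)) -> (forall q, U q -> veq q (X q) (X' q)) ->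
  U p -> dom A c p -> twisted Y X p c = twisted Y' X' p c.
Proof.
move=> sY sY' sX sX' YY XX Up cp; rewrite twisted.unlock.
apply: (endo_eq eL cp (lbracket_endo_tvec Up sY sX) (lbracket_endo_tvec Up sY' sX')).
have H E (eE : endo E) Z Z' : smooth_vfield U Z -> smooth_vfield U Z' ->
    (forall q, U q -> veq q (Z q) (Z' q)) ->
    forall q, U q -> veq q (E q (Z q)) (E q (Z' q)).
  move=> sZ sZ' ZZ q Uq e eq.
  exact: (endo_eq eE eq (vf_tvec sZ Uq) (vf_tvec sZ' Uq) (ZZ q Uq e eq)).
exact: (lbracket_local hA oU (H a ea _ _ sY sY' YY) (H b eb _ _ sX sX' XX) Up cp).
Qed.

Lemma twisted_addl Y Y' X p c : smooth_vfield U Y -> smooth_vfield U Y' ->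
  smooth_vfield U X -> U p -> dom A c p ->
  twisted (fun q => Y q + Y' q) X p c = twisted Y X p c + twisted Y' X p c.
Proof.
move=> sY sY' sX Up cp; have sYY := vfD hA oU sY sY'.
rewrite -[twisted Y X p c]scale1r.
rewrite twisted.unlock; apply: (endo_comb eL cp (lbracket_endo_tvec Up sY sX)
  (lbracket_endo_tvec Up sYY sX) (lbracket_endo_tvec Up sY' sX)).
have E q : U q -> veq q (a q (Y q + Y' q)) (a q (Y q) + a q (Y' q)).
  by move=> Uq e eq; rewrite (endoD hA ea eq (vf_tvec sY Uq) (vf_tvec sY' Uq)).
rewrite (lbracket_locall hA _ oU Up cp E) scale1r.
exact: (lbracketDl hA Up cp (endo_vf hA ea oU sY) (endo_vf hA ea oU sY') (endo_vf hA eb oU sX)).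
Qed.

Lemma twisted_addr Y X X' p c : smooth_vfield U Y -> smooth_vfield U X ->
  smooth_vfield U X' -> U p -> dom A c p ->
  twisted Y (fun q => X q + X' q) p c = twisted Y X p c + twisted Y X' p c.
Proof.
move=> sY sX sX' Up cp; have sXX := vfD hA oU sX sX'.
rewrite -[twisted Y X p c]scale1r.
rewrite twisted.unlock; apply: (endo_comb eL cp (lbracket_endo_tvec Up sY sX)
  (lbracket_endo_tvec Up sY sXX) (lbracket_endo_tvec Up sY sX')).
have E q : U q -> veq q (b q (X q + X' q)) (b q (X q) + b q (X' q)).
  by move=> Uq e eq; rewrite (endoD hA eb eq (vf_tvec sX Uq) (vf_tvec sX' Uq)).
rewrite (lbracket_localr hA _ oU Up cp E) scale1r.
exact: (lbracketDr hA Up cp (endo_vf hA ea oU sY) (endo_vf hA eb oU sX) (endo_vf hA eb oU sX')).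
Qed.

Lemma twisted_scalel f Y X p c : smooth_fun A U f -> smooth_vfield U Y ->
  smooth_vfield U X -> U p -> dom A c p ->
  twisted (fun q => f q *: Y q) X p c =
  f p *: twisted Y X p c - dfun f p (b p (X p)) *: L p (a p (Y p)) c.
Proof.
move=> sf sY sX Up cp; have sfY := vfZ hA oU sf sY.
have saY := endo_vf hA ea oU sY; have sbX := endo_vf hA eb oU sX.
have ta : is_tvec p (a p (Y p)) := vf_tvec saY Up.
rewrite -scaleNr -(endoZ hA eL _ cp ta).
rewrite twisted.unlock; apply: (endo_comb eL cp (lbracket_endo_tvec Up sY sX)
  (lbracket_endo_tvec Up sfY sX) (is_tvecZ hA _ ta)).
have E q : U q -> veq q (a q (f q *: Y q)) (f q *: a q (Y q)).
  by move=> Uq e eq; rewrite (endoZ hA ea (f q) eq (vf_tvec sY Uq)).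
rewrite (lbracket_locall hA _ oU Up cp E) tvscaleE scaleNr.
exact: (lbracketZl hA Up cp saY sbX sf).
Qed.

Lemma twisted_scaler f Y X p c : smooth_fun A U f -> smooth_vfield U Y ->
  smooth_vfield U X -> U p -> dom A c p ->
  twisted Y (fun q => f q *: X q) p c =
  f p *: twisted Y X p c + dfun f p (a p (Y p)) *: L p (b p (X p)) c.
Proof.
move=> sf sY sX Up cp; have sfX := vfZ hA oU sf sX.
have saY := endo_vf hA ea oU sY; have sbX := endo_vf hA eb oU sX.
have tb : is_tvec p (b p (X p)) := vf_tvec sbX Up.
rewrite -(endoZ hA eL _ cp tb).
rewrite twisted.unlock; apply: (endo_comb eL cp (lbracket_endo_tvec Up sY sX)
  (lbracket_endo_tvec Up sY sfX) (is_tvecZ hA _ tb)).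
have E q : U q -> veq q (b q (f q *: X q)) (f q *: b q (X q)).
  by move=> Uq e eq; rewrite (endoZ hA eb (f q) eq (vf_tvec sX Uq)).
rewrite (lbracket_localr hA _ oU Up cp E) tvscaleE.
exact: (lbracketZr hA Up cp saY sbX sf).
Qed.

End twisted.

Section Build.
(* In the application, P and Q are the horizontal and vertical projections, J
   is the fundamental tensor, K = H^sigma o epsilon^{-1} o Q, X0 = X^sigma and
   tf is the time; the hypotheses are their algebraic relations. *)
Variables (P Q J K : T -> tvec A -> tvec A) (X0 : vfield A) (tf : T -> R).
Hypotheses (eP : endo P) (eQ : endo Q) (eJ : endo J) (eK : endo K).
Hypothesis sX0 : forall U, mopen A U -> smooth_vfield U X0.
Hypothesis stf : forall U, mopen A U -> smooth_fun A U tf.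
Hypothesis PQ : forall p v c, dom A c p -> is_tvec p v -> P p v c + Q p v c = v c.
Hypothesis QP0 : forall p v c, dom A c p -> is_tvec p v -> Q p (P p v) c = 0.
Hypothesis JQ0 : forall p v c, dom A c p -> is_tvec p v -> J p (Q p v) c = 0.
Hypothesis split3 : forall p v c, dom A c p -> is_tvec p v ->
  v c = dfun tf p v *: X0 p c + Q p v c + K p (J p v) c.

Section V.
Variable E : T -> tvec A -> tvec A.
Hypothesis eE : endo E.
Hypothesis QE : forall p v c, dom A c p -> is_tvec p v -> Q p (E p v) c = E p v c.
Hypothesis JKE : forall p v c, dom A c p -> is_tvec p v -> J p (K p (E p v)) c = E p v c.

Let KE (q : T) (v : tvec A) := K q (E q v).
Let eKE : endo KE := endo_comp eK eE.

Local Notation vconn := (vconn P Q J K E).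

Variable U : set T.
Hypothesis oU : mopen A U.

Lemma vconn_vf Y X : smooth_vfield U Y -> smooth_vfield U X -> smooth_vfield U (vconn Y X).
Proof.
by move=> sY sX; rewrite vconn.unlock; apply: (vfD hA oU); [exact: (twisted_vf eQ eP eE)|exact:
  (twisted_vf eJ eQ eKE)].
Qed.

Lemma vconnE Y X p c : vconn Y X p c = twisted Q P E Y X p c + twisted J Q KE Y X p c.
Proof. by rewrite vconn.unlock. Qed.

Lemma vconn_local Y Y' X X' p c : smooth_vfield U Y -> smooth_vfield U Y' ->
  smooth_vfield U X -> smooth_vfield U X' ->
  (forall q, U q -> veq q (Y q) (Y' q)) -> (forall q, U q -> veq q (X q) (X' q)) ->
  U p -> dom A c p -> vconn Y X p c = vconn Y' X' p c.
Proof.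
move=> sY sY' sX sX' YY XX Up cp; rewrite !vconnE.
by rewrite (twisted_local eQ eP eE oU sY sY' sX sX' YY XX Up cp)
  (twisted_local eJ eQ eKE oU sY sY' sX sX' YY XX Up cp).
Qed.

Lemma vconn_addl Y Y' X p c : smooth_vfield U Y -> smooth_vfield U Y' ->
  smooth_vfield U X -> U p -> dom A c p ->
  vconn (fun q => Y q + Y' q) X p c = vconn Y X p c + vconn Y' X p c.
Proof.
move=> sY sY' sX Up cp; rewrite !vconnE (twisted_addl eQ eP eE oU sY sY' sX Up cp).
by rewrite (twisted_addl eJ eQ eKE oU sY sY' sX Up cp) addrACA.
Qed.

Lemma vconn_addr Y X X' p c : smooth_vfield U Y -> smooth_vfield U X ->
  smooth_vfield U X' -> U p -> dom A c p ->
  vconn Y (fun q => X q + X' q) p c = vconn Y X p c + vconn Y X' p c.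
Proof.
move=> sY sX sX' Up cp; rewrite !vconnE (twisted_addr eQ eP eE oU sY sX sX' Up cp).
by rewrite (twisted_addr eJ eQ eKE oU sY sX sX' Up cp) addrACA.
Qed.

(** The derivatives of f come with the factors Q (P Y) and J (Q Y), which
    vanish. *)
Lemma vconn_scalel f Y X p c : smooth_fun A U f -> smooth_vfield U Y ->
  smooth_vfield U X -> U p -> dom A c p ->
  vconn (fun q => f q *: Y q) X p c = f p *: vconn Y X p c.
Proof.
move=> sf sY sX Up cp; rewrite !vconnE (twisted_scalel eQ eP eE oU sf sY sX Up cp).
rewrite (twisted_scalel eJ eQ eKE oU sf sY sX Up cp) (QP0 cp (vf_tvec sY Up)).
erewrite (JQ0 cp (vf_tvec sY Up)).
by erewrite !scaler0; rewrite !subr0 scalerDr.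
Qed.

(** The derivatives of f along P Y and along Q Y come with the factors Q (E
    X) and J (K (E X)), both equal to E X; they add up to the derivative
    along Y. *)
Lemma vconn_scaler f Y X p c : smooth_fun A U f -> smooth_vfield U Y ->
  smooth_vfield U X -> U p -> dom A c p ->
  vconn Y (fun q => f q *: X q) p c = f p *: vconn Y X p c + dfun f p (Y p) *: E p (X p) c.
Proof.
move=> sf sY sX Up cp; rewrite !vconnE (twisted_scaler eQ eP eE oU sf sY sX Up cp).
rewrite (twisted_scaler eJ eQ eKE oU sf sY sX Up cp).
have tX := vf_tvec sX Up; have tY := vf_tvec sY Up.
rewrite (QE cp tX) (JKE cp tX).
have tP := endo_tvec eP tY; have tQ := endo_tvec eQ tY.
have -> : dfun f p (Y p) = dfun f p (P p (Y p)) + dfun f p (Q p (Y p)).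
  rewrite -(dfunDv Up cp sf tP tQ).
  apply: (dfun_veq Up cp sf tY (is_tvecD hA tP tQ)).
  by rewrite tvaddE (PQ cp tY).
move: (twisted _ _ _ _ _ _ _) (twisted _ _ _ _ _ _ _) (dfun _ _ _) (dfun _ _ _) (E _ _ _)
  => a1 a2 a3 a4 a5.
by rewrite scalerDr scalerDl addrACA.
Qed.

End V.

Hypothesis QQ : forall p v c, dom A c p -> is_tvec p v -> Q p (Q p v) c = Q p v c.
Hypothesis JKQ : forall p v c, dom A c p -> is_tvec p v -> J p (K p (Q p v)) c = Q p v c.
Hypothesis QJ : forall p v c, dom A c p -> is_tvec p v -> Q p (J p v) c = J p v c.
Hypothesis JKJ : forall p v c, dom A c p -> is_tvec p v -> J p (K p (J p v)) c = J p v c.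

Definition time_comp X : T -> R := fun q => dfun tf q (X q).

(** A field X is the sum of its component along X0, its vertical component Q
    X and K (J X); the three are differentiated separately, J X being
    transported to the vertical bundle and back. *)
Definition conn_op Y X : vfield A := fun q =>
  dfun (time_comp X) q (Y q) *: X0 q + vconn P Q J K Q Y X q + K q (vconn P Q J K J Y X q).

Lemma conn_opE Y X p c : conn_op Y X p c =
  dfun (time_comp X) p (Y p) *: X0 p c + vconn P Q J K Q Y X p c + K p (vconn P Q J K J Y X p) c.
Proof. by []. Qed.

Section On.
Variable U : set T.
Hypothesis oU : mopen A U.

Lemma time_comp_smooth X : smooth_vfield U X -> smooth_fun A U (time_comp X).
Proof. by move=> sX; apply: (dfun_smooth oU) => //; exact: stf. Qed.

Lemma conn_op_vf Y X : smooth_vfield U Y -> smooth_vfield U X -> smooth_vfield U (conn_op Y X).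
Proof.
move=> sY sX; apply: (vfD hA oU).
  apply: (vfD hA oU); last exact: (vconn_vf eQ oU sY sX).
  exact: (vfZ hA oU (dfun_smooth oU (time_comp_smooth sX) sY) (sX0 oU)).
exact: (endo_vf hA eK oU (vconn_vf eJ oU sY sX)).
Qed.

Lemma conn_op_local Y Y' X X' p c : smooth_vfield U Y -> smooth_vfield U Y' ->
  smooth_vfield U X -> smooth_vfield U X' ->
  (forall q, U q -> veq q (Y q) (Y' q)) -> (forall q, U q -> veq q (X q) (X' q)) ->
  U p -> dom A c p -> conn_op Y X p c = conn_op Y' X' p c.
Proof.
move=> sY sY' sX sX' YY XX Up cp; rewrite !conn_opE.
have H1 := vconn_local eQ oU sY sY' sX sX' YY XX Up cp.
have H2 := vconn_local eJ oU sY sY' sX sX' YY XX Up cp.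
have t1 := vf_tvec (vconn_vf eJ oU sY sX) Up; have t2 := vf_tvec (vconn_vf eJ oU sY' sX') Up.
have H3 := endo_eq eK cp t1 t2 H2.
have timeE q : U q -> time_comp X q = time_comp X' q.
  move=> Uq; have [[e eq]|no] := pselect (exists e, dom A e q).
    exact: (dfun_veq Uq eq (stf oU) (vf_tvec sX Uq) (vf_tvec sX' Uq) (XX q Uq e eq)).
  rewrite /time_comp /dfun; congr xget; apply/seteqP.
  by split=> r [e eq]; case: no; exists e.
erewrite H1, H3, (dfun_local oU Up cp (time_comp_smooth sX) (time_comp_smooth sX')
  (vf_tvec sY Up) timeE).
by erewrite (dfun_veq Up cp (time_comp_smooth sX') (vf_tvec sY Up) (vf_tvec sY' Up) (YY p Up c cp)).
Qed.

Lemma conn_op_addl Y Y' X p c : smooth_vfield U Y -> smooth_vfield U Y' ->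
  smooth_vfield U X -> U p -> dom A c p ->
  conn_op (fun q => Y q + Y' q) X p c = conn_op Y X p c + conn_op Y' X p c.
Proof.
move=> sY sY' sX Up cp; rewrite !conn_opE.
have sYY := vfD hA oU sY sY'.
have t1 := vf_tvec (vconn_vf eJ oU sY sX) Up; have t2 := vf_tvec (vconn_vf eJ oU sY' sX) Up.
have t3 := vf_tvec (vconn_vf eJ oU sYY sX) Up.
have H3 : K p (vconn P Q J K J (fun q => Y q + Y' q) X p) c =
    1 *: K p (vconn P Q J K J Y X p) c + K p (vconn P Q J K J Y' X p) c.
  by apply: (endo_comb eK cp t1 t3 t2); rewrite scale1r (vconn_addl eJ oU sY sY' sX Up cp).
rewrite H3 (vconn_addl eQ oU sY sY' sX Up cp).
rewrite (dfunDv Up cp (time_comp_smooth sX) (vf_tvec sY Up) (vf_tvec sY' Up)).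
move: (K _ _ _) (K _ _ _) (vconn _ _ _ _ _ _ _ _ _) (vconn _ _ _ _ _ _ _ _ _) (dfun _ _ _)
  (dfun _ _ _) (X0 p c).
by move=> a1 a2 a3 a4 a5 a6 a7; apply/rowP => j; rewrite !mxE; ring.
Qed.

Lemma conn_op_scalel f Y X p c : smooth_fun A U f -> smooth_vfield U Y ->
  smooth_vfield U X -> U p -> dom A c p ->
  conn_op (fun q => f q *: Y q) X p c = f p *: conn_op Y X p c.
Proof.
move=> sf sY sX Up cp; rewrite !conn_opE.
have sfY := vfZ hA oU sf sY.
have t1 := vf_tvec (vconn_vf eJ oU sY sX) Up; have t0 := @is_tvec0 _ _ _ A p.
have t3 := vf_tvec (vconn_vf eJ oU sfY sX) Up.
have H3 : K p (vconn P Q J K J (fun q => f q *: Y q) X p) c = f p *: K p (vconn P Q J K J Y X p)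
  c + K p 0 c.
  by apply: (endo_comb eK cp t1 t3 t0); rewrite tvzeroE addr0 (vconn_scalel eJ oU sf sY sX Up cp).
rewrite H3 (endo_zero eK cp t0) // addr0 (vconn_scalel eQ oU sf sY sX Up cp).
rewrite (dfunZv Up cp _ (time_comp_smooth sX) (vf_tvec sY Up)).
move: (K _ _ _) (vconn _ _ _ _ _ _ _ _ _) (dfun _ _ _) (X0 p c) (f p).
by move=> a1 a2 a3 a4 a5; apply/rowP => j; rewrite !mxE; ring.
Qed.

Lemma conn_op_addr Y X X' p c : smooth_vfield U Y -> smooth_vfield U X ->
  smooth_vfield U X' -> U p -> dom A c p ->
  conn_op Y (fun q => X q + X' q) p c = conn_op Y X p c + conn_op Y X' p c.
Proof.
move=> sY sX sX' Up cp; rewrite !conn_opE.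
have sXX := vfD hA oU sX sX'.
have t1 := vf_tvec (vconn_vf eJ oU sY sX) Up; have t2 := vf_tvec (vconn_vf eJ oU sY sX') Up.
have t3 := vf_tvec (vconn_vf eJ oU sY sXX) Up.
have H3 : K p (vconn P Q J K J Y (fun q => X q + X' q) p) c =
    1 *: K p (vconn P Q J K J Y X p) c + K p (vconn P Q J K J Y X' p) c.
  by apply: (endo_comb eK cp t1 t3 t2); rewrite scale1r (vconn_addr eJ oU sY sX sX' Up cp).
have s1 := time_comp_smooth sX; have s2 := time_comp_smooth sX'.
have s12 : smooth_fun A U (fun q => time_comp X q + time_comp X' q).
  by move=> e; exact: (csmoothD hA oU (s1 e) (s2 e)).
have H4 : dfun (time_comp (fun q => X q + X' q)) p (Y p) =
    dfun (time_comp X) p (Y p) + dfun (time_comp X') p (Y p).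
  rewrite -(dfunD oU Up cp s1 s2 (vf_tvec sY Up)).
  rewrite (dfun_cderive Up cp (time_comp_smooth sXX) (vf_tvec sY Up))
    (dfun_cderive Up cp s12 (vf_tvec sY Up)).
  apply: (cderive_eq hA _ oU Up cp) => q cq Uq.
  exact: (dfunDv Uq cq (stf oU) (vf_tvec sX Uq) (vf_tvec sX' Uq)).
erewrite H3, H4, (vconn_addr eQ oU sY sX sX' Up cp).
by gen_atoms; apply/rowP => j; rewrite !mxE; ring.
Qed.

(** The three differential terms are the three components of X. *)
Lemma conn_op_leibniz f Y X p c : smooth_fun A U f -> smooth_vfield U Y ->
  smooth_vfield U X -> U p -> dom A c p ->
  conn_op Y (fun q => f q *: X q) p c = dfun f p (Y p) *: X p c + f p *: conn_op Y X p c.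
Proof.
move=> sf sY sX Up cp; rewrite !conn_opE.
have sfX := vfZ hA oU sf sX.
have tX := vf_tvec sX Up.
have t1 := vf_tvec (vconn_vf eJ oU sY sX) Up.
have tJ := endo_tvec eJ tX.
have t3 := vf_tvec (vconn_vf eJ oU sY sfX) Up.
have H3 : K p (vconn P Q J K J Y (fun q => f q *: X q) p) c =
    f p *: K p (vconn P Q J K J Y X p) c + K p (dfun f p (Y p) *: J p (X p)) c.
  by apply: (endo_comb eK cp t1 t3 (is_tvecZ hA _ tJ)); rewrite (vconn_scaler eJ QJ JKJ oU sf sY
    sX Up cp).
have s1 := time_comp_smooth sX.
have s12 : smooth_fun A U (fun q => f q * time_comp X q).
  by move=> e; exact: (csmoothZ hA oU (sf e) (s1 e)).
have H4 : dfun (time_comp (fun q => f q *: X q)) p (Y p) =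
    f p * dfun (time_comp X) p (Y p) + dfun f p (Y p) * time_comp X p.
  rewrite -(dfunM oU Up cp sf s1 (vf_tvec sY Up)).
  rewrite (dfun_cderive Up cp (time_comp_smooth sfX) (vf_tvec sY Up))
    (dfun_cderive Up cp s12 (vf_tvec sY Up)).
  apply: (cderive_eq hA _ oU Up cp) => q cq Uq.
  exact: (dfunZv Uq cq _ (stf oU) (vf_tvec sX Uq)).
erewrite H3, H4, (vconn_scaler eQ QQ JKQ oU sf sY sX Up cp), (endoZ hA eK _ cp tJ).
rewrite [X in _ = _ *: X + _](split3 cp tX) -/(time_comp X p).
move: (K _ _ _) (K _ _ _) (Q _ _ _) (vconn _ _ _ _ _ _ _ _ _) (dfun _ _ _) (dfun _ _ _)
  (time_comp X p) (X0 p c).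
by move=> a1 a2 a3 a4 a5 a6 a7 a8; apply/rowP => j; rewrite !mxE; ring.
Qed.

End On.

Definition twisted_conn : linear_connection A := @LinearConnection R T d A conn_op
  (fun U Y X oU sY sX => conn_op_vf oU sY sX)
  (fun U Y Y' X X' oU sY sY' sX sX' YY XX p Up c cp =>
     conn_op_local oU sY sY' sX sX' YY XX Up cp)
  (fun U Y Y' X oU sY sY' sX p Up c cp => conn_op_addl oU sY sY' sX Up cp)
  (fun U f Y X oU sf sY sX p Up c cp => conn_op_scalel oU sf sY sX Up cp)
  (fun U Y X X' oU sY sX sX' p Up c cp => conn_op_addr oU sY sX sX' Up cp)
  (fun U f Y X oU sf sY sX p Up c cp => conn_op_leibniz oU sf sY sX Up cp).

End Build.

End Twisted.

(** * The induced frame and the Chern connection *)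

Section Frames.
Variables (R : realType) (M : topologicalType) (n : nat) (A : atlas R M n).
Hypothesis hM : smooth_manifold A.
Variable s : sode A.
Let B := M1 A.
Let hB : regular_atlas B := M1_regular hM s.
Implicit Types (c e : idx B) (p q : jet A 1) (v : tvec B).
Local Notation ev i := (delta_mx 0 i : 'rV[R]_n).

(** The row of the 1/2 d^2 F^k / d\dot x^i d\dot x^j. *)
Definition dhlift c p (i j : 'I_n) : 'rV[R]_n :=
  cderive (A := B) c (txv 0 0 (ev i)) (fun q => hlift s c q (ev j)) p.

Lemma dom_open c : mopen B (dom B c). Proof. exact: mopen_dom. Qed.

Lemma Xi_vf c i : smooth_vfield (dom B c) (Xi s c i : vfield B).
Proof.
have tX q : dom B c q -> is_tvec q (Xi s c i q : tvec B).
  by move=> cq; exact: (tv_is_tvec hB _ cq).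
have zs := csmooth_cst hB c (@dom_open c) (ev i).
have sX : csmooth c (dom B c) (fun q => (Xi s c i : vfield B) q c).
  apply: (@csmooth_eq _ _ _ _ hB c _ (@dom_open c) _ (fun q => txv 0 (ev i) (hlift s c q (ev i)))).
    by move=> q cq _; rewrite (XiE hM).
  exact: (csmooth_txv hM s (@dom_open c) (csmooth_cst hB c (@dom_open c) 0)
    zs (hlift_smooth hM s (@dom_open c) zs)).
exact: (vf_chart hB (@dom_open c) (fun q cq => cq) tX sX).
Qed.

Lemma Dv_vf c i : smooth_vfield (dom B c) (Dv c i : vfield B).
Proof. exact: (vf_tv hB (@dom_open c) (fun q cq => cq) (csmooth_cst hB c (@dom_open c) _)). Qed.

Section At.
Variables (c : idx B) (p : jet A 1).
Hypothesis cp : dom B c p.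

Lemma dhlift_sym i j : dhlift c p i j = dhlift c p j i.
Proof.
have E k l : dhlift c p k l =
    2^-1 *: cderive (A := B) c (txv 0 0 (ev k)) (fun q => cderive (A :=
      B) c (txv 0 0 (ev l)) (F s c) q) p.
  have sF := csmooth_F hM s c (@dom_open c).
  have df : cdiff (A := B) c (fun q => cderive (A := B) c (txv 0 0 (ev l)) (F s c) q) p.
    exact: (csmooth_cdiff (csmooth_cderive_cst hB (@dom_open c) _ sF) cp cp).
  have dc : cdiff (A := B) c (fun=> 2^-1 : R) p.
    exact: (csmooth_cdiff (csmooth_cst hB c (@dom_open c) (2^-1 : R)) cp cp).
  have := cderiveZ hB cp (txv 0 0 (ev k)) dc df.
  by rewrite (cderive_cst hB cp) scale0r addr0.
have sy := cderive_sym hB (@dom_open c) cp cp (txv 0 0 (ev i)) (txv 0 0 (ev j))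
  (csmooth_F hM s c (@dom_open c)).
by erewrite !E, sy.
Qed.

Lemma cderive_Xi w j : cderive (A := B) c w (fun q => Xi s c j q c) p =
  txv 0 0 (cderive (A := B) c w (fun q => hlift s c q (ev j)) p).
Proof.
have dX := csmooth_cdiff (vf_csmooth c (Xi_vf c j)) cp cp.
have XE q : dom B c q -> dom B c q ->
    Xi s c j q c = txv ((fun=> 0) q) ((fun=> ev j) q) ((fun q => hlift s c q (ev j)) q).
  by move=> cq _; rewrite (XiE hM).
by rewrite (cderive_txv hM s w (@dom_open c) cp cp XE dX) !(cderive_cst hB cp).
Qed.

Lemma cderive_Dv w j : cderive (A := B) c w (fun q => Dv c j q c) p = 0.
Proof.
rewrite (@cderive_eq _ _ _ _ hB _ _ _ w _ (fun=> txv 0 0 (ev j)) p (@dom_open c) cp cp).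
  by rewrite (cderive_cst hB cp).
by move=> q cq _; rewrite (DvE hM s).
Qed.

Lemma two_hlift b : cderive (A := B) c (txv 0 0 b) (F s c) p = 2 *: hlift s c p b.
Proof. by rewrite /hlift scalerA divff ?scale1r // pnatr_eq0. Qed.

Lemma lbracket_Xs_Dv i : lbracket (Xs s : vfield B) (Dv c i) p c = - txv 0 (ev i)
  (2 *: hlift s c p (ev i)).
Proof. by rewrite lbracketE cderive_Dv (cderive_Xs hM _ _ cp) (DvE hM s i cp) two_hlift; rowE;
  rewrite sub0r. Qed.

Lemma lbracket_Xi_Dv j i : lbracket (Xi s c j : vfield B) (Dv c i) p c = - txv 0 0 (dhlift c p i j).
Proof. by rewrite lbracketE; erewrite cderive_Dv, cderive_Xi, (DvE hM s i cp); rewrite sub0r. Qed.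

Lemma lbracket_Dv_Dv j i : lbracket (Dv c j : vfield B) (Dv c i) p c = 0.
Proof. by rewrite lbracketE; erewrite !cderive_Dv; rewrite subrr. Qed.

Lemma lbracket_Xs_Xi j : lbracket (Xs s : vfield B) (Xi s c j) p c =
  txv 0 (- hlift s c p (ev j)) (vcoord (lbracket (Xs s : vfield B) (Xi s c j) p c)).
Proof.
rewrite lbracketE cderive_Xi (cderive_Xs hM _ _ cp) (XiE hM s j cp).
by apply: row_ext; rowE; rewrite ?subr0 ?sub0r.
Qed.

Lemma lbracket_Xi_Xi i j : lbracket (Xi s c i : vfield B) (Xi s c j) p c =
  txv 0 0 (vcoord (lbracket (Xi s c i : vfield B) (Xi s c j) p c)).
Proof.
by rewrite lbracketE; erewrite !cderive_Xi; apply: row_ext; rowE; rewrite ?subr0.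
Qed.

Lemma DvSum (b : 'rV[R]_n) : \sum_(i < n) b 0 i *: Dv c i p c = txv 0 0 b.
Proof.
rewrite (eq_bigr (fun i => b 0 i *: insv (ev i))); last by move=> i _; rewrite (DvE hM s).
rewrite -[RHS]/(insv b) [in RHS](row_sum_delta b) linear_sum.
by apply: eq_bigr => i _; rewrite linearZ.
Qed.

Lemma hlift_dF i j : hlift s c p (ev i) 0 j = 2^-1 * dF s c j i p.
Proof. by rewrite /hlift mxE /dF /partial -delta_iv cderiveE. Qed.

Lemma dhlift_ddF i j k : dhlift c p i j 0 k = 2^-1 * ddF s c k i j p.
Proof.
have sF := csmooth_F hM s c (@dom_open c).
have df : cdiff (A := B) c (fun q => cderive (A := B) c (txv 0 0 (ev j)) (F s c) q) p.
  exact: (csmooth_cdiff (csmooth_cderive_cst hB (@dom_open c) _ sF) cp cp).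
have dc : cdiff (A := B) c (fun=> 2^-1 : R) p.
  exact: (csmooth_cdiff (csmooth_cst hB c (@dom_open c) (2^-1 : R)) cp cp).
have := cderiveZ hB cp (txv 0 0 (ev i)) dc df.
rewrite (cderive_cst hB cp) scale0r addr0 -/(dhlift c p i j) => ->.
by rewrite mxE /ddF /partial -!delta_iv cderive.unlock.
Qed.

End At.

(** The defining equations of the Chern connection, as rows in the chart that
    defines the fields X^sigma_i and d/d\dot x^i. They are equivalent to
    [is_Chern] because tangent vectors are determined by their components in
    one chart. *)
Record chern_table (D : linear_connection B) : Prop := ChernTable {
  ct_Xs : forall U Y, mopen B U -> smooth_vfield U Y -> forall p c, U p -> dom B c p ->
    D Y (Xs s) p c = 0 ;
  ct_Xs_Xi : forall c p i, dom B c p -> D (Xs s) (Xi s c i) p c =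
    - txv 0 (hlift s c p (ev i)) (hlift s c p (hlift s c p (ev i))) ;
  ct_Xs_Dv : forall c p i, dom B c p -> D (Xs s) (Dv c i) p c =
    - txv 0 0 (hlift s c p (ev i)) ;
  ct_Xi_Xi : forall c p i j, dom B c p -> D (Xi s c j) (Xi s c i) p c =
    - txv 0 (dhlift c p i j) (hlift s c p (dhlift c p i j)) ;
  ct_Xi_Dv : forall c p i j, dom B c p -> D (Xi s c j) (Dv c i) p c =
    - txv 0 0 (dhlift c p i j) ;
  ct_Dv_Xi : forall c p i j, dom B c p -> D (Dv c j) (Xi s c i) p c = 0 ;
  ct_Dv_Dv : forall c p i j, dom B c p -> D (Dv c j) (Dv c i) p c = 0 }.

Lemma sumXi c p (b : 'rV[R]_n) (x : 'I_n -> R) : dom B c p -> (forall j, b 0 j = x j) ->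
  (- \sum_(j < n) x j *: Xi s c j p : tvec B) c = - txv 0 b (hlift s c p b).
Proof.
move=> cp bx; rewrite -(XiSum hM s b cp) tvoppE tvsumE; congr (- _).
by apply: eq_bigr => j _; rewrite bx.
Qed.

Lemma sumDv c p (b : 'rV[R]_n) (x : 'I_n -> R) : dom B c p -> (forall j, b 0 j = x j) ->
  (- \sum_(j < n) x j *: Dv c j p : tvec B) c = - txv 0 0 b.
Proof.
move=> cp bx; rewrite -(DvSum cp b) tvoppE tvsumE; congr (- _).
by apply: eq_bigr => j _; rewrite bx.
Qed.

Lemma is_tvec_sum p m (F : 'I_m -> tvec B) : (forall i, is_tvec p (F i)) ->
  is_tvec p (\sum_(i < m) F i).
Proof.
move=> tF; elim/big_rec: _ => [|i x _ tx]; first exact: is_tvec0.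
exact: (is_tvecD hB (tF i) tx).
Qed.

Lemma Chern_table (D : linear_connection B) : is_Chern s D -> chern_table D.
Proof.
move=> [D0 D1]; split=> [U Y oU sY p c Up cp|c p i cp|c p i cp|c p i j cp|c p i j cp|c p i j cp|c
  p i j cp].
- exact: (D0 U Y oU sY p Up c cp).
- have [H _ _ _ _] := D1 c p cp.
  by rewrite (H i c cp); apply: sumXi => // j; exact: hlift_dF.
- have [_ H _ _ _] := D1 c p cp.
  by rewrite (H i c cp); apply: sumDv => // j; exact: hlift_dF.
- have [_ _ H _ _] := D1 c p cp.
  by rewrite (H i j c cp); apply: sumXi => // k; exact: dhlift_ddF.
- have [_ _ _ H _] := D1 c p cp.
  by rewrite (H i j c cp); apply: sumDv => // k; exact: dhlift_ddF.
- by have [_ _ _ _ H] := D1 c p cp; rewrite (H i j).1.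
- by have [_ _ _ _ H] := D1 c p cp; rewrite (H i j).2.
Qed.

Lemma table_Chern (D : linear_connection B) : chern_table D -> is_Chern s D.
Proof.
move=> ct; split=> [U Y oU sY p Up c cp|c p cp]; first exact: (ct_Xs ct oU sY Up cp).
have sX := Xs_vf hM s (@dom_open c).
have tD Y X : smooth_vfield (dom B c) Y -> smooth_vfield (dom B c) X -> is_tvec p (D Y X p).
  by move=> sY sX'; exact: (vf_tvec (cov_smooth D (@dom_open c) sY sX') cp).
have tXi i := vf_tvec (Xi_vf c i) cp; have tDv i := vf_tvec (Dv_vf c i) cp.
have tS x E : (forall j, is_tvec p (E j : tvec B)) -> is_tvec p (- \sum_(j < n) (x j : R) *: E j).
  move=> tE; apply: (is_tvecN hB); apply: is_tvec_sum => j; exact: (is_tvecZ hB).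
split=> [i|i|i j|i j|i j].
- apply: (tvec_eq (tD _ _ sX (Xi_vf c i)) (tS _ _ tXi) cp).
  by rewrite (ct_Xs_Xi ct) //; apply: esym; apply: sumXi => // j; exact: hlift_dF.
- apply: (tvec_eq (tD _ _ sX (Dv_vf c i)) (tS _ _ tDv) cp).
  by rewrite (ct_Xs_Dv ct) //; apply: esym; apply: sumDv => // j; exact: hlift_dF.
- apply: (tvec_eq (tD _ _ (Xi_vf c j) (Xi_vf c i)) (tS _ _ tXi) cp).
  by rewrite (ct_Xi_Xi ct) //; apply: esym; apply: sumXi => // k; exact: dhlift_ddF.
- apply: (tvec_eq (tD _ _ (Xi_vf c j) (Dv_vf c i)) (tS _ _ tDv) cp).
  by rewrite (ct_Xi_Dv ct) //; apply: esym; apply: sumDv => // k; exact: dhlift_ddF.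
- split.
    apply: (tvec_eq (tD _ _ (Dv_vf c j) (Xi_vf c i)) (@is_tvec0 _ _ _ B p) cp).
    by rewrite (ct_Dv_Xi ct).
  apply: (tvec_eq (tD _ _ (Dv_vf c j) (Dv_vf c i)) (@is_tvec0 _ _ _ B p) cp).
  by rewrite (ct_Dv_Dv ct).
Qed.

Lemma contact_txv c p (a : R) (b e : 'rV[R]_n) : contact c p (txv a b e) = b - a *: jcoord c 1 p.
Proof. by rewrite /contact; rowE. Qed.

Lemma vcoef_txv c p (a : R) (b e : 'rV[R]_n) :
  vcoef s c p (txv a b e) = e - (a *: F s c p + hlift s c p (b - a *: jcoord c 1 p)).
Proof. by rewrite /vcoef contact_txv; rowE. Qed.

Lemma vcoef_vert c p (e : 'rV[R]_n) : vcoef s c p (txv 0 0 e) = e.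
Proof. by rewrite vcoef_txv !scale0r subr0 hlift0 addr0 subr0. Qed.

Lemma vcoef_hor c p (b : 'rV[R]_n) : vcoef s c p (txv 0 b (hlift s c p b)) = 0.
Proof. by rewrite vcoef_txv !scale0r subr0 add0r subrr. Qed.

Lemma hpart_vpart p v c : dom B c p -> is_tvec p v -> hpart s p v c + vpart s p v c = v c.
Proof.
move=> cp tv; rewrite -[vpart s p v c]/(v c - hpart s p v c).
by generalize (hpart s p v c); move=> a; rewrite addrC subrK.
Qed.

Lemma vpart_hpart p v c : dom B c p -> is_tvec p v -> vpart s p (hpart s p v) c = 0.
Proof.
move=> cp tv; rewrite (vpart_coef hM s (hpart_tvec hM s tv) cp) (hpartE hM s tv cp) vcoef_txv subrr.
by rewrite -[txv 0 0 0]/(insv 0) linear0.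
Qed.

Lemma J_vpart p v c : dom B c p -> is_tvec p v -> Jtensor p (vpart s p v) c = 0.
Proof.
move=> cp tv; rewrite (JE hM s (vpart_tvec hM s tv) cp) (vpart_coef hM s tv cp).
by rowE; rewrite scale0r subr0 -[txv 0 0 0]/(insv 0) linear0.
Qed.

Lemma vpart_vpart p v c : dom B c p -> is_tvec p v -> vpart s p (vpart s p v) c = vpart s p v c.
Proof.
by move=> cp tv; rewrite (vpart_coef hM s (vpart_tvec hM s tv) cp) (vpart_coef hM s tv cp)
  vcoef_vert.
Qed.

Lemma vpart_J p v c : dom B c p -> is_tvec p v -> vpart s p (Jtensor p v) c = Jtensor p v c.
Proof.
by move=> cp tv; rewrite (vpart_coef hM s (J_tvec hM s tv) cp) (JE hM s tv cp) vcoef_vert.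
Qed.

Lemma J_vert_to_hor p v c b : dom B c p -> is_tvec p v -> v c = txv 0 0 b ->
  Jtensor p (vert_to_hor s p v) c = txv 0 0 b.
Proof.
move=> cp tv vE; rewrite (JE hM s (vert_to_hor_tvec hM s tv) cp) (vert_to_horE hM s tv cp)
  vE vcoef_vert.
by rowE; rewrite scale0r subr0.
Qed.

Lemma split_three p v c : dom B c p -> is_tvec p v ->
  v c = dfun (@jtime _ _ _ _ 1) p v *: Xs s p c + vpart s p v c + vert_to_hor s p (Jtensor p v) c.
Proof.
move=> cp tv; rewrite -/(dt p v) (dtE hM s tv cp) XsE (vpart_coef hM s tv cp).
rewrite (vert_to_horE hM s (J_tvec hM s tv) cp) (JE hM s tv cp) vcoef_vert.
apply: row_ext; rowE; rewrite ?mulr1 ?addr0 //.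
  by rewrite addrC subrK.
by rewrite /vcoef /contact; generalize (hlift s c p (xcoord (v c) - tcoord (v c)
  *: jcoord c 1 p)) => a;
  apply/rowP => j; rewrite !mxE; ring.
Qed.

(** Globally defined, since it only involves globally defined tensors and
    brackets; that it satisfies the local equations is [chern_is_table]. *)
Definition chern : linear_connection B :=
  twisted_conn hB (hpart_endo hM s) (vpart_endo hM s) (J_endo hM s) (vert_to_hor_endo hM s)
    (Xs_vf hM s) (smooth_time hM s) hpart_vpart vpart_hpart J_vpart split_three vpart_vpart
    (fun p v c cp tv => etrans (J_vert_to_hor cp (vpart_tvec hM s tv) (vpart_coef hM s tv cp))
      (esym (vpart_coef hM s tv cp)))
    vpart_J
    (fun p v c cp tv => etrans (J_vert_to_hor cp (J_tvec hM s tv) (JE hM s tv cp))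
      (esym (JE hM s tv cp))).

End Frames.

Section Existence.
Variables (R : realType) (M : topologicalType) (n : nat) (A : atlas R M n).
Hypothesis hM : smooth_manifold A.
Variable s : sode A.
Let B := M1 A.
Let hB : regular_atlas B := M1_regular hM s.
Implicit Types (c e : idx B) (p q : jet A 1) (v : tvec B) (X Y : vfield B).
Implicit Types (L E : jet A 1 -> tvec B -> tvec B).
Local Notation ev i := (delta_mx 0 i : 'rV[R]_n).
Local Notation P := (hpart s).
Local Notation Q := (vpart s).
Local Notation J := (@Jtensor R M n A).
Local Notation K := (vert_to_hor s).
Let eP := hpart_endo hM s.
Let eQ := vpart_endo hM s.
Let eJ := J_endo hM s.
Let eK := vert_to_hor_endo hM s.

Lemma txvN (b b' : 'rV[R]_n) : txv 0 (- b) (- b') = - txv 0 b b' :> 'rV[R]_(1 + (n + n)).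
Proof. by apply: row_ext; rowE; rewrite ?oppr0. Qed.

Lemma vconn_val E Y X p c w w' : twisted (A := B) Q P E Y X p c = w ->
  twisted (A := B) J Q (fun q v => K q (E q v)) Y X p c = w' ->
  vconn (A := B) P Q J K E Y X p c = w + w'.
Proof. by rewrite vconn.unlock => <- <-. Qed.

Lemma vpart_val p c v r : is_tvec p v -> dom B c p -> v c = r -> Q p v c = txv 0 0 (vcoef s c p r).
Proof. by move=> tv cp <-; exact: vpart_coef. Qed.

Lemma J_val p c v r : is_tvec p v -> dom B c p -> v c = r -> J p v c = txv 0 0 (contact c p r).
Proof. by move=> tv cp <-; exact: JE. Qed.

Lemma txv0 : txv 0 0 0 = 0 :> 'rV[R]_(1 + (n + n)).
Proof. by apply: row_ext; rowE. Qed.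

Lemma hliftN c p b : dom B c p -> hlift s c p (- b) = - hlift s c p b.
Proof.
by move=> cp; have := hlift_linear hM s (-1) b 0 cp; rewrite !scaleN1r hlift0 !addr0.
Qed.

Lemma vcoefN c p w : dom B c p -> vcoef s c p (- w) = - vcoef s c p w.
Proof.
move=> cp; have z0 : vcoef s c p 0 = 0 by rewrite -txv0 vcoef_vert.
by have := vcoef_linear hM s (-1) w 0 cp; rewrite !scaleN1r z0 !addr0.
Qed.

Lemma lbracket_0r Y p c : dom B c p -> lbracket Y (fun=> 0 : tvec B) p c = 0.
Proof. by move=> cp; rewrite lbracketE (cderive_cst hB cp) cderive_dir0 subr0. Qed.

Lemma lbracket_0l Y p c : dom B c p -> lbracket (fun=> 0 : tvec B) Y p c = 0.
Proof. by move=> cp; rewrite lbracket_anti lbracket_0r // oppr0. Qed.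

Lemma frame_tvec q c : dom B c q -> (forall i, is_tvec q (Xi s c i q : tvec B)) /\
  (forall i, is_tvec q (Dv c i q : tvec B)).
Proof.
by move=> cq; split=> i; [exact: (vf_tvec (Xi_vf hM s c i) cq)|exact: (vf_tvec (Dv_vf hM s c i)
  cq)].
Qed.

Section FrameValues.
Variables (c : idx B) (q : jet A 1) (i : 'I_n).
Hypothesis cq : dom B c q.
Let tX := Xs_tvec hM s (p := q).
Let tXi := (frame_tvec cq).1 i.
Let tDv := (frame_tvec cq).2 i.
Let t0 := @is_tvec0 _ _ _ B q.

Lemma hpart_Xs : veq q (P q (Xs s q)) (Xs s q).
Proof.
apply: (tvec_eq (hpart_tvec hM s tX) tX cq).
by rewrite (hpartE hM s tX cq) XsE; rowE; rewrite !scale1r subrr hlift0 addr0.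
Qed.

Lemma hpart_Xi : veq q (P q (Xi s c i q)) (Xi s c i q).
Proof.
apply: (tvec_eq (hpart_tvec hM s tXi) tXi cq).
by rewrite (hpartE hM s tXi cq) (XiE hM s i cq); rowE; rewrite !scale0r subr0 add0r.
Qed.

Lemma hpart_Dv : veq q (P q (Dv c i q)) 0.
Proof.
apply: (tvec_eq (hpart_tvec hM s tDv) t0 cq).
rewrite (hpartE hM s tDv cq) (DvE hM s i cq); rowE.
by rewrite !scale0r subr0 add0r hlift0 txv0.
Qed.

Lemma vpart_Xs : veq q (Q q (Xs s q)) 0.
Proof.
apply: (tvec_eq (vpart_tvec hM s tX) t0 cq).
by rewrite (vpart_coef hM s tX cq) XsE vcoef_txv !scale1r subrr hlift0 addr0 subrr txv0.
Qed.

Lemma vpart_Xi : veq q (Q q (Xi s c i q)) 0.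
Proof.
apply: (tvec_eq (vpart_tvec hM s tXi) t0 cq).
by rewrite (vpart_coef hM s tXi cq) (XiE hM s i cq) vcoef_hor txv0.
Qed.

Lemma vpart_Dv : veq q (Q q (Dv c i q)) (Dv c i q).
Proof.
apply: (tvec_eq (vpart_tvec hM s tDv) tDv cq).
by rewrite (vpart_coef hM s tDv cq) (DvE hM s i cq) vcoef_vert.
Qed.

Lemma J_Xs : veq q (J q (Xs s q)) 0.
Proof.
apply: (tvec_eq (J_tvec hM s tX) t0 cq).
by rewrite (JE hM s tX cq) XsE; rowE; rewrite scale1r subrr txv0.
Qed.

Lemma J_Xi : veq q (J q (Xi s c i q)) (Dv c i q).
Proof.
apply: (tvec_eq (J_tvec hM s tXi) tDv cq).
by rewrite (JE hM s tXi cq) (XiE hM s i cq) (DvE hM s i cq); rowE; rewrite scale0r subr0.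
Qed.

Lemma J_Dv : veq q (J q (Dv c i q)) 0.
Proof.
apply: (tvec_eq (J_tvec hM s tDv) t0 cq).
by rewrite (JE hM s tDv cq) (DvE hM s i cq); rowE; rewrite scale0r subr0 txv0.
Qed.

Lemma vert_to_hor_Dv : veq q (K q (Dv c i q)) (Xi s c i q).
Proof.
apply: (tvec_eq (vert_to_hor_tvec hM s tDv) tXi cq).
by rewrite (vert_to_horE hM s tDv cq) (DvE hM s i cq) (XiE hM s i cq) vcoef_vert.
Qed.

End FrameValues.

Section Eval.
Variables (c : idx B) (p : jet A 1) (U : set (jet A 1)).
Hypotheses (oU : mopen B U) (Up : U p) (cp : dom B c p) (Uc : U `<=` dom B c).

(** Endomorphisms act on fields, so a bracket of images at p can be computed
    as soon as the images are known near p. *)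
Lemma twisted_eval L a b Y X Y' X' : endo (A := B) L -> endo (A := B) a -> endo (A := B) b ->
  smooth_vfield U Y -> smooth_vfield U X -> smooth_vfield U Y' -> smooth_vfield U X' ->
  (forall q, U q -> veq q (a q (Y q)) (Y' q)) -> (forall q, U q -> veq q (b q (X q)) (X' q)) ->
  twisted L a b Y X p c = L p (lbracket Y' X' p) c.
Proof.
move=> eL ea eb sY sX sY' sX' YY XX; rewrite twisted.unlock.
apply: (endo_eq eL cp (lbracket_endo_tvec hB ea eb oU Up sY sX) (lbracket_tvec hB oU Up sY' sX')).
exact: (lbracket_local hB oU YY XX Up cp).
Qed.

Lemma twisted_0r L a b Y X : endo (A := B) L -> endo (A := B) a -> endo (A := B) b ->
  smooth_vfield U Y -> smooth_vfield U X ->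
  (forall q, U q -> veq q (b q (X q)) 0) -> twisted L a b Y X p c = 0.
Proof.
move=> eL ea eb sY sX XX; have s0 := vf0 hB oU; have sa := endo_vf hB ea oU sY.
rewrite (twisted_eval eL ea eb sY sX sa s0 _ XX) //.
by apply: (endo_zero eL cp (lbracket_tvec hB oU Up sa s0)); rewrite lbracket_0r.
Qed.

Lemma twisted_0l L a b Y X : endo (A := B) L -> endo (A := B) a -> endo (A := B) b ->
  smooth_vfield U Y -> smooth_vfield U X ->
  (forall q, U q -> veq q (a q (Y q)) 0) -> twisted L a b Y X p c = 0.
Proof.
move=> eL ea eb sY sX YY; have s0 := vf0 hB oU; have sb := endo_vf hB eb oU sX.
rewrite (twisted_eval eL ea eb sY sX s0 sb YY) //.
by apply: (endo_zero eL cp (lbracket_tvec hB oU Up s0 sb)); rewrite lbracket_0l.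
Qed.

Let sXs : smooth_vfield U (Xs s : vfield B). Proof. exact: Xs_vf. Qed.
Let sXi i : smooth_vfield U (Xi s c i : vfield B).
Proof. exact: (vf_sub Uc (Xi_vf hM s c i)). Qed.
Let sDv i : smooth_vfield U (Dv c i : vfield B).
Proof. exact: (vf_sub Uc (Dv_vf hM s c i)). Qed.

Section VcEval.
Variables (E : jet A 1 -> tvec B -> tvec B) (X : vfield B).
Hypotheses (eE : endo (A := B) E) (sX : smooth_vfield U X).
Let eKE : endo (A := B) (fun q v => K q (E q v)) := endo_comp eK eE.

Lemma KE_zero : (forall q, U q -> veq q (E q (X q)) 0) ->
  forall q, U q -> veq q (K q (E q (X q))) 0.
Proof.
move=> E0 q Uq e eq; apply: (endo_zero eK eq (endo_tvec eE (vf_tvec sX Uq))).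
exact: E0.
Qed.

Lemma vconn_zero Y : smooth_vfield U Y -> (forall q, U q -> veq q (E q (X q)) 0) ->
  vconn P Q J K E Y X p c = 0.
Proof.
move=> sY E0.
by rewrite (vconn_val (twisted_0r eQ eP eE sY sX E0) (twisted_0r eJ eQ eKE sY sX (KE_zero E0)))
  addr0.
Qed.

Variable i : 'I_n.
Hypothesis ED : forall q, U q -> veq q (E q (X q)) (Dv c i q).

Lemma KE_Xi : forall q, U q -> veq q (K q (E q (X q))) (Xi s c i q).
Proof.
move=> q Uq e eq; rewrite -(vert_to_hor_Dv i (Uc Uq) eq).
have tD := (frame_tvec (Uc Uq)).2 i.
exact: (endo_eq eK eq (endo_tvec eE (vf_tvec sX Uq)) tD (ED Uq eq)).
Qed.

Lemma vconn_Xs : vconn P Q J K E (Xs s) X p c = - txv 0 0 (hlift s c p (ev i)).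
Proof.
have Q0 q : U q -> veq q (Q q (Xs s q)) 0 by move=> Uq; exact: (vpart_Xs (Uc Uq)).
have P0 q : U q -> veq q (P q (Xs s q)) (Xs s q) by move=> Uq; exact: (hpart_Xs (Uc Uq)).
apply: etrans (vconn_val (twisted_eval eQ eP eE sXs sX sXs (sDv i) P0 ED)
  (twisted_0l eJ eQ eKE sXs sX Q0)) _.
have tb := lbracket_tvec hB oU Up sXs (sDv i).
rewrite addr0 (vpart_val tb cp (lbracket_Xs_Dv hM s cp i)) (vcoefN _ cp) vcoef_txv.
rewrite !scale0r subr0 add0r -txvN oppr0; congr txv.
by congr (- _); apply/rowP => j; rewrite !mxE; ring.
Qed.

Lemma vconn_Xi j : vconn P Q J K E (Xi s c j) X p c = - txv 0 0 (dhlift s c p i j).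
Proof.
have Q0 q : U q -> veq q (Q q (Xi s c j q)) 0 by move=> Uq; exact: (vpart_Xi j (Uc Uq)).
have P0 q : U q -> veq q (P q (Xi s c j q)) (Xi s c j q).
  by move=> Uq; exact: (hpart_Xi j (Uc Uq)).
apply: etrans (vconn_val (twisted_eval eQ eP eE (sXi j) sX (sXi j) (sDv i) P0 ED)
  (twisted_0l eJ eQ eKE (sXi j) sX Q0)) _.
have tb := lbracket_tvec hB oU Up (sXi j) (sDv i).
by rewrite addr0 (vpart_val tb cp (lbracket_Xi_Dv hM s cp j i)) (vcoefN _ cp)
  vcoef_vert -txvN oppr0.
Qed.

Lemma vconn_Dv j : vconn P Q J K E (Dv c j) X p c = 0.
Proof.
have P0 q : U q -> veq q (P q (Dv c j q)) 0 by move=> Uq; exact: (hpart_Dv j (Uc Uq)).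
have Q0 q : U q -> veq q (Q q (Dv c j q)) (Dv c j q).
  by move=> Uq; exact: (vpart_Dv j (Uc Uq)).
apply: etrans (vconn_val (twisted_0l eQ eP eE (sDv j) sX P0)
  (twisted_eval eJ eQ eKE (sDv j) sX (sDv j) (sXi i) Q0 KE_Xi)) _.
have tb := lbracket_tvec hB oU Up (sDv j) (sXi i).
have Eb : lbracket (Dv c j) (Xi s c i) p c = txv 0 0 (dhlift s c p j i).
  by rewrite lbracket_anti (lbracket_Xi_Dv hM s cp i j) opprK.
by rewrite add0r (J_val tb cp Eb) contact_txv scale0r subr0 txv0.
Qed.

End VcEval.

Lemma chernE Y X : chern hM s Y X p c =
  dfun (time_comp (@jtime _ _ _ _ 1) X) p (Y p) *: Xs s p c +
  vconn P Q J K Q Y X p c + K p (vconn P Q J K J Y X p) c.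
Proof. by []. Qed.

Lemma time_comp_const X k Y : smooth_vfield U X -> smooth_vfield U Y ->
  (forall q, U q -> tcoord (X q c) = k) -> dfun (time_comp (@jtime _ _ _ _ 1) X) p (Y p) = 0.
Proof.
move=> sX sY tk.
have sc := sfun_cst hB k oU.
have st := time_comp_smooth hB (smooth_time hM s) oU sX.
have E q : U q -> time_comp (A := B) (@jtime _ _ _ _ 1) X q = k.
  by move=> Uq; have := dtE hM s (vf_tvec sX Uq) (Uc Uq); rewrite /dt /time_comp tk.
rewrite (dfun_local hB oU Up cp st sc (vf_tvec sY Up) E).
by rewrite (dfun_cderive hB Up cp sc (vf_tvec sY Up)) (cderive_cst hB cp).
Qed.

Lemma K_vconn0 Y X : smooth_vfield U Y -> smooth_vfield U X ->
  vconn P Q J K J Y X p c = 0 -> K p (vconn P Q J K J Y X p) c = 0.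
Proof.
by move=> sY sX E0; exact: (endo_zero eK cp (vf_tvec (vconn_vf hB eP eQ eJ eK eJ oU sY sX) Up) E0).
Qed.

Lemma K_vconnE Y X b : smooth_vfield U Y -> smooth_vfield U X ->
  vconn P Q J K J Y X p c = - txv 0 0 b -> K p (vconn P Q J K J Y X p)
    c = - txv 0 b (hlift s c p b).
Proof.
move=> sY sX Eb; have tV := vf_tvec (vconn_vf hB eP eQ eJ eK eJ oU sY sX) Up.
by rewrite (vert_to_horE hM s tV cp) Eb (vcoefN _ cp) vcoef_vert (hliftN _ cp) txvN.
Qed.

Lemma chern_vert Y i : smooth_vfield U Y ->
  chern hM s Y (Dv c i) p c = vconn P Q J K Q Y (Dv c i) p c.
Proof.
move=> sY; rewrite chernE.
have J0 q : U q -> veq q (J q (Dv c i q)) 0 by move=> Uq; exact: (J_Dv i (Uc Uq)).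
erewrite (K_vconn0 sY (sDv i) (vconn_zero eJ (sDv i) sY J0)).
erewrite (@time_comp_const (Dv c i) 0 Y (sDv i) sY).
  by rewrite scale0r add0r addr0.
by move=> q Uq; rewrite (DvE hM s i (Uc Uq)); rowE.
Qed.

Lemma chern_hor Y i : smooth_vfield U Y ->
  chern hM s Y (Xi s c i) p c = K p (vconn P Q J K J Y (Xi s c i) p) c.
Proof.
move=> sY; rewrite chernE.
have Q0 q : U q -> veq q (Q q (Xi s c i q)) 0 by move=> Uq; exact: (vpart_Xi i (Uc Uq)).
erewrite (vconn_zero eQ (sXi i) sY Q0).
erewrite (@time_comp_const (Xi s c i) 0 Y (sXi i) sY).
  by rewrite scale0r add0r add0r.
by move=> q Uq; rewrite (XiE hM s i (Uc Uq)); rowE.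
Qed.

Lemma chern_Xs Y : smooth_vfield U Y -> chern hM s Y (Xs s) p c = 0.
Proof.
move=> sY; rewrite chernE.
have Q0 q : U q -> veq q (Q q (Xs s q)) 0 by move=> Uq; exact: (vpart_Xs (Uc Uq)).
have J0 q : U q -> veq q (J q (Xs s q)) 0 by move=> Uq; exact: (J_Xs (Uc Uq)).
erewrite (vconn_zero eQ sXs sY Q0), (K_vconn0 sY sXs (vconn_zero eJ sXs sY J0)).
erewrite (@time_comp_const (Xs s) 1 Y sXs sY).
  by rewrite scale0r !addr0.
by move=> q Uq; rewrite XsE; rowE.
Qed.

End Eval.

Lemma chern_is_table : chern_table s (chern hM s).
Proof.
have o c : mopen B (dom B c) by exact: mopen_dom.
have JX c i q : dom B c q -> veq q (J q (Xi s c i q)) (Dv c i q) by exact: J_Xi.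
have QD c i q : dom B c q -> veq q (Q q (Dv c i q)) (Dv c i q) by exact: vpart_Dv.
split=> [U Y oU sY p c Up cp|c p i cp|c p i cp|c p i j cp|c p i j cp|c p i j cp|c p i j cp].
- have oU' := mopenI hB oU (o c).
  apply: (chern_Xs oU' (conj Up cp) cp) => [q []//|].
  by apply: vf_sub sY => q [].
- rewrite (chern_hor (@o c) cp cp (fun q h => h) i (Xs_vf hM s (@o c))).
  apply: (K_vconnE (@o c) cp cp (Xs_vf hM s (@o c)) (Xi_vf hM s c i)).
  exact: (vconn_Xs (@o c) cp cp (fun q h => h) eJ (Xi_vf hM s c i) (@JX c i)).
- rewrite (chern_vert (@o c) cp cp (fun q h => h) i (Xs_vf hM s (@o c))).
  exact: (vconn_Xs (@o c) cp cp (fun q h => h) eQ (Dv_vf hM s c i) (@QD c i)).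
- rewrite (chern_hor (@o c) cp cp (fun q h => h) i (Xi_vf hM s c j)).
  apply: (K_vconnE (@o c) cp cp (Xi_vf hM s c j) (Xi_vf hM s c i)).
  exact: (vconn_Xi (@o c) cp cp (fun q h => h) eJ (Xi_vf hM s c i) (@JX c i)).
- rewrite (chern_vert (@o c) cp cp (fun q h => h) i (Xi_vf hM s c j)).
  exact: (vconn_Xi (@o c) cp cp (fun q h => h) eQ (Dv_vf hM s c i) (@QD c i)).
- rewrite (chern_hor (@o c) cp cp (fun q h => h) i (Dv_vf hM s c j)).
  apply: (K_vconn0 (@o c) cp cp (Dv_vf hM s c j) (Xi_vf hM s c i)).
  exact: (vconn_Dv (@o c) cp cp (fun q h => h) eJ (Xi_vf hM s c i) (@JX c i)).
- rewrite (chern_vert (@o c) cp cp (fun q h => h) i (Dv_vf hM s c j)).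
  exact: (vconn_Dv (@o c) cp cp (fun q h => h) eQ (Dv_vf hM s c i) (@QD c i)).
Qed.

End Existence.

(** * Torsion *)

Section Torsion.
Variables (R : realType) (M : topologicalType) (n : nat) (A : atlas R M n).
Hypothesis hM : smooth_manifold A.
Variable s : sode A.
Let B := M1 A.
Let hB : regular_atlas B := M1_regular hM s.
Implicit Types (c e : idx B) (p q : jet A 1) (v : tvec B) (X Y : vfield B).
Implicit Types (U W : set (jet A 1)).
Local Notation ev i := (delta_mx 0 i : 'rV[R]_n).
Local Notation P := (hpart s).
Local Notation Q := (vpart s).
Local Notation J := (@Jtensor R M n A).
Local Notation K := (vert_to_hor s).
Let eP := hpart_endo hM s.
Let eQ := vpart_endo hM s.
Let eJ := J_endo hM s.
Let eK := vert_to_hor_endo hM s.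

Definition frame_family (V : Type) (x0 : V) (x1 x2 : 'I_n -> V) (a : 'I_(1 + (n + n))) : V :=
  match fintype.split a with
  | inl _ => x0
  | inr b => match fintype.split b with inl i => x1 i | inr i => x2 i end
  end.

Lemma frame_family_it V (x0 : V) x1 x2 : frame_family x0 x1 x2 (it n) = x0.
Proof. by rewrite /frame_family /it (unsplitK (inl _ ord0)). Qed.
Lemma frame_family_ix V (x0 : V) x1 x2 i : frame_family x0 x1 x2 (ix i) = x1 i.
Proof. by rewrite /frame_family /ix (unsplitK (inr _ (lshift n i))) (unsplitK (inl _ i)). Qed.
Lemma frame_family_iv V (x0 : V) x1 x2 i : frame_family x0 x1 x2 (iv i) = x2 i.
Proof. by rewrite /frame_family /iv (unsplitK (inr _ (rshift n i))) (unsplitK (inr _ i)). Qed.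

Definition sigma_frame c : 'I_(1 + (n + n)) -> vfield B := frame_family (Xs s) (Xi s c)
  (@Dv R M n A c).

Lemma sigma_frame_it c : sigma_frame c (it n) = Xs s. Proof. exact: frame_family_it. Qed.
Lemma sigma_frame_ix c i : sigma_frame c (ix i) = Xi s c i. Proof. exact: frame_family_ix. Qed.
Lemma sigma_frame_iv c i : sigma_frame c (iv i) = Dv c i. Proof. exact: frame_family_iv. Qed.

Lemma index_cases (a : 'I_(1 + (n + n))) :
  [\/ a = it n, exists i, a = ix i | exists i, a = iv i].
Proof.
rewrite -[a]splitK; case: (fintype.split a) => [b|b] /=.
  by constructor 1; rewrite (ord1 b).
rewrite -[b]splitK; case: (fintype.split b) => [i|i] /=.
  by constructor 2; exists i.
by constructor 3; exists i.
Qed.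

Lemma frame_family_ind V (Pr : V -> Prop) (x0 : V) x1 x2 : Pr x0 -> (forall i, Pr (x1 i)) ->
  (forall i, Pr (x2 i)) -> forall a, Pr (frame_family x0 x1 x2 a).
Proof.
move=> h0 h1 h2 a; have [->|[i ->]|[i ->]] := index_cases a.
- by rewrite frame_family_it.
- by rewrite frame_family_ix.
- by rewrite frame_family_iv.
Qed.

Lemma sigma_frame_ind c (Pr : vfield B -> Prop) : Pr (Xs s) -> (forall i, Pr (Xi s c i)) ->
  (forall i, Pr (Dv c i)) -> forall a, Pr (sigma_frame c a).
Proof. exact: frame_family_ind. Qed.

Lemma sigma_frame_vf c a : smooth_vfield (dom B c) (sigma_frame c a).
Proof.
apply: (sigma_frame_ind (Pr := smooth_vfield (dom B c))) => [|i|i].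
- exact: (Xs_vf hM s (mopen_dom hB (c := c))).
- exact: (Xi_vf hM).
- exact: (Dv_vf hM s).
Qed.

Definition frame_coef c q (w : 'rV[R]_(1 + (n + n))) : 'rV[R]_(1 + (n + n)) :=
  txv (tcoord w) (contact c q w) (vcoef s c q w).

Lemma frame_sum c q (r : 'rV[R]_(1 + (n + n))) : dom B c q ->
  \sum_a r 0 a *: sigma_frame c a q c = tcoord r *: Xs s q c + txv 0 (xcoord r)
    (hlift s c q (xcoord r)) + txv 0 0 (vcoord r).
Proof.
move=> cq; rewrite big_split_ord big_ord1 big_split_ord /= addrA.
congr (_ + _ + _).
- by rewrite -[lshift _ _]/(it n) sigma_frame_it tcoord.unlock mxE.
- rewrite -(XiSum hM s (xcoord r) cq); apply: eq_bigr => i _.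
  by rewrite -[rshift _ _]/(ix i) sigma_frame_ix xcoord.unlock !mxE.
- rewrite -(DvSum hM s cq (vcoord r)); apply: eq_bigr => i _.
  by rewrite -[rshift _ _]/(iv i) sigma_frame_iv vcoord.unlock !mxE.
Qed.

Lemma frame_coefP c q (w : 'rV[R]_(1 + (n + n))) : dom B c q ->
  w = \sum_a frame_coef c q w 0 a *: sigma_frame c a q c.
Proof.
move=> cq; rewrite frame_sum // /frame_coef XsE; rowE.
apply: row_ext; rowE; rewrite ?mulr1 ?addr0 //.
  by rewrite /contact addrC subrK.
by rewrite /vcoef; generalize (hlift s c q (contact c q w)) => a; apply/rowP => j; rewrite !mxE;
  ring.
Qed.

Lemma frame_coef_smooth c U X a : mopen B U -> smooth_vfield U X ->
  csmooth (A := B) c U (fun q => frame_coef c q (X q c) 0 a).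
Proof.
move=> oU sX; have sw := vf_csmooth c sX.
have sm : csmooth (A := B) c U (fun q => frame_coef c q (X q c)).
  exact: (csmooth_txv hM s oU (csmooth_lin hB oU (@tcoord R n) sw) (contact_smooth hM s oU sw)
    (vcoef_smooth hM s oU sw)).
exact: (csmooth_lin hB oU (entry a) sm).
Qed.

Lemma tensorial_frame W Phi c X p : tensorial (A := B) W Phi -> mopen B W -> W p ->
  dom B c p -> smooth_vfield W X ->
  Phi X p c = \sum_a frame_coef c p (X p c) 0 a *: Phi (sigma_frame c a) p c.
Proof.
move=> tP oW Wp cp sX.
have oW' := mopenI hB oW (mopen_dom hB (c := c)).
have sX' : smooth_vfield (W `&` dom B c) X by apply: vf_sub sX => q [].
apply: (tensorial_expand hB (E := sigma_frame c) (x := fun a q => frame_coef c q (X q c) 0 a)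
  tP oW Wp cp _ _ sX).
- by move=> a; exact: frame_coef_smooth.
- by move=> a; apply: (vf_sub _ (sigma_frame_vf c a)) => q [].
- by move=> q _ cq; exact: frame_coefP.
Qed.

Lemma tensorial_zero W Phi c X p : tensorial (A := B) W Phi -> mopen B W -> W p ->
  dom B c p -> smooth_vfield W X -> (forall a, Phi (sigma_frame c a) p c = 0) -> Phi X p c = 0.
Proof.
move=> tP oW Wp cp sX P0; rewrite (tensorial_frame tP oW Wp cp sX).
by rewrite big1 // => a _; rewrite P0 scaler0.
Qed.

(** The difference of two connections is tensorial in both arguments; it
    vanishes as soon as it does on the induced frame. *)
Lemma table_unique (D D' : linear_connection B) : chern_table s D -> chern_table s D' ->
  conn_eq D D'.
Proof.
move=> ct ct' U Y X oU sY sX p Up c cp.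
pose W := U `&` dom B c.
have oc : mopen B (dom B c) := mopen_dom hB (c := c).
have oW : mopen B W := mopenI hB oU oc.
have Wp : W p by [].
have WU : W `<=` U by move=> q [].
have Wc : W `<=` dom B c by move=> q [].
have sYW := vf_sub WU sY; have sXW := vf_sub WU sX.
have E a b : D (sigma_frame c b) (sigma_frame c a) p c = D' (sigma_frame c b) (sigma_frame c a) p c.
  apply: (sigma_frame_ind (Pr := fun E => D (sigma_frame c b) E p c = D' (sigma_frame c b)
    E p c)) => [|i|i].
  - exact: (etrans (ct_Xs ct oc (sigma_frame_vf c b) cp cp) (esym (ct_Xs ct' oc (sigma_frame_vf c
    b) cp cp))).
  - apply: (sigma_frame_ind (Pr := fun E => D E (Xi s c i) p c = D' E (Xi s c i) p c)) => [|j|j].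
    + exact: (etrans (ct_Xs_Xi ct i cp) (esym (ct_Xs_Xi ct' i cp))).
    + exact: (etrans (ct_Xi_Xi ct i j cp) (esym (ct_Xi_Xi ct' i j cp))).
    + exact: (etrans (ct_Dv_Xi ct i j cp) (esym (ct_Dv_Xi ct' i j cp))).
  - apply: (sigma_frame_ind (Pr := fun E => D E (Dv c i) p c = D' E (Dv c i) p c)) => [|j|j].
    + exact: (etrans (ct_Xs_Dv ct i cp) (esym (ct_Xs_Dv ct' i cp))).
    + exact: (etrans (ct_Xi_Dv ct i j cp) (esym (ct_Xi_Dv ct' i j cp))).
    + exact: (etrans (ct_Dv_Dv ct i j cp) (esym (ct_Dv_Dv ct' i j cp))).
have H a : D Y (sigma_frame c a) p c - D' Y (sigma_frame c a) p c = 0.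
  have sa := vf_sub Wc (sigma_frame_vf c a).
  have tB := tensorialB (cov_tensorial D sa) (cov_tensorial D' sa).
  apply: (tensorial_zero tB oW Wp cp sYW) => b.
  by apply/eqP; rewrite subr_eq0; apply/eqP; exact: E.
apply/eqP; rewrite -subr_eq0; apply/eqP.
exact: (tensorial_zero (cov_diff_tensorial D D' sYW) oW Wp cp sXW H).
Qed.

Lemma tensorial_endo W L Phi : endo (A := B) L -> tensorial (A := B) W Phi ->
  (forall U X, mopen B U -> U `<=` W -> smooth_vfield U X -> smooth_vfield U (Phi X)) ->
  tensorial (A := B) W (fun X p => L p (Phi X p)).
Proof.
move=> eL tP sP U oU UW; have [l a m] := tP U oU UW.
have tv X p : smooth_vfield U X -> U p -> is_tvec p (Phi X p).
  by move=> sX Up; exact: (vf_tvec (sP U X oU UW sX) Up).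
split=> [X X' sX sX' XX p c Up cp|X X' sX sX' p c Up cp|f X sf sX p c Up cp].
- exact: (endo_eq eL cp (tv _ _ sX Up) (tv _ _ sX' Up) (l _ _ sX sX' XX p c Up cp)).
- have sXX := vfD hB oU sX sX'.
  rewrite -[L p (Phi X p) c]scale1r.
  apply: (endo_comb eL cp (tv _ _ sX Up) (tv _ _ sXX Up) (tv _ _ sX' Up)).
  by rewrite scale1r a.
- have sfX := vfZ hB oU sf sX; have t0 := @is_tvec0 _ _ _ B p.
  have := endo_comb eL (a := f p) cp (tv _ _ sX Up) (tv _ _ sfX Up) t0.
  by rewrite (endo_zero eL cp t0) // !addr0; apply; exact: m.
Qed.

Lemma HLJE Y p : HLJ s Y p = K p (lie_endo (Xs s) J Y p).
Proof. by []. Qed.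

Lemma HLJ_tensorial W : mopen B W -> tensorial (A := B) W (HLJ s).
Proof.
move=> oW; apply: (tensorial_endo eK (lie_tensorial hB eJ (Xs_vf hM s oW))).
move=> U X oU UW sX; exact: (lie_vf hB oU eJ (Xs_vf hM s oU) sX).
Qed.

Lemma TsE X Y p c : is_tvec p (X p) -> is_tvec p (Y p) -> dom B c p ->
  Ts s X Y p c = - twisted Q P P X Y p c +
    (tcoord (X p c) *: HLJ s Y p c - tcoord (Y p c) *: HLJ s X p c).
Proof.
move=> tX tY cp; rewrite -(dtE hM s tX cp) -(dtE hM s tY cp).
by rewrite twisted.unlock lbracket.unlock.
Qed.

Lemma twisted_anti L a U X Y p c : endo (A := B) L -> endo (A := B) a -> mopen B U -> U p ->
  dom B c p -> smooth_vfield U X -> smooth_vfield U Y ->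
  twisted L a a X Y p c = - twisted L a a Y X p c.
Proof.
move=> eL ea oU Up cp sX sY; rewrite twisted.unlock -scaleN1r.
have t0 := @is_tvec0 _ _ _ B p.
have := endo_comb eL (a := -1) cp (lbracket_endo_tvec hB ea ea oU Up sY sX)
  (lbracket_endo_tvec hB ea ea oU Up sX sY) t0.
rewrite (endo_zero eL cp t0) // !addr0; apply.
by rewrite scaleN1r lbracket_anti.
Qed.

Lemma Ts_anti U X Y p c : mopen B U -> U p -> dom B c p ->
  smooth_vfield U X -> smooth_vfield U Y -> Ts s X Y p c = - Ts s Y X p c.
Proof.
move=> oU Up cp sX sY; have tX := vf_tvec sX Up; have tY := vf_tvec sY Up.
rewrite (TsE tX tY cp) (TsE tY tX cp) (twisted_anti eQ eP oU Up cp sX sY).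
move: (twisted _ _ _ Y X p c) (HLJ s Y p c) (HLJ s X p c) (tcoord (X p c)) (tcoord (Y p c)).
by move=> a1 a2 a3 a4 a5; apply/rowP => j; rewrite !mxE; ring.
Qed.

(** The derivative of f in the curvature term is a multiple of Q (P Y) = 0. *)
Lemma Ts_tensorial W X : mopen B W -> smooth_vfield W X -> tensorial (A := B) W (Ts s X).
Proof.
move=> oW sXW U oU UW; have sX := vf_sub UW sXW.
have [l a m] := HLJ_tensorial oW oU UW.
split=> [Y Y' sY sY' YY p c Up cp|Y Y' sY sY' p c Up cp|f Y sf sY p c Up cp];
  have tX := vf_tvec sX Up; have tY := vf_tvec sY Up.
- have tY' := vf_tvec sY' Up.
  rewrite (TsE tX tY cp) (TsE tX tY' cp).
  have E1 := twisted_local hB eQ eP eP oU sX sX sY sY' (fun q _ e eq => erefl) YY Up cp.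
  have E2 := l _ _ sY sY' YY p c Up cp; have E3 := YY p Up c cp.
  by move: E1 E2 E3 => -> -> ->.
- have tY' := vf_tvec sY' Up; have tYY := vf_tvec (vfD hB oU sY sY') Up.
  rewrite (TsE tX tYY cp) (TsE tX tY cp) (TsE tX tY' cp).
  have E1 := twisted_addr hB eQ eP eP oU sX sY sY' Up cp.
  have E2 := a _ _ sY sY' p c Up cp.
  have E3 : tcoord ((Y p + Y' p) c) = tcoord (Y p c) + tcoord (Y' p c) by rewrite tvaddE; rowE.
  move: E1 E2 E3 => -> -> ->.
  generalize (HLJ s Y p c) (HLJ s Y' p c) (HLJ s X p c) => a3 a4 a5.
  move: (twisted _ _ _ X Y p c) (twisted _ _ _ X Y' p c) (tcoord (X p c)) (tcoord (Y p c))
    (tcoord (Y' p c)) => a1 a2 a6 a7 a8.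
  by apply/rowP => j; rewrite !mxE; ring.
- have tfY := vf_tvec (vfZ hB oU sf sY) Up.
  rewrite (TsE tX tfY cp) (TsE tX tY cp).
  have E1 := twisted_scaler hB eQ eP eP oU sf sX sY Up cp.
  have E0 := vpart_hpart hM s cp tY.
  have E2 := m _ _ sf sY p c Up cp.
  have E3 : tcoord ((f p *: Y p) c) = f p * tcoord (Y p c) by rewrite tvscaleE; rowE.
  move: E1 E2 E3; rewrite E0 scaler0 addr0 => -> -> ->.
  move: (twisted _ _ _ X Y p c) (HLJ s Y p c) (HLJ s X p c) (tcoord (X p c)) (tcoord (Y p c)) (f p).
  by move=> a1 a2 a3 a4 a5 a6; apply/rowP => j; rewrite !mxE; ring.
Qed.

Section FrameTorsion.
Variables (c : idx B) (p : jet A 1).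
Hypothesis cp : dom B c p.
Let oc : mopen B (dom B c) := mopen_dom hB (c := c).
Let sX0 := Xs_vf hM s oc.
Let sXi := Xi_vf hM s c.
Let sDv := Dv_vf hM s c.

Lemma HLJ_val Y : smooth_vfield (dom B c) Y ->
  HLJ s Y p c = txv 0 (vcoord (Y p c) - tcoord (Y p c) *: F s c p - hlift s c p (contact c p (Y p
    c)))
    (hlift s c p (vcoord (Y p c) - tcoord (Y p c) *: F s c p - hlift s c p (contact c p (Y p c)))).
Proof.
move=> sY; rewrite HLJE.
have tL := vf_tvec (lie_vf hB oc eJ sX0 sY) cp.
rewrite (vert_to_horE hM s tL cp) (lieJ hM s oc cp cp sY).
set b := contact c p (Y p c); set r := vcoord (Y p c) - _ *: _.
have -> : vcoef s c p (txv 0 (- b) (r - 2 *: hlift s c p b)) = r - hlift s c p b.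
  rewrite vcoef_txv !scale0r subr0 add0r (hliftN hM s _ cp).
  by generalize (hlift s c p b) r => a1 a2; apply/rowP => j; rewrite !mxE; ring.
by [].
Qed.

Lemma HLJ_Xi i : HLJ s (Xi s c i) p c = 0.
Proof.
rewrite (HLJ_val (sXi i)) (XiE hM s i cp) contact_txv; rowE.
by rewrite !scale0r !subr0 subrr hlift0 txv0.
Qed.

Lemma HLJ_Dv i : HLJ s (Dv c i) p c = txv 0 (ev i) (hlift s c p (ev i)).
Proof.
rewrite (HLJ_val (sDv i)) (DvE hM s i cp) contact_txv; rowE.
by rewrite !scale0r !subr0 hlift0 subr0.
Qed.

Lemma Ts_val X Y X' Y' r : smooth_vfield (dom B c) X -> smooth_vfield (dom B c) Y ->
  smooth_vfield (dom B c) X' -> smooth_vfield (dom B c) Y' ->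
  (forall q, dom B c q -> veq q (P q (X q)) (X' q)) ->
  (forall q, dom B c q -> veq q (P q (Y q)) (Y' q)) ->
  lbracket X' Y' p c = r ->
  Ts s X Y p c = - txv 0 0 (vcoef s c p r) +
    (tcoord (X p c) *: HLJ s Y p c - tcoord (Y p c) *: HLJ s X p c).
Proof.
move=> sX sY sX' sY' XX YY br_r.
rewrite (TsE (vf_tvec sX cp) (vf_tvec sY cp) cp).
have E := twisted_eval hM s oc cp cp eQ eP eP sX sY sX' sY' XX YY.
have tb := lbracket_tvec hB oc cp sX' sY'.
by rewrite (etrans E (vpart_val hM s tb cp br_r)).
Qed.

Variable D : linear_connection B.
Hypothesis ct : chern_table s D.

Let hpart_Xs' q : dom B c q -> veq q (P q (Xs s q)) (Xs s q). Proof. exact: hpart_Xs. Qed.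
Let hpart_Xi' i q : dom B c q -> veq q (P q (Xi s c i q)) (Xi s c i q). Proof. exact: hpart_Xi. Qed.
Let hpart_Dv' i q : dom B c q -> veq q (P q (Dv c i q)) ((fun=> 0 : tvec B) q). Proof.
exact: hpart_Dv. Qed.
Let s0 : smooth_vfield (dom B c) (fun=> 0 : tvec B) := vf0 hB oc.
Let z0 : vcoef s c p 0 = 0.
Proof. by rewrite -[X in vcoef _ _ _ X]txv0 vcoef_vert. Qed.

(** Both torsions of a pair of fields become explicit rows once the
    horizontal parts X' and Y' are known as fields near p; it remains to
    compare the rows. *)
Lemma tors_eq X Y X' Y' a b r r' hx hy tx ty :
  smooth_vfield (dom B c) X -> smooth_vfield (dom B c) Y ->
  smooth_vfield (dom B c) X' -> smooth_vfield (dom B c) Y' ->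
  (forall q, dom B c q -> veq q (P q (X q)) (X' q)) ->
  (forall q, dom B c q -> veq q (P q (Y q)) (Y' q)) ->
  D X Y p c = a -> D Y X p c = b -> lbracket X Y p c = r -> lbracket X' Y' p c = r' ->
  HLJ s X p c = hx -> HLJ s Y p c = hy -> tcoord (X p c) = tx -> tcoord (Y p c) = ty ->
  a - b - r = - txv 0 0 (vcoef s c p r') + (tx *: hy - ty *: hx) ->
  torsion D X Y p c = Ts s X Y p c.
Proof.
move=> sX sY sX' sY' XX YY <- <- <- Er <- <- <- <- E.
apply: etrans (torsionE D X Y p c) (etrans E _); apply: esym.
exact: (Ts_val sX sY sX' sY' XX YY Er).
Qed.

Let t_Xs : tcoord (Xs s p c) = 1. Proof. by rewrite XsE; rowE. Qed.
Let t_Xi i : tcoord (Xi s c i p c) = 0. Proof. by rewrite (XiE hM s i cp); rowE. Qed.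
Let t_Dv i : tcoord (Dv c i p c) = 0. Proof. by rewrite (DvE hM s i cp); rowE. Qed.

Lemma HLJ_Xs : HLJ s (Xs s) p c = 0.
Proof.
rewrite (HLJ_val sX0) XsE contact_txv; rowE.
by rewrite !scale1r !subrr hlift0 subrr hlift0 txv0.
Qed.

Lemma tors_Xs_Xi i : torsion D (Xs s) (Xi s c i) p c = Ts s (Xs s) (Xi s c i) p c.
Proof.
apply: (tors_eq sX0 (sXi i) sX0 (sXi i) hpart_Xs' (@hpart_Xi' i) (ct_Xs_Xi ct i cp)
  (ct_Xs ct oc (sXi i) cp cp) (lbracket_Xs_Xi hM s cp i) (lbracket_Xs_Xi hM s cp i)
  HLJ_Xs (HLJ_Xi i) t_Xs (t_Xi i)).
generalize (vcoord (lbracket (Xs s : vfield B) (Xi s c i) p c)) => b.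
rewrite vcoef_txv !scaler0 !scale0r !subr0 addr0 add0r (hliftN hM s _ cp).
generalize (hlift s c p (ev i)) => h; generalize (hlift s c p h) => k.
apply: row_ext; rowE; rewrite ?subr0 ?oppr0 //.
  by rewrite opprK addNr.
by apply/rowP => j; rewrite !mxE; ring.
Qed.

Lemma tors_Xs_Dv i : torsion D (Xs s) (Dv c i) p c = Ts s (Xs s) (Dv c i) p c.
Proof.
apply: (tors_eq sX0 (sDv i) sX0 s0 hpart_Xs' (@hpart_Dv' i) (ct_Xs_Dv ct i cp)
  (ct_Xs ct oc (sDv i) cp cp) (lbracket_Xs_Dv hM s cp i) (lbracket_0r hM s _ cp)
  HLJ_Xs (HLJ_Dv i) t_Xs (t_Dv i)).
rewrite z0 txv0 oppr0 add0r scale1r scale0r !subr0 opprK.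
generalize (hlift s c p (ev i)) => h.
apply: row_ext; rowE; rewrite ?oppr0 ?add0r //.
by apply/rowP => j; rewrite !mxE; ring.
Qed.

Lemma tors_Xi_Xi i j : torsion D (Xi s c i) (Xi s c j) p c = Ts s (Xi s c i) (Xi s c j) p c.
Proof.
have H := ct_Xi_Xi ct i j cp; rewrite (dhlift_sym hM s cp i j) in H.
apply: (tors_eq (sXi i) (sXi j) (sXi i) (sXi j) (@hpart_Xi' i) (@hpart_Xi' j) (ct_Xi_Xi ct j i cp)
  H (lbracket_Xi_Xi hM s cp i j) (lbracket_Xi_Xi hM s cp i j)
  (HLJ_Xi i) (HLJ_Xi j) (t_Xi i) (t_Xi j)).
by rewrite subrr vcoef_vert !scaler0 subr0 addr0 sub0r.
Qed.

Lemma tors_Xi_Dv i j : torsion D (Xi s c i) (Dv c j) p c = Ts s (Xi s c i) (Dv c j) p c.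
Proof.
apply: (tors_eq (sXi i) (sDv j) (sXi i) s0 (@hpart_Xi' i) (@hpart_Dv' j) (ct_Xi_Dv ct j i cp)
  (ct_Dv_Xi ct i j cp) (lbracket_Xi_Dv hM s cp i j) (lbracket_0r hM s _ cp)
  (HLJ_Xi i) (HLJ_Dv j) (t_Xi i) (t_Dv j)).
by rewrite z0 txv0; apply/rowP => k; rewrite !mxE; ring.
Qed.

Lemma tors_Dv_Dv i j : torsion D (Dv c i) (Dv c j) p c = Ts s (Dv c i) (Dv c j) p c.
Proof.
apply: (tors_eq (sDv i) (sDv j) s0 s0 (@hpart_Dv' i) (@hpart_Dv' j) (ct_Dv_Dv ct j i cp)
  (ct_Dv_Dv ct i j cp) (lbracket_Dv_Dv hM s cp i j) (lbracket_0r hM s _ cp)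
  (HLJ_Dv i) (HLJ_Dv j) (t_Dv i) (t_Dv j)).
by rewrite z0 txv0; apply/rowP => k; rewrite !mxE; ring.
Qed.

Lemma tors_Xs_Xs : torsion D (Xs s) (Xs s) p c = Ts s (Xs s) (Xs s) p c.
Proof.
have H (r : 'rV[R]_(1 + (n + n))) : r = - r -> r = 0.
  move=> E; apply/rowP => j; have := congr1 (fun m : 'rV[R]_(1 + (n + n)) => m 0 j) E.
  by rewrite !mxE; lra.
rewrite (H _ (torsion_anti D _ _ p c)).
by rewrite (H _ (Ts_anti oc cp cp sX0 sX0)).
Qed.

Lemma tors_frame a b : torsion D (sigma_frame c a) (sigma_frame c b) p c = Ts s (sigma_frame c a)
  (sigma_frame c b) p c.
Proof.
have anti X Y : smooth_vfield (dom B c) X -> smooth_vfield (dom B c) Y ->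
    torsion D X Y p c = Ts s X Y p c -> torsion D Y X p c = Ts s Y X p c.
  move=> sX sY E; apply: etrans (torsion_anti D Y X p c) _.
  apply: etrans (congr1 (fun r : 'rV[R]_(1 + (n + n)) => - r) E) _.
  exact: esym (Ts_anti oc cp cp sY sX).
apply: (sigma_frame_ind (Pr := fun E => torsion D E (sigma_frame c b)
  p c = Ts s E (sigma_frame c b) p c)) => [|i|i].
- apply: (sigma_frame_ind (Pr := fun E => torsion D (Xs s) E p c = Ts s (Xs s) E p c)) => [|j|j].
  + exact: tors_Xs_Xs.
  + exact: tors_Xs_Xi.
  + exact: tors_Xs_Dv.
- apply: (sigma_frame_ind (Pr := fun E => torsion D (Xi s c i) E p c = Ts s (Xi s c i) E p c))
  => [|j|j].
  + exact: (anti _ _ sX0 (sXi i) (tors_Xs_Xi i)).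
  + exact: tors_Xi_Xi.
  + exact: tors_Xi_Dv.
- apply: (sigma_frame_ind (Pr := fun E => torsion D (Dv c i) E p c = Ts s (Dv c i) E p c))
  => [|j|j].
  + exact: (anti _ _ sX0 (sDv i) (tors_Xs_Dv i)).
  + exact: (anti _ _ (sXi j) (sDv i) (tors_Xi_Dv j i)).
  + exact: tors_Dv_Dv.
Qed.

End FrameTorsion.

(** Both sides are tensorial in each argument, so they need only be compared
    on pairs of fields of the induced frame. *)
Lemma table_torsion (D : linear_connection B) : chern_table s D -> has_torsion_Ts s D.
Proof.
move=> ct U X Y oU sX sY p Up c cp.
pose W := U `&` dom B c.
have oc : mopen B (dom B c) := mopen_dom hB (c := c).
have oW : mopen B W := mopenI hB oU oc.
have Wp : W p by [].
have WU : W `<=` U by move=> q [].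
have Wc : W `<=` dom B c by move=> q [].
have sYW := vf_sub WU sY; have sXW := vf_sub WU sX.
have tD Z (sZ : smooth_vfield W Z) :=
  tensorialB (torsion_tensorial hB D sZ) (Ts_tensorial oW sZ).
have E (r t : 'rV[R]_(1 + (n + n))) : r - t = 0 -> r = t by move/eqP; rewrite subr_eq0 => /eqP.
have H a : torsion D (sigma_frame c a) X p c = Ts s (sigma_frame c a) X p c.
  apply: E; apply: (tensorial_zero (tD _ (vf_sub Wc (sigma_frame_vf c a))) oW Wp cp sXW) => b.
  exact: (etrans (congr1 (fun r => r - _) (tors_frame cp ct a b)) (subrr _)).
apply: E; apply: (tensorial_zero (tD _ sXW) oW Wp cp sYW) => b.
have H1 := etrans (torsion_anti D X (sigma_frame c b) p c) (congr1 (fun r => - r) (H b)).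
have H2 := etrans H1 (esym (Ts_anti oW Wp cp sXW (vf_sub Wc (sigma_frame_vf c b)))).
exact: (etrans (congr1 (fun r => r - _) H2) (subrr _)).
Qed.

End Torsion.

(** * Adapted frames and reducibility *)

Section Nonvanishing.
Variables (R : realType) (T : Type) (d : nat) (A : atlas R T d).
Hypothesis hA : regular_atlas A.

Lemma mopen_nz W (f : T -> R) : mopen A W -> smooth_fun A W f ->
  mopen A (W `&` [set q | f q != 0]).
Proof.
move=> oW sf c; rewrite openE => _ [p [cp [Wp /= fp]] <-].
have oI : open (chart_image (A := A) c W) := oW c.
have Ip : chart_image c W (coord A c p) := chart_imageP cp Wp.
have cf : {for coord A c p, continuous (rep c f)}.
  exact: (differentiable_continuous (csmooth_cdiff (sf c) cp Wp)).
have nz : rep c f (coord A c p) != 0 by rewrite (repE hA).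
have onz : open [set x : R | x != 0].
  have -> : [set x : R | x != 0] = ~` [set 0].
    by apply/seteqP; split=> x /= /eqP.
  by apply: closed_openC; exact: closed_eq.
have N1 : nbhs (coord A c p) (rep c f @^-1` [set x : R | x != 0]).
  by apply: cf; apply: open_nbhs_nbhs.
have N2 : nbhs (coord A c p) (chart_image (A := A) c W) by apply: open_nbhs_nbhs.
rewrite /interior; apply: filterS (filterI N1 N2) => y [/= ny [q [cq Wq] Ey]].
exists q => //; split=> //; split=> //=.
by move: ny; rewrite -Ey (repE hA).
Qed.

Lemma csmooth_prod c U I (r : seq I) (F : I -> T -> R) : mopen A U ->
  (forall i, csmooth (A := A) c U (F i)) -> csmooth (A := A) c U (fun q => \prod_(i <- r) F i q).
Proof.
move=> oU sF; elim: r => [|i r IH].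
  apply: (csmooth_eq hA oU (f := fun=> 1 : R)); last exact: (csmooth_cst hA).
  by move=> q _ _; rewrite big_nil.
apply: (csmooth_eq hA oU (f := fun q => F i q *: \prod_(j <- r) F j q)).
  by move=> q _ _; rewrite big_cons.
exact: (csmoothZ hA oU (sF i) IH).
Qed.

Lemma csmooth_det c U m (Mx : T -> 'M[R]_m) : mopen A U ->
  (forall i j, csmooth (A := A) c U (fun q => Mx q i j)) -> csmooth (A :=
    A) c U (fun q => \det (Mx q)).
Proof.
move=> oU sM.
apply: (csmooth_eq hA oU (f := fun q => \sum_(s : 'S_m) (-1) ^+ s *: \prod_i Mx q i (s i))).
  by move=> q _ _; rewrite /determinant; apply: eq_bigr.
apply: (csmooth_sum hA oU) => s.
apply: (csmoothZ hA oU); first exact: (csmooth_cst hA).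
by apply: csmooth_prod => // i; exact: sM.
Qed.

End Nonvanishing.

Section Reduction.
Variables (R : realType) (M : topologicalType) (n : nat) (A : atlas R M n).
Hypothesis hM : smooth_manifold A.
Variable s : sode A.
Let B := M1 A.
Let hB : regular_atlas B := M1_regular hM s.
Implicit Types (c e : idx B) (p q : jet A 1) (v : tvec B) (X Y : vfield B).
Implicit Types (U W : set (jet A 1)).
Local Notation ev i := (delta_mx 0 i : 'rV[R]_n).
Local Notation Q := (vpart s).
Local Notation K := (vert_to_hor s).

Lemma vertical_chart c q v b : is_tvec q v -> dom B c q -> v c = txv 0 0 b -> vertical q v.
Proof.
move=> tv cq vE.
have QV : veq q (Q q v) v.
  by apply: (tvec_eq (vpart_tvec hM s tv) tv cq); rewrite (vpart_val hM s tv cq vE) vE vcoef_vert.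
apply: (verticalI hM s tv) => e eq.
by rewrite -(QV e eq) (vpart_coef hM s tv eq); split; rowE.
Qed.

Lemma Heps_vert_to_hor q v : is_tvec q v -> vertical q v -> veq q (Heps s q v) (K q v).
Proof.
move=> tv vert e eq; have [t0 x0] := verticalE hM s tv vert eq.
rewrite (HepsE hM s v eq) (vert_to_horE hM s tv eq).
have -> : vcoef s e q (v e) = vcoord (v e).
  by rewrite {1}[v e]txv_eta t0 x0 vcoef_vert.
by [].
Qed.

Lemma mulmx_rows m (x : 'rV[R]_m) (r : 'I_m -> 'rV[R]_n) :
  x *m (\matrix_i r i) = \sum_i x 0 i *: r i.
Proof.
apply/rowP => j; rewrite !mxE summxE; apply: eq_bigr => i _.
by rewrite !mxE.
Qed.

Lemma unitmx_inj m (Mx : 'M[R]_m) :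
  (forall x : 'rV[R]_m, x *m Mx = 0 -> x = 0) <-> Mx \in unitmx.
Proof.
split=> [H|uM x xM]; first by rewrite -row_free_unit; apply: inj_row_free.
by rewrite -(mulmxK uM x) xM mul0mx.
Qed.

(** Relatively to the induced frame, u has the matrix diag(1, Lambda,
    Lambda), where Lambda has the rows lam i. *)
Lemma frame_comb c q (u : 'I_(1 + (n + n)) -> tvec B) (lam : 'I_n -> 'rV[R]_n)
    (x : 'rV[R]_(1 + (n + n))) : dom B c q -> u (it n) c = Xs s q c ->
  (forall i, u (ix i) c = txv 0 (lam i) (hlift s c q (lam i))) ->
  (forall i, u (iv i) c = txv 0 0 (lam i)) ->
  \sum_a x 0 a *: u a c = txv (tcoord x)
    (tcoord x *: jcoord c 1 q + xcoord x *m \matrix_i lam i)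
    (tcoord x *: F s c q + hlift s c q (xcoord x *m \matrix_i lam i) + vcoord x *m \matrix_i lam i).
Proof.
move=> cq u0 ux uv; rewrite big_split_ord big_ord1 big_split_ord /=.
have E1 : \sum_(i < n) x 0 (rshift 1 (lshift n i)) *: u (rshift 1 (lshift n i)) c =
    txv 0 (xcoord x *m \matrix_i lam i) (hlift s c q (xcoord x *m \matrix_i lam i)).
  rewrite -(XiSum hM s _ cq) mulmx_rows.
  rewrite (eq_bigr (fun i => \sum_j (xcoord x 0 i * lam i 0 j) *: Xi s c j q c)); last first.
    move=> i _; rewrite -[rshift _ _]/(ix i) ux -(XiSum hM s _ cq) scaler_sumr.
    by apply: eq_bigr => j _; rewrite scalerA xcoord.unlock !mxE.
  rewrite exchange_big; apply: eq_bigr => j _; rewrite summxE scaler_suml.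
  by apply: eq_bigr => i _; rewrite mxE.
have E2 : \sum_(i < n) x 0 (rshift 1 (rshift n i)) *: u (rshift 1 (rshift n i)) c =
    txv 0 0 (vcoord x *m \matrix_i lam i).
  rewrite mulmx_rows -[RHS]/(insv _) linear_sum; apply: eq_bigr => i _.
  by rewrite -[rshift _ _]/(iv i) uv linearZ vcoord.unlock !mxE.
rewrite E1 E2 -[lshift _ _]/(it n) u0 XsE.
have -> : x 0 (it n) = tcoord x by rewrite tcoord.unlock mxE.
by apply: row_ext; rowE; rewrite ?mulr1 ?addr0 // addrA.
Qed.

(** With [adapted_rows]: the frames adapted to sigma at q are the images of
    the induced frame under the matrices diag(1, Lambda, Lambda) with Lambda
    invertible. *)
Lemma adapted_of_rows c q (u : frame B) (lam : 'I_n -> 'rV[R]_n) : dom B c q ->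
  (forall a, is_tvec q (u a)) -> u (it n) c = Xs s q c ->
  (forall i, u (ix i) c = txv 0 (lam i) (hlift s c q (lam i))) ->
  (forall i, u (iv i) c = txv 0 0 (lam i)) ->
  \matrix_i lam i \in unitmx -> adapted s q u.
Proof.
move=> cq tu u0 ux uv ul.
have vert i : vertical q (u (iv i)) by exact: (vertical_chart (tu _) cq (uv i)).
split=> [|||i].
- split=> // e eq; apply/unitmx_inj => x x0.
  have tw : is_tvec q (\sum_a x 0 a *: u a) by apply: (is_tvec_sum hM s) => a; exact: (is_tvecZ hB).
  have w0 : (\sum_a x 0 a *: u a) e = (0 : tvec B) e.
    rewrite tvsumE -[RHS]/(0 : 'rV[R]_(1 + (n + n))) -[RHS]x0.
    apply/rowP => j; rewrite !mxE summxE; apply: eq_bigr => a _.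
    by rewrite !mxE.
  have := tvec_eq tw (@is_tvec0 _ _ _ B q) eq w0 cq.
  rewrite tvsumE (eq_bigr (fun a => x 0 a *: u a c)) // (frame_comb x cq u0 ux uv) tvzeroE => E.
  have z (b : 'rV[R]_n) : b *m \matrix_i lam i = 0 -> b = 0 by move/unitmx_inj: ul => /(_ b).
  have t0 : tcoord x = 0 by have := congr1 (@tcoord R n) E; rowE.
  have xcoord0 : xcoord x = 0.
    have := congr1 (@xcoord R n) E; rowE; rewrite t0 scale0r add0r; exact: z.
  have vcoord0 : vcoord x = 0.
    have := congr1 (@vcoord R n) E; rowE.
    by rewrite t0 xcoord0 mul0mx scale0r add0r hlift0 add0r; exact: z.
  by apply: row_ext; rowE.
- exact: (tvec_eq (tu _) (Xs_tvec hM s (p := q)) cq u0).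
- exact: vert.
- have tK := vert_to_hor_tvec hM s (tu (iv i)).
  have E : veq q (u (ix i)) (K q (u (iv i))).
    apply: (tvec_eq (tu _) tK cq).
    by rewrite (vert_to_horE hM s (tu (iv i)) cq) uv vcoef_vert.
  by move=> e eq; rewrite (E e eq) (Heps_vert_to_hor (tu _) (vert i) eq).
Qed.

Lemma adapted_rows c q (u : frame B) : adapted s q u -> dom B c q ->
  exists lam : 'I_n -> 'rV[R]_n,
  [/\ forall i, u (ix i) c = txv 0 (lam i) (hlift s c q (lam i)),
      forall i, u (iv i) c = txv 0 0 (lam i) & \matrix_i lam i \in unitmx].
Proof.
move=> [[tu uu] u0 vert hor] cq; exists (fun i => vcoord (u (iv i) c)).
have uv i : u (iv i) c = txv 0 0 (vcoord (u (iv i) c)).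
  by have [t0 x0] := verticalE hM s (tu _) (vert i) cq; rewrite {1}[u (iv i) c]txv_eta t0 x0.
have ux i : u (ix i) c = txv 0 (vcoord (u (iv i) c)) (hlift s c q (vcoord (u (iv i) c))).
  by rewrite (hor i c cq) (HepsE hM s _ cq).
split=> //; apply/unitmx_inj => y y0.
move/unitmx_inj: (uu c cq) => /(_ (txv 0 0 y)) H.
suff E : txv 0 0 y = 0 :> 'rV[R]_(1 + (n + n)).
  by have := congr1 (@vcoord R n) E; rowE.
apply: H; transitivity (\sum_a txv 0 0 y 0 a *: u a c).
  apply/rowP => j; rewrite !mxE summxE; apply: eq_bigr => a _; by rewrite !mxE.
rewrite (frame_comb _ cq (u0 c cq) ux uv); rowE.
rewrite y0 mul0mx !scale0r hlift0 !addr0.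
by apply: row_ext; rowE.
Qed.
End Reduction.

Section Reducible.
Variables (R : realType) (M : topologicalType) (n : nat) (A : atlas R M n).
Hypothesis hM : smooth_manifold A.
Variable s : sode A.
Let B := M1 A.
Let hB : regular_atlas B := M1_regular hM s.
Implicit Types (c e : idx B) (p q : jet A 1) (v : tvec B) (X Y : vfield B).
Implicit Types (U W : set (jet A 1)).
Local Notation ev i := (delta_mx 0 i : 'rV[R]_n).

(** The connection form of the Chern connection in the induced frame: the
    derivative of d/d\dot x^k along w has the coefficients conn_form c p k w
    ([table_Dv]), and that of X^sigma_k has the same ones ([table_Xi]). The
    equality of the two blocks says that the form takes its values in the Lie
    algebra of G. *)
Definition conn_form c p k (w : 'rV[R]_(1 + (n + n))) : 'rV[R]_n :=
  - (tcoord w *: hlift s c p (ev k) + \sum_j contact c p w 0 j *: dhlift s c p k j).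

Lemma conn_form_linear c p k : linear (conn_form c p k).
Proof.
move=> a w w'; rewrite /conn_form (_ : \sum_j _ = a *: (\sum_j contact c p w 0 j *: dhlift s c p
  k j) +
    \sum_j contact c p w' 0 j *: dhlift s c p k j).
  have -> : tcoord (a *: w + w') = a * tcoord w + tcoord w' by rowE.
  move: (tcoord w) (tcoord w') (hlift _ _ _ _) (\sum_j _) (\sum_j _) => t t' h S S'.
  by apply/rowP => j; rewrite !mxE; ring.
rewrite scaler_sumr -big_split; apply: eq_bigr => j _ /=.
by rewrite contact_linear !mxE scalerDl scalerA.
Qed.
HB.instance Definition _ c p k := GRing.isLinear.Build _ _ _ _ (conn_form c p k)
  (@conn_form_linear c p k).

(** The horizontal lift of vertical vectors as a linear map on rows, so that
    the vertical and the horizontal parts of the frame are treated by the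
    same lemmas. *)
Lemma hor_lin c p : dom B c p ->
  exists l : {linear 'rV[R]_n -> 'rV[R]_(1 + (n + n))}, forall b, l b = txv 0 b (hlift s c p b).
Proof.
move=> cp; have lin : linear (fun b : 'rV[R]_n => txv 0 b (hlift s c p b)).
  move=> k b b'; rewrite (hlift_linear hM s k b b' cp).
  by apply: row_ext; rowE; rewrite ?mulr0 ?addr0.
by exists (HB.pack_for {linear 'rV[R]_n -> 'rV[R]_(1 + (n + n))} (fun b => txv 0 b (hlift s c p
  b)) (GRing.isLinear.Build _ _ _ _ _ lin)).
Qed.

Lemma coef_sum c p w (G : 'I_(1 + (n + n)) -> 'rV[R]_(1 + (n + n))) :
  (forall j, G (iv j) = 0) ->
  \sum_a frame_coef s c p w 0 a *: G a =
  tcoord w *: G (it n) + \sum_j contact c p w 0 j *: G (ix j).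
Proof.
move=> G0; rewrite big_split_ord big_ord1 big_split_ord /=.
rewrite [X in _ + (_ + X)]big1 ?addr0; last by move=> j _; rewrite -[rshift _ _]/(iv j) G0 scaler0.
congr (_ *: _ + _).
  have : tcoord (frame_coef s c p w) = tcoord w by rewrite /frame_coef; rowE.
  by rewrite {1}tcoord.unlock mxE.
apply: eq_bigr => j _; congr (_ *: _).
have : xcoord (frame_coef s c p w) = contact c p w by rewrite /frame_coef; rowE.
by move/(congr1 (fun r : 'rV_n => r 0 j)); rewrite {1}xcoord.unlock !mxE.
Qed.

(** The function is affine in the coordinates of c. *)
Lemma affine_row c p (l : {linear 'rV[R]_(1 + (n + n)) -> 'rV[R]_n}) (b : 'rV[R]_n) :
  dom B c p -> exists f : jet A 1 -> 'rV[R]_n,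
  [/\ f p = b, forall U, mopen B U -> csmooth (A := B) c U f &
      forall w j, cderive (A := B) c w (fun q => f q 0 j) p = l w 0 j].
Proof.
move=> cp; have oc := mopen_dom hB (c := c).
pose f q := b + l (coord B c q + (-1) *: coord B c p).
have sf U : mopen B U -> csmooth (A := B) c U (fun q => l (coord B c q + (-1) *: coord B c p)).
  move=> oU; apply: (csmooth_lin hB oU); apply: (csmoothD hB oU); first exact: (csmooth_coord hB).
  exact: (csmooth_cst hB).
have sb U : mopen B U -> csmooth (A := B) c U (fun=> b) by move=> oU; exact: (csmooth_cst hB).
have sg U : mopen B U -> csmooth (A := B) c U f by move=> oU;
  exact: (csmoothD hB oU (sb U oU) (sf U oU)).
exists f; split=> [|//|w j].
  by rewrite /f scaleN1r subrr linear0 addr0.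
have df := csmooth_cdiff (sg _ oc) cp cp.
have dl := csmooth_cdiff (sf _ oc) cp cp.
have db := csmooth_cdiff (sb _ oc) cp cp.
apply: etrans (cderive_lin hB cp (entry j) w df) _; congr (_ _ _).
apply: etrans (cderiveD hB cp w db dl) _; rewrite (cderive_cst hB cp) add0r.
have dc : cdiff (A := B) c (coord B c) p by exact: (csmooth_cdiff (csmooth_coord hB c oc) cp cp).
have dk : cdiff (A := B) c (fun=> (-1) *: coord B c p) p.
  exact: (csmooth_cdiff (csmooth_cst hB c oc _) cp cp).
apply: etrans (cderive_lin hB cp l w (csmooth_cdiff (csmoothD hB oc (csmooth_coord hB c oc)
  (csmooth_cst hB c oc _)) cp cp)) _.
by rewrite (cderiveD hB cp w dc dk) (cderive_cst hB cp) addr0 (cderive_coord hB cp).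
Qed.

Section Table.
Variables (D : linear_connection B) (ct : chern_table s D).

Lemma table_eval (l : {linear 'rV[R]_n -> 'rV[R]_(1 + (n + n))}) W E Y p c k :
  mopen B W -> smooth_vfield W Y -> W p -> dom B c p -> smooth_vfield (dom B c) E ->
  D (Xs s) E p c = - l (hlift s c p (ev k)) ->
  (forall j, D (Xi s c j) E p c = - l (dhlift s c p k j)) ->
  (forall j, D (Dv c j) E p c = 0) ->
  D Y E p c = l (conn_form c p k (Y p c)).
Proof.
move=> oW sY Wp cp sE E0 E1 E2; have oc := mopen_dom hB (c := c).
have oW' := mopenI hB oW oc.
have Wc : W `&` dom B c `<=` dom B c by move=> q [].
have sY' : smooth_vfield (W `&` dom B c) Y by apply: vf_sub sY => q [].
have tD := cov_tensorial D (vf_sub Wc sE).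
apply: etrans (tensorial_frame hM s tD oW' (conj Wp cp) cp sY') _.
etransitivity.
  apply: (coef_sum c p (Y p c) (G := fun a => D (sigma_frame s c a) E p c)) => j.
  by rewrite sigma_frame_iv.
have lZ a b : l (a *: b) = a *: l b by rewrite linearZ.
cbv beta; rewrite sigma_frame_it E0 /conn_form (linearN l) (linearD l) (linear_sum l) opprD scalerN.
congr (_ + _); first exact: (congr1 (-%R) (esym (lZ _ _))).
rewrite -sumrN; apply: eq_bigr => j _.
by rewrite sigma_frame_ix E1 lZ scalerN.
Qed.

Lemma table_Dv W Y p c k : mopen B W -> smooth_vfield W Y -> W p -> dom B c p ->
  D Y (Dv c k) p c = txv 0 0 (conn_form c p k (Y p c)).
Proof.
move=> oW sY Wp cp; apply: (table_eval (l := insv) oW sY Wp cp (Dv_vf hM s c k)) => [|j|j].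
- exact: (ct_Xs_Dv ct).
- exact: (ct_Xi_Dv ct).
- exact: (ct_Dv_Dv ct).
Qed.

Lemma table_Xi W Y p c k : mopen B W -> smooth_vfield W Y -> W p -> dom B c p ->
  D Y (Xi s c k) p c = txv 0 (conn_form c p k (Y p c)) (hlift s c p (conn_form c p k (Y p c))).
Proof.
move=> oW sY Wp cp; have [l lE] := hor_lin cp; rewrite -lE.
apply: (table_eval (l := l) oW sY Wp cp (Xi_vf hM s c k)) => [|j|j]; rewrite ?lE.
- exact: (ct_Xs_Xi ct).
- exact: (ct_Xi_Xi ct).
- exact: (ct_Dv_Xi ct).
Qed.

(** Let u be adapted at p, with rows Lam i. Extend them by functions lam i
    with lam i = Lam i at p and with a differential at p that compensates the
    connection form. Near p the rows lam i remain independent and hence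
    define a local section of P^sigma, which is parallel at p along v. *)
Lemma table_reducible : reducible D (adapted s).
Proof.
move=> p u v up tgv.
have [c cp] : exists c, dom B c p := sm_cover hM (jtarget p).
have oc := mopen_dom hB (c := c).
have [Lam [ux uv uL]] := adapted_rows hM up cp.
have [[tu _] u0 _ _] := up.
have [l lE] : exists l : 'I_n -> {linear 'rV[R]_(1 + (n + n)) -> 'rV[R]_n},
    forall i w, l i w = - \sum_k Lam i 0 k *: conn_form c p k w.
  have lin i : linear (fun w => - \sum_k Lam i 0 k *: conn_form c p k w).
    move=> a w w'; rewrite scalerN -opprD scaler_sumr -big_split; congr (- _).
    by apply: eq_bigr => k _ /=; rewrite linearP scalerDr !scalerA mulrC.
  by exists (fun i => HB.pack_for {linear 'rV[R]_(1 + (n + n)) -> 'rV[R]_n}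
    (fun w => - \sum_k Lam i 0 k *: conn_form c p k w) (GRing.isLinear.Build _ _ _ _ _ (lin i))).
(* l i is chosen so that the derivatives of the coefficients lam i cancel the
   sum of the Lam i 0 k times the derivatives of the k-th frame fields. *)
have [lam lamE] : exists lam : 'I_n -> jet A 1 -> 'rV[R]_n, forall i,
    [/\ lam i p = Lam i, forall U, mopen B U -> csmooth (A := B) c U (lam i) &
     forall w j, cderive (A := B) c w (fun q => lam i q 0 j) p = l i w 0 j].
  by have [f fE] := boolp.choice (fun i => affine_row (l i) (Lam i) cp); exists f.
have slam U i : mopen B U -> csmooth (A := B) c U (lam i) by have [_ + _] := lamE i; apply.
have sx U i j : mopen B U -> csmooth (A := B) c U (fun q => lam i q 0 j).
  by move=> oU; exact: (csmooth_lin hB oU (entry j) (slam U i oU)).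
have sf U i j : mopen B U -> U `<=` dom B c -> smooth_fun B U (fun q => lam i q 0 j).
  by move=> oU Uc; exact: (sfun_chart hB oU Uc (sx U i j oU)).
pose dt q := \det (\matrix_i lam i q).
have sdt : smooth_fun B (dom B c) dt.
  apply: (sfun_chart hB (c := c) oc) => //; apply: (csmooth_det hB oc) => i j.
  apply: (csmooth_eq hB oc (f := fun q => lam i q 0 j)); last exact: sx.
  by move=> q _ _; rewrite [X in _ = X]mxE.
pose U := dom B c `&` [set q | dt q != 0].
have oU : mopen B U := mopen_nz hB oc sdt.
have Uc : U `<=` dom B c by move=> q [].
have lamp i : lam i p = Lam i by have [] := lamE i.
have Up : U p.
  split=> //=; rewrite /dt (_ : \matrix_i lam i p = \matrix_i Lam i).
    by move: uL; rewrite unitmxE unitfE.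
  by apply/matrixP => i j; rewrite [LHS]mxE [RHS]mxE lamp.
pose S1 i : vfield B := fun q => \sum_j lam i q 0 j *: Xi s c j q.
pose S2 i : vfield B := fun q => \sum_j lam i q 0 j *: Dv c j q.
pose S := frame_family (Xs s : vfield B) S1 S2.
pose Y : vfield B := fun q => tv B c q (v c).
have sXi j := vf_sub Uc (Xi_vf hM s c j).
have sDv j := vf_sub Uc (Dv_vf hM s c j).
have sS a : smooth_vfield U (S a).
  apply: (frame_family_ind (Pr := smooth_vfield U)) => [|i|i].
  - exact: (Xs_vf hM s oU).
  - rewrite /S1; apply: (vf_sum hB _ oU) => j; exact: (vfZ hB oU (sf U i j oU Uc) (sXi j)).
  - rewrite /S2; apply: (vf_sum hB _ oU) => j; exact: (vfZ hB oU (sf U i j oU Uc) (sDv j)).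
have S1c i q : U q -> S1 i q c = txv 0 (lam i q) (hlift s c q (lam i q)).
  by move=> Uq; rewrite /S1 tvsumE; exact: (XiSum hM s _ (Uc q Uq)).
have S2c i q : U q -> S2 i q c = txv 0 0 (lam i q).
  by move=> Uq; rewrite /S2 tvsumE; exact: (DvSum hM s (Uc q Uq)).
have sY : smooth_vfield U Y by apply: (vf_tv hB oU Uc); exact: (csmooth_cst hB).
have Yp : Y p c = v c by exact: (tv_self hB).
have tS a q (Uq : U q) := vf_tvec (sS a) Uq.
exists U, S, Y; split; first exact: conj oU Up.
- split; first exact: sS.
  move=> q Uq; apply: (adapted_of_rows hM (c := c) (lam := fun i => lam i q)) => [|a||i|i|].
  + exact: Uc.
  + exact: tS.
  + by rewrite /S frame_family_it.
  + by rewrite /S frame_family_ix; exact: S1c.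
  + by rewrite /S frame_family_iv; exact: S2c.
  + by rewrite unitmxE unitfE; case: Uq.
- move=> a; apply: (tvec_eq (tS a p Up) (tu a) cp).
  have [->|[i ->]|[i ->]] := index_cases a.
  + by rewrite /S frame_family_it u0.
  + by rewrite /S frame_family_ix S1c // lamp ux.
  + by rewrite /S frame_family_iv S2c // lamp uv.
- exact: conj sY (tvec_eq (vf_tvec sY Up) tgv cp Yp).
move=> a.
have tDS b : is_tvec p (D Y (S b) p) := vf_tvec (cov_smooth D oU sY (sS b)) Up.
apply: (tvec_eq (tDS a) (@is_tvec0 _ _ _ B p) cp).
have dlam i j : dfun (A := B) (fun q => lam i q 0 j) p (Y p) = l i (v c) 0 j.
  have dx e : dom B e p -> cdiff (A := B) e (fun q => lam i q 0 j) p.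
    by move=> ep; exact: (csmooth_cdiff (sf U i j oU Uc e) ep Up).
  rewrite (dfunE hB (vf_tvec sY Up) cp dx) Yp.
  by have [_ _] := lamE i; apply.
have dS E (g : {linear 'rV[R]_n -> 'rV[R]_(1 + (n + n))}) i :
    (forall j, smooth_vfield U (E j)) -> (forall j, E j p c = g (ev j)) ->
    (forall j, D Y (E j) p c = g (conn_form c p j (v c))) ->
    D Y (fun q => \sum_j lam i q 0 j *: E j q) p c = 0.
  move=> sE E0 E1; apply: etrans (cov_sum hB D oU sY (fun j => sf U i j oU Uc) sE Up cp) _.
  transitivity (g (\sum_j (l i (v c) 0 j *: ev j + Lam i 0 j *: conn_form c p j (v c)))).
    rewrite linear_sum; apply: eq_bigr => j _.
    by rewrite dlam lamp E0 E1 linearD !linearZ.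
  by rewrite big_split /= -row_sum_delta lE addNr linear0.
have [->|[i ->]|[i ->]] := index_cases a.
- by rewrite /S frame_family_it; exact: (ct_Xs ct oU sY Up cp).
- have [g gE] := hor_lin cp.
  rewrite /S frame_family_ix.
  refine (dS (Xi s c) g i sXi (fun j => etrans (XiE hM s j cp) (esym (gE _))) (fun j => _)).
  rewrite gE -Yp; exact: (table_Xi j oU sY Up cp).
- rewrite /S frame_family_iv.
  refine (dS (Dv c) insv i sDv (fun j => DvE hM s j cp) (fun j => _)).
  rewrite -Yp; exact: (table_Dv j oU sY Up cp).
Qed.

End Table.
End Reducible.

(** * Uniqueness *)

Section Unique.
Variables (R : realType) (M : topologicalType) (n : nat) (A : atlas R M n).
Hypothesis hM : smooth_manifold A.
Variable s : sode A.
Let B := M1 A.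
Let hB : regular_atlas B := M1_regular hM s.
Implicit Types (c e : idx B) (p q : jet A 1) (v : tvec B) (X Y : vfield B).
Implicit Types (U W : set (jet A 1)).
Local Notation ev i := (delta_mx 0 i : 'rV[R]_n).

Lemma adapted_sigma_frame c p : dom B c p -> adapted s p (fun a => sigma_frame s c a p).
Proof.
move=> cp; apply: (adapted_of_rows hM (c := c) (lam := fun i => ev i)) => [|a||i|i|].
- exact: cp.
- exact: (vf_tvec (sigma_frame_vf hM s c a) cp).
- by rewrite sigma_frame_it.
- by rewrite sigma_frame_ix; exact: (XiE hM s i cp).
- by rewrite sigma_frame_iv; exact: (DvE hM s i cp).
- rewrite (_ : (\matrix_i _) = 1%:M) ?unitmx1 //.
  by apply/matrixP => i j; rewrite !mxE eqxx eq_sym.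
Qed.

Variables (D : linear_connection B).

(** Expanding Z over E and using that Z is parallel at p expresses the
    derivative of E i by the differentials of the coefficients of Z. *)
Lemma cov_coef c U p Y i (g : {linear 'rV[R]_n -> 'rV[R]_(1 + (n + n))})
    (E : 'I_n -> vfield B) (Z : vfield B) (lam : jet A 1 -> 'rV[R]_n) :
  mopen B U -> U `<=` dom B c -> U p -> smooth_vfield U Y ->
  (forall j, smooth_vfield U (E j)) -> (forall j, E j p c = g (ev j)) ->
  smooth_vfield U Z -> csmooth (A := B) c U lam ->
  (forall q, U q -> Z q c = \sum_j lam q 0 j *: E j q c) -> lam p = ev i ->
  D Y Z p c = 0 ->
  D Y (E i) p c = g (- \row_j dfun (A := B) (fun q => lam q 0 j) p (Y p)).
Proof.
move=> oU Uc Up sY sE Ep sZ sl ZE lp DZ.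
have sx j : smooth_fun B U (fun q => lam q 0 j).
  exact: (sfun_chart hB oU Uc (csmooth_lin hB oU (entry j) sl)).
pose Z' : vfield B := fun q => \sum_j lam q 0 j *: E j q.
have sZ' : smooth_vfield U Z'.
  by rewrite /Z'; apply: (vf_sum hB _ oU) => j; exact: (vfZ hB oU (sx j) (sE j)).
have ZZ q : U q -> veq q (Z q) (Z' q).
  move=> Uq; apply: (tvec_eq (vf_tvec sZ Uq) (vf_tvec sZ' Uq) (Uc q Uq)).
  by rewrite /Z' tvsumE; exact: ZE.
have cp := Uc p Up.
have E1 := etrans (esym (cov_localr D oU sY sZ sZ' ZZ Up cp)) DZ.
have E2 := etrans (esym (cov_sum hB D oU sY sx sE Up cp)) E1.
move: E2; rewrite big_split /=.
rewrite [X in _ + X](_ : _ = D Y (E i) p c); last first.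
  rewrite (bigD1 i) //= lp mxE !eqxx scale1r big1 ?addr0 // => j ji.
  by rewrite mxE eqxx (negbTE ji) scale0r.
rewrite (eq_bigr (fun j => dfun (A := B) (fun q => lam q 0 j) p (Y p) *: g (ev j))); last first.
  by move=> j _; rewrite Ep.
move=> /eqP; rewrite addrC addr_eq0 => /eqP ->.
rewrite (linearN g) [in RHS](row_sum_delta (\row_j _)) (linear_sum g); congr (- _).
by apply: eq_bigr => j _; rewrite linearZ mxE.
Qed.

Hypothesis red : reducible D (adapted s).

(** The infinitesimal form of reducibility: X^sigma is parallel, and
    X^sigma_i and d/d\dot x^i are differentiated with the same coefficients
    b. Apply the definition to the induced frame at p: the parallel section
    it provides is adapted, so the coefficients lam of its horizontal and of
    its vertical members in the induced frame are the same functions. *)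
Lemma reducible_frame c p W Y : mopen B W -> smooth_vfield W Y -> W p -> dom B c p ->
  D Y (Xs s) p c = 0 /\
  forall i, exists b, D Y (Xi s c i) p c = txv 0 b (hlift s c p b) /\ D Y (Dv c i) p c = txv 0 0 b.
Proof.
move=> oW sY Wp cp; have tY := vf_tvec sY Wp.
have [U [S [Y1 [[oU Up] [sS aS] Su [sY1 Y1p] DS]]]] := red (adapted_sigma_frame cp) tY.
pose V := U `&` W `&` dom B c.
have oV : mopen B V := mopenI hB (mopenI hB oU oW) (mopen_dom hB (c := c)).
have Vp : V p by [].
have VU : V `<=` U by move=> q [[]].
have VW : V `<=` W by move=> q [[]].
have vconn : V `<=` dom B c by move=> q [].
have sSV a := vf_sub VU (sS a).
have sYV := vf_sub VW sY; have sY1V := vf_sub VU sY1.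
have YY Z : smooth_vfield V Z -> D Y Z p c = D Y1 Z p c.
  move=> sZ; apply: (tensorial_pt hB (cov_tensorial D sZ) oV Vp cp sYV sY1V).
  exact: esym (Y1p c cp).
have sX := Xs_vf hM s oV.
have sXi j := vf_sub vconn (Xi_vf hM s c j).
have sDv j := vf_sub vconn (Dv_vf hM s c j).
split.
  rewrite (YY _ sX); apply: etrans (DS (it n) c cp).
  apply: (cov_localr D oV sY1V sX (sSV _)) => // q Vq e eq.
  by have [_ H _ _] := aS q (VU q Vq); rewrite (H e eq).
move=> i; pose lam q := vcoord (S (iv i) q c).
have sl : csmooth (A := B) c V lam by exact: (csmooth_lin hB oV (@vcoord R n)
  (vf_csmooth c (sSV _))).
have lp : lam p = ev i by rewrite /lam (Su (iv i) c cp) sigma_frame_iv (DvE hM s i cp); rowE.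
have Sc q : V q -> S (ix i) q c = txv 0 (lam q) (hlift s c q (lam q)) /\ S (iv i)
  q c = txv 0 0 (lam q).
  move=> Vq; have [r [rx rv _]] := adapted_rows hM (aS q (VU q Vq)) (vconn q Vq).
  have -> : lam q = r i by rewrite /lam rv; rowE.
  by split.
have [g gE] := hor_lin hM s cp.
exists (- \row_j dfun (A := B) (fun q => lam q 0 j) p (Y1 p)); split.
  rewrite (YY _ (sXi i)) -gE.
  apply: (cov_coef (g := g) oV vconn Vp sY1V sXi _ (sSV (ix i)) sl _ lp (DS _ c cp)).
    by move=> j; rewrite gE; exact: (XiE hM s j cp).
  by move=> q Vq; rewrite (XiSum hM s _ (vconn q Vq)); exact: (Sc q Vq).1.
rewrite (YY _ (sDv i)).
apply: (cov_coef (g := insv) oV vconn Vp sY1V sDv _ (sSV (iv i)) sl _ lp (DS _ c cp)).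
  by move=> j; exact: (DvE hM s j cp).
by move=> q Vq; rewrite (DvSum hM s (vconn q Vq)); exact: (Sc q Vq).2.
Qed.

Hypothesis tor : has_torsion_Ts s D.

(** D has the same torsion as the Chern connection, so both have the same
    antisymmetrization. For the pair (X^sigma_j, d/d\dot x^i) the two
    derivatives are one vertical, the other horizontal, and so each is
    determined; for the pair (X^sigma, d/d\dot x^i) one of them is zero. The
    other derivatives of frame fields follow by equality of the coefficients
    of X^sigma_i and d/d\dot x^i. *)
Lemma reducible_torsion_table : chern_table s D.
Proof.
pose D0 := chern hM s.
have ct : chern_table s D0 := chern_is_table hM s.
have tor0 : has_torsion_Ts s D0 := table_torsion hM ct.
(* The bracket cancels between the two torsions. *)
have torsion_diff c p X Y : dom B c p -> smooth_vfield (dom B c) X -> smooth_vfield (dom B c) Y ->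
    D X Y p c - D Y X p c = D0 X Y p c - D0 Y X p c.
  move=> cp sX sY; have oc := mopen_dom hB (c := c).
  have E := etrans (tor oc sX sY cp cp) (esym (tor0 _ _ _ oc sX sY p cp c cp)).
  have := etrans (esym (torsionE D X Y p c)) (etrans E (torsionE D0 X Y p c)).
  exact: addIr.
have xs c p X : dom B c p -> smooth_vfield (dom B c) X -> D X (Xs s) p c = 0.
  by move=> cp sX; have [] := reducible_frame (mopen_dom hB (c := c)) sX cp cp.
have fr c p X i : dom B c p -> smooth_vfield (dom B c) X -> exists b,
    D X (Xi s c i) p c = txv 0 b (hlift s c p b) /\ D X (Dv c i) p c = txv 0 0 b.
  by move=> cp sX; have [_] := reducible_frame (mopen_dom hB (c := c)) sX cp cp; apply.
have neg c p b : dom B c p -> txv 0 (- b) (hlift s c p (- b)) = - txv 0 b (hlift s c p b).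
  by move=> cp; have [g gE] := hor_lin hM s cp; rewrite -!gE linearN.
have negv b : txv 0 0 (- b) = - txv 0 0 b :> 'rV[R]_(1 + (n + n)).
  by have := linearN (@insv R n) b.
have XsV c p i : dom B c p ->
    D (Xs s) (Xi s c i) p c = txv 0 (- hlift s c p (ev i)) (hlift s c p (- hlift s c p (ev i))) /\
    D (Xs s) (Dv c i) p c = txv 0 0 (- hlift s c p (ev i)).
  move=> cp; have oc := mopen_dom hB (c := c); have sX := Xs_vf hM s oc.
  have [b [H1 H2]] := fr c p (Xs s) i cp sX.
  have E := torsion_diff c p (Xs s) (Dv c i) cp sX (Dv_vf hM s c i).
  have E1 := xs c p (Dv c i) cp (Dv_vf hM s c i).
  have E2 := ct_Xs ct oc (Dv_vf hM s c i) cp cp.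
  have E3 := ct_Xs_Dv ct i cp.
  have {E} : txv 0 0 b - 0 = - txv 0 0 (hlift s c p (ev i)) - 0 :> 'rV[R]_(1 + (n + n)).
    by rewrite -E3 -[X in _ - X = _]E1 -[X in _ = _ - X]E2 -H2.
  rewrite !subr0 => E; have bE : b = - hlift s c p (ev i).
    by have := congr1 (@vcoord R n) E; rowE.
  by rewrite -bE.
have XiDv c p i j : dom B c p ->
    [/\ D (Xi s c j) (Xi s c i) p c = txv 0 (- dhlift s c p i j) (hlift s c p (- dhlift s c p i j)),
        D (Xi s c j) (Dv c i) p c = txv 0 0 (- dhlift s c p i j),
        D (Dv c i) (Xi s c j) p c = 0 & D (Dv c i) (Dv c j) p c = 0].
  move=> cp; have oc := mopen_dom hB (c := c).
  have sX := Xi_vf hM s c j; have sV := Dv_vf hM s c i.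
  have [b [H1 H2]] := fr c p (Xi s c j) i cp sX.
  have [b' [H3 H4]] := fr c p (Dv c i) j cp sV.
  have E := torsion_diff c p (Xi s c j) (Dv c i) cp sX sV.
  have E1 := ct_Xi_Dv ct i j cp.
  have E2 := ct_Dv_Xi ct j i cp.
  have {E} E : txv 0 0 b - txv 0 b' (hlift s c p b') = - txv 0 0 (dhlift s c p i j)
    - 0 :> 'rV[R]_(1 + (n + n)).
    by rewrite -E1 -[X in _ = _ - X]E2 -H2 -H3.
  (* The x-parts of E give b', the \dot x-parts then give b. *)
  have b0 : b' = 0.
    by have := congr1 (@xcoord R n) E; rowE; rewrite sub0r subr0 oppr0 => /eqP;
      rewrite oppr_eq0 => /eqP.
  have bE : b = - dhlift s c p i j.
    by have := congr1 (@vcoord R n) E; rowE; rewrite b0 hlift0 !subr0.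
  have z : txv 0 0 0 = 0 :> 'rV[R]_(1 + (n + n)) by apply: row_ext; rowE.
  by split; [rewrite -bE|rewrite -bE|rewrite H3 b0 hlift0|rewrite H4 b0].
split.
- by move=> U Y oU sY p c Up cp; have [] := reducible_frame oU sY Up cp.
- by move=> c p i cp; have [H _] := XsV c p i cp; exact: etrans H (neg _ _ _ cp).
- by move=> c p i cp; have [_ H] := XsV c p i cp; exact: etrans H (negv _).
- by move=> c p i j cp; have [H _ _ _] := XiDv c p i j cp; exact: etrans H (neg _ _ _ cp).
- by move=> c p i j cp; have [_ H _ _] := XiDv c p i j cp; exact: etrans H (negv _).
- by move=> c p i j cp; have [_ _ H _] := XiDv c p j i cp; exact: H.
- by move=> c p i j cp; have [_ _ _ H] := XiDv c p j i cp; exact: H.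
Qed.
End Unique.

Theorem theorem4p4 (R : realType) (n : nat) (M : topologicalType)
    (A : atlas R M n) (hM : smooth_manifold A) (hconn : connected [set: M])
    (s : sode A) :
  (exists D : linear_connection (M1 A), is_Chern s D) /\
  (forall D : linear_connection (M1 A), is_Chern s D ->
    [/\ reducible D (adapted s), has_torsion_Ts s D &
        forall D' : linear_connection (M1 A),
          reducible D' (adapted s) -> has_torsion_Ts s D' -> conn_eq D' D]).
Proof.
split; first by exists (chern hM s); apply: (table_Chern hM); exact: chern_is_table.
move=> D /(Chern_table hM) ct; split.
- exact: table_reducible.
- exact: table_torsion.
- move=> D' red tor; apply: (table_unique hM (s := s)) => //.
  exact: reducible_torsion_table.
Qed.
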